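(* Let $d\ge 2$, let $0<r<1$, and let $c_1(t),c_2(t),\mathrm{b}_1(t),\mathrm{b}_2(t)$ be slowly varying functions with $\lim_{t\to\infty}\mathrm{b}_1(t)/\mathrm{b}_2(t)=1$. Let $\tau=(\tau_e)_{e\in\mathbb{E}^d}$ be i.i.d. non-negative random variables such that $\mathbb{P}(\tau_e=0)<p_c(d)$ and, for all $t>0$, $$c_1(t)\exp(-\mathrm{b}_1(t)t^r)\le\mathbb{P}(\tau_e>t)\le c_2(t)\exp(-\mathrm{b}_2(t)t^r).$$ Then for any $\xi>0$ and any $x\in\mathbb{R}^d\setminus\{0\}$, $$\lim_{n\to\infty}\frac{1}{\mathrm{b}_1(n)\,n^r}\log\mathbb{P}\big(\mathrm{T}(0,nx)>n(\mu(x)+\xi)\big)=-2d\,\xi^r.$$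
   Context: A function $f(t)$, $t>0$, is slowly varying if for any $a>0$, $f(a)>0$ and $\lim_{t\to\infty}f(at)/f(t)=1$. First-passage percolation on $\mathbb{Z}^d$: $\mathbb{E}^d$ is the set of (undirected) nearest-neighbour edges of $\mathbb{Z}^d$ and each edge $e$ carries the weight $\tau_e$. A path is a finite sequence $(x_i)_{i=1}^l$ in $\mathbb{Z}^d$ with $|x_i-x_{i+1}|_1=1$ for all $i$ (also regarded as a set of edges). The passage time of a path $\gamma$ is $\mathrm{T}(\gamma)=\sum_{e\in\gamma}\tau_e$. For $x\in\mathbb{R}^d$, $\lfloor x\rfloor=(\lfloor x_1\rfloor,\dots,\lfloor x_d\rfloor)$. For $x,y\in\mathbb{R}^d$, the first passage time is $\mathrm{T}(x,y)=\inf_\gamma \mathrm{T}(\gamma)$, the infimum over all finite paths $\gamma$ from $\lfloor x\rfloor$ to $\lfloor y\rfloor$. $p_c(d)$ is the critical probability of Bernoulli bond percolation on $\mathbb{Z}^d$. Since $\mathbb{E}\tau_e<\infty$, by Kingman's subadditive ergodic theorem for each $x\in\mathbb{R}^d$ there is a non-random constant $\mu(x)\ge 0$ (the time constant) with $\mu(x)=\lim_{t\to\infty}t^{-1}\mathrm{T}(0,tx)=\lim_{t\to\infty}t^{-1}\mathbb{E}[\mathrm{T}(0,tx)]$ almost surely.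
   Formalization: The slowly varying functions c_1, c_2, b_1, b_2 are additionally assumed measurable on (0,∞), as in Karamata's standard definition; without this the claim fails for non-measurable examples built from a Hamel basis. *)

(* Defs.v *)
From HB Require Import structures.
From mathcomp Require Import all_boot all_order all_algebra finmap.
From mathcomp Require Import all_classical all_reals all_analysis.

Set Implicit Arguments.
Unset Strict Implicit.
Unset Printing Implicit Defensive.

Import Order.TTheory GRing.Theory Num.Theory.
Import numFieldNormedType.Exports.

Local Open Scope classical_set_scope.
Local Open Scope ring_scope.

(* Measurability is part of the standard (Karamata) notion of slow variation.
   Without it a Hamel-basis construction gives positive f with
   f (a * t) / f t --> 1 for every a > 0 for which the regular-variation
   arguments fail. Values of f outside ]0, +oo[ play no role. *)
Definition slowly_varying (R : realType) (f : R -> R) : Prop :=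
  [/\ measurable_fun (`]0, +oo[%classic : set R) f,
      forall a, 0 < a -> 0 < f a &
      forall a, 0 < a -> f (a * t) / f t @[t --> +oo] --> (1 : R)].

Section independence.
Context {R : realType} {disp disp' : measure_display}.
Context {Omega : measurableType disp} {E : measurableType disp'}.
Context {I : choiceType}.

Definition mutually_independent (P : probability Omega R)
    (X : I -> {RV P >-> E}) : Prop :=
  forall (J : {fset I}) (B : I -> set E), (forall i, measurable (B i)) ->
    P (\bigcap_(i in [set` J]) (X i @^-1` B i)) =
    (\prod_(i <- J) P (X i @^-1` B i))%E.

Definition identically_distributed (P : probability Omega R)
    (X : I -> {RV P >-> E}) : Prop :=
  forall (i j : I) (B : set E), measurable B ->
    distribution P (X i) B = distribution P (X j) B.

Definition iid (P : probability Omega R) (X : I -> {RV P >-> E}) : Prop :=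
  mutually_independent X /\ identically_distributed X.

End independence.

Definition lattice (d : nat) : countType := 'rV[int]_d.

Definition adjacent (d : nat) (x y : lattice d) : bool :=
  \sum_(i < d) `|x 0 i - y 0 i| == 1.

Definition is_edge (d : nat) (e : {fset lattice d}) : bool :=
  `[< exists x y : lattice d, adjacent x y /\ e = [fset x; y]%fset >].

Definition edge (d : nat) : countType := {e : {fset lattice d} | is_edge e}.

(* A path with vertices x, p_0, ..., p_(l-1) is given by its first vertex x and
   the sequence p of the others; p = [::] is the path reduced to x. *)
Definition is_path (d : nat) (x y : lattice d) (p : seq (lattice d)) : Prop :=
  path (@adjacent d) x p /\ last x p = y.

Definition path_edges (d : nat) (x : lattice d) (p : seq (lattice d)) :
    set (edge d) :=
  [set e | exists2 i, (i < size p)%N &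
     val e = [fset nth x (x :: p) i; nth x (x :: p) i.+1]%fset].

(* The path is regarded as a set of edges: an edge crossed several times is
   counted once. *)
Definition passage_time (R : realType) (d : nat) (w : edge d -> R)
    (x : lattice d) (p : seq (lattice d)) : R :=
  \sum_(e \in path_edges x p) w e.

Definition floor_point (R : realType) (d : nat) (x : 'rV[R]_d) : lattice d :=
  \row_(i < d) Num.floor (x 0 i).

Definition first_passage_time (R : realType) (d : nat) (w : edge d -> R)
    (x y : 'rV[R]_d) : R :=
  inf [set passage_time w (floor_point x) p |
       p in [set p | is_path (floor_point x) (floor_point y) p]].

Definition time_constant (R : realType) (d : nat) (disp : measure_display)
    (Omega : measurableType disp) (P : probability Omega R)
    (tau : edge d -> {RV P >-> R}) (x : 'rV[R]_d) : R :=
  lim (t^-1 * fine 'E_P[fun omega =>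
         first_passage_time (fun e => tau e omega) 0 (t *: x)]
       @[t --> +oo]).

Definition open_cluster (d : nat) (o : edge d -> bool) (x : lattice d) :
    set (lattice d) :=
  [set y | exists2 p, is_path x y p & forall e, path_edges x p e -> o e].

(* The percolation probability theta(p) depends only on the law of the
   configuration; theta(p) > 0 is expressed on some space carrying i.i.d.
   Bernoulli(p) edge states. *)
Definition percolates (R : realType) (d : nat) (p : R) : Prop :=
  exists (disp : measure_display) (Omega : measurableType disp)
    (P : probability Omega R) (o : edge d -> {RV P >-> bool}),
    [/\ mutually_independent o,
        forall e, P [set omega | o e omega] = p%:E &
        (0 < P [set omega |
                infinite_set (open_cluster (fun e => o e omega) 0%R)])%E].

(* p_c(d) = inf {p in [0, 1] | theta(p) > 0}. *)
Definition critical_probability (R : realType) (d : nat) : R :=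
  inf [set p : R | 0 <= p <= 1 /\ percolates d p].

(* Main.v *)
From HB Require Import structures.
Require Import Defs.
From mathcomp Require Import all_boot all_order all_algebra finmap.
From mathcomp Require Import all_classical all_reals all_analysis.
From mathcomp Require Import measurable_realfun.
From mathcomp Require Import ring lra zify.

Set Implicit Arguments.
Unset Strict Implicit.
Unset Printing Implicit Defensive.

Import Order.TTheory GRing.Theory Num.Theory.
Import numFieldNormedType.Exports.

Local Open Scope classical_set_scope.
Local Open Scope ring_scope.

(** Write [T] for the passage time from the origin to the lattice point below
    [n *: x], [mu] for the time constant and [rate t] for [b t * t `^ r], the
    exponent of the tail of one edge. Since [r < 1] the rate is sublinear: the
    cheapest way to make a sum of edge weights large is to make a single weight
    large. Every path leaves the origin through one of its
    [2 * d] edges, so [T] exceeds its typical value [n * mu] by [n * xi] as soon as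
    each of these [2 * d] weights does. To first order in the exponent this has
    probability [expR (- (2 * d * rate (n * xi)))]; the theorem says that nothing is
    cheaper.

    The lower bound makes this precise. With the edges at the origin set to zero,
    the passage time depends on the other edges only, and it is still near
    [n * mu] with probability bounded away from zero, because its mean is close to
    that of [T] ([ET_le_zeroed], [zeroed_likely]). Independence then gives
    [star_raise] and [lower_bound].

    For the upper bound, [2 * d] routes with pairwise disjoint edge sets are drawn
    from the origin to the target ([routes]). Route number [q] leaves the origin
    along the unit vector [q], moves sideways into a lane of its own, parallel to
    the ray through [x], follows the lane, and enters the target from the
    direction reflected from [q]. A lane is covered by boxes of fixed size that
    are placed at equal distances along it, and the passage time through a box,
    with all weights capped at a constant [M], has mean close to the distance
    travelled times [mu] ([block_choice]). The total along a lane is a sum of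
    bounded variables with finite range of dependence, so that it exceeds
    [n * (mu + small)] with probability exponentially small in [n]
    ([block_deviation]), which is negligible against the rate. Apart from this
    event, [T > n * (mu + xi)] forces, on each of the [2 * d] routes, the excesses
    of the weights above [M] to sum to almost [n * xi]. An exponential Chebyshev
    inequality shows that this costs as much as one edge of weight [n * xi]
    ([excess_sum_deviation]), and the routes are independent, whence the factor
    [2 * d] in the exponent ([deviation_intersection], [upper_bound]).

    Both estimates compare the slowly varying functions at distant arguments,
    which rests on Karamata's uniform convergence theorem in the form of Potter's
    bounds ([slowly_varying_potter]). The probabilistic estimates are proved for
    the law of the weights on the product space of all real configurations
    ([field]), where shifts and resampling act on the configurations themselves. *)

(** * Uniform convergence and Potter bounds for slowly varying functions *)

Section translation.
Variable R : realType.
Local Notation mu := (@lebesgue_measure R).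

Lemma measurable_shift (c : R) :
  measurable_fun setT ((fun s => s - c) : measurableTypeR R -> measurableTypeR R).
Proof. by apply: measurable_funB => //; exact: measurable_id. Qed.

Lemma lebesgue_measure_shift (c : R) (A : set R) : measurable A ->
  pushforward mu ((fun s => s - c) : _ -> measurableTypeR R) A = mu A.
Proof.
move=> mA; apply/esym/lebesgue_measure_unique => //=; first exact: measurable_shift.
move=> mf _ [[a b]] _ <-.
rewrite /pushforward (_ : _ @^-1` _ = `]a + c, b + c]%classic); last first.
  by apply/seteqP; split=> s /=; rewrite !in_itv/= ltrBrDr lerBlDr.
by rewrite !lebesgue_measure_itv/= !lte_fin ltrD2r -!EFinB opprD addrACA subrr addr0.
Qed.

Lemma ge0_integral_shift (c : R) (D : set R) (f : R -> \bar R) :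
  measurable D -> measurable_fun setT f -> (forall s, 0 <= f s)%E ->
  (\int[mu]_(s in D) f s =
   \int[mu]_(s in (fun s => (s - c)%R) @^-1` D) f (s - c)%R)%E.
Proof.
move=> mD mf f0.
rewrite -(@ge0_integral_pushforward _ _ _ _ _ _ (@measurable_shift c) mu D f)//=;
  last exact: measurable_funS mf.
apply: eq_measure_integral => [|mf2 A mA AS]; first exact: measurable_shift.
by apply/esym; exact: lebesgue_measure_shift.
Qed.

End translation.

Section uniform_convergence.
Variables (R : realType) (h : R -> R).
Hypothesis mh : measurable_fun setT h.
Hypothesis hcvg : forall a, h (u + a) - h u @[u --> +oo] --> (0 : R).
Local Notation mu := (@lebesgue_measure R).

Let clip (e : R) (x : R) : \bar R := (Num.min `|x| e)%:E.

Let clip_ge0 e x : 0 < e -> (0 <= clip e x)%E.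
Proof. by move=> e0; rewrite lee_fin le_min normr_ge0 ltW. Qed.

Let measurable_clip e (c v : R) : measurable_fun setT (fun a => clip e (h (v + a) - c)).
Proof.
apply/measurable_EFinP; apply: measurable_minr => //.
apply: measurableT_comp => //; apply: measurable_funB => //.
by apply: measurableT_comp => //; exact: measurable_funD.
Qed.

(** Clipping at [e] provides the domination that the pointwise convergence of
    the increments needs. *)
Lemma integral_clip_cvg (e : R) (v : nat -> R) : 0 < e -> v @ \oo --> +oo ->
  (\int[mu]_(a in `[0%R, 2%R]) clip e (h (v n + a)%R - h (v n))%R)%E @[n --> \oo] --> 0%E.
Proof.
move=> e0 voo.
have mD : measurable (`[0, 2]%classic : set R) by exact: measurable_itv.
have [|||||_ _] := @dominated_convergence _ _ _ mu _ mD
  (fun n a => clip e (h (v n + a) - h (v n))) (cst 0%E) (cst e%:E).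
- by move=> n; apply: measurable_funTS; exact: measurable_clip.
- exact: measurable_cst.
- apply: aeW => a _.
  have ha : (h (v n + a) - h (v n)) @[n --> \oo] --> (0 : R).
    exact: (cvg_comp _ _ voo (hcvg a)).
  apply: cvg_EFin; first by near=> n.
  apply/cvgrPdist_lt => d d0; near=> n.
  rewrite sub0r normrN ger0_norm; last by rewrite le_min normr_ge0 ltW.
  rewrite gt_min; apply/orP; left.
  near: n; move/cvgrPdist_lt : ha => /(_ _ d0); apply: filterS => n.
  by rewrite sub0r normrN.
- apply/integrableP; split; first exact: measurable_cst.
  under eq_integral do rewrite /= gtr0_norm//.
  rewrite integral_cst//= lebesgue_measure_itv/= lte_fin ltr0n/= -EFinB -EFinM.
  exact: ltry.
- apply: aeW => a n _; rewrite gee0_abs ?clip_ge0//.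
  by rewrite lee_fin ge_min lexx orbT.
by rewrite integral0.
Unshelve. all: by end_near. Qed.

(** Karamata's uniform convergence theorem in additive form. If uniformity
    failed along points [u n] and [u n + a n], then every [s] in [[1, 2]] would
    see [h (u n + s)] far from [h (u n)] or from [h (u n + a n)]; by
    translation invariance both deviations have vanishing integrals. *)
Lemma slow_variation_uniform (e : R) : 0 < e ->
  exists U, forall u a, U <= u -> 0 <= a <= 1 -> `|h (u + a) - h u| <= e.
Proof.
move=> e0; apply: contrapT => nU.
have /choice [p hp] : forall n : nat, exists p : R * R,
    [/\ n%:R <= p.1, 0 <= p.2 <= 1 & e < `|h (p.1 + p.2) - h p.1|].
  move=> n; apply: contrapT => np; apply: nU; exists n%:R => u a nu a01.
  by rewrite leNgt; apply/negP => lt; apply: np; exists (u, a).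
pose u n := (p n).1; pose a n := (p n).2.
have uoo : u @ \oo --> +oo.
  apply/cvgryPge => A; near=> n; have [+ _ _] := hp n; apply: le_trans.
  by near: n; exact: nbhs_infty_ger.
have uaoo : (u n + a n) @[n --> \oo] --> +oo.
  apply/cvgryPge => A; near=> n; have [_ /andP[a0 _] _] := hp n.
  rewrite (@le_trans _ _ (u n)) ?lerDl//.
  by near: n; move/cvgryPge : uoo; exact.
have I1 := integral_clip_cvg e0 uoo.
have I2 := integral_clip_cvg e0 uaoo.
have := cvgeD _ I1 I2; rewrite adde0 => /(_ _ isT) I12.
pose F n s := clip e (h (u n + s) - h (u n)).
pose G n s := clip e (h (u n + a n + s) - h (u n + a n)).
have F0 n s : (0 <= F n s)%E by exact: clip_ge0.
have G0 n s : (0 <= G n s)%E by exact: clip_ge0.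
have mF n : measurable_fun setT (F n) by exact: measurable_clip.
have mG n : measurable_fun setT (G n) by exact: measurable_clip.
have key n : (e%:E <= \int[mu]_(s in `[0%R, 2%R]) F n s
                     + \int[mu]_(s in `[0%R, 2%R]) G n s)%E.
  have [_ /andP[a0 a1] far] := hp n; rewrite -/(u n) -/(a n) in a0 a1 far.
  have m12 : measurable (`[1, 2]%classic : set R) by exact: measurable_itv.
  have m02 : measurable (`[0, 2]%classic : set R) by exact: measurable_itv.
  rewrite [in X in (_ <= _ + X)%E](@ge0_integral_shift _ (a n))//=.
  have mpre : measurable ((fun s : R => s - a n) @^-1` `[0, 2]%classic).
    by rewrite -[X in measurable X]setTI; exact: (@measurable_shift R (a n)).
  have mG2 : measurable_fun setT (fun s : R => G n (s - a n)).
    apply: (measurableT_comp (mG n)); apply: measurable_funB => //.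
  have mFG : measurable_fun (setT : set R) (fun s => F n s + G n (s - a n)%R)%E.
    exact: emeasurable_funD.
  apply: (@le_trans _ _ (\int[mu]_(s in `[1%R, 2%R]) (F n s + G n (s - a n)%R))%E).
    rewrite (_ : e%:E = \int[mu]_(s in `[1%R, 2%R]) cst e%:E s)%E; last first.
      rewrite integral_cst//= lebesgue_measure_itv/= lte_fin.
      by rewrite ltr1n/= -EFinB -EFinM; congr _%:E; ring.
    apply: ge0_le_integral => //=.
    - by move=> *; rewrite lee_fin ltW.
    - exact: measurable_funTS.
    move=> s _; rewrite /F /G (_ : u n + a n + (s - a n) = u n + s); last by ring.
    rewrite /clip -EFinD lee_fin.
    have tri : `|h (u n + a n) - h (u n)| <=
        `|h (u n + s) - h (u n)| + `|h (u n + s) - h (u n + a n)|.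
      rewrite (_ : h (u n + a n) - h (u n) =
        (h (u n + s) - h (u n)) - (h (u n + s) - h (u n + a n))); last by ring.
      exact: ler_normB.
    have c1 := normr_ge0 (h (u n + s) - h (u n)).
    have c2 := normr_ge0 (h (u n + s) - h (u n + a n)).
    by rewrite /Num.min; case: ifP => ?; case: ifP => ?; lra.
  rewrite ge0_integralD//=; last 2 first.
  - exact: (measurable_funTS (mF n)).
  - exact: (measurable_funTS mG2).
  apply: leeD; apply: ge0_subset_integral => //=.
  - exact: (measurable_funTS (mF n)).
  - by move=> s /=; rewrite !in_itv/= => /andP[s1 ->]; rewrite (le_trans _ s1).
  - exact: (measurable_funTS mG2).
  - move=> s /=; rewrite !in_itv/= => /andP[s1 s2].
    by rewrite subr_ge0 (le_trans a1)//= (le_trans _ s2)// gerBl.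
have : (e%:E <= 0)%E.
  by apply: (cvge_ge _ I12); near=> n; exact: key.
by rewrite lee_fin leNgt e0.
Unshelve. all: by end_near. Qed.

(** A chain of unit steps, each of which changes [h] by at most [e]. *)
Lemma slow_variation_linear (e : R) : 0 < e ->
  exists U, forall u v, U <= u -> u <= v -> `|h v - h u| <= e * (v - u + 1).
Proof.
move=> e0; have [U hU] := slow_variation_uniform e0; exists U.
have steps n u v : U <= u -> u <= v -> v <= u + n%:R -> `|h v - h u| <= e * n%:R.
  elim: n u => [|n IH] u Uu uv vun.
    have -> : u = v by apply/eqP; rewrite eq_le uv -[u]addr0.
    by rewrite subrr normr0 mulr0.
  have [vu1|u1v] := leP v (u + 1).
    rewrite -(subrKC u v) (le_trans (hU _ _ Uu _))//; first by apply/andP; lra.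
    by rewrite ler_peMr ?ler1n// ltW.
  have -> : h v - h u = (h v - h (u + 1)) + (h (u + 1) - h u) by ring.
  rewrite (le_trans (ler_normD _ _))// -natr1 mulrDr mulr1 lerD//.
    by apply: IH; [lra|lra|rewrite -natr1 in vun; lra].
  by apply: hU => //; apply/andP; lra.
move=> u v Uu uv; have vu0 : 0 <= v - u by rewrite subr_ge0.
have /andP[tl tu] := Num.Theory.truncn_itv vu0.
rewrite (le_trans (steps (Num.truncn (v - u)).+1 u v Uu uv _))//.
  by rewrite -lerBlDl ltW.
by rewrite ler_pM2l// -natr1 lerD2r.
Qed.

End uniform_convergence.

Section potter.
Variable R : realType.
Implicit Types f : R -> R.

Lemma cvg_expR_pinfty : @expR R u @[u --> +oo] --> +oo.
Proof.
apply/cvgryPge => A; near=> u; rewrite (le_trans _ (expR_ge1Dx u))//.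
by rewrite -lerBlDl; near: u; apply: nbhs_pinfty_ge; exact: num_real.
Unshelve. all: by end_near. Qed.

(** In the variable [u = ln t] this is the linear bound on the increments of
    [ln (f (expR u))]. *)
Lemma slowly_varying_potter f (e : R) : slowly_varying f -> 0 < e ->
  exists2 T, 1 <= T & forall s t, T <= s -> s <= t ->
    f t <= expR e * (t / s) `^ e * f s /\ f s <= expR e * (t / s) `^ e * f t.
Proof.
move=> [mf f0 fcvg] e0; pose h u := ln (f (expR u)).
have hE u : h u = ln (f (expR u)) by [].
have fE u : f (expR u) = expR (h u) by rewrite lnK// posrE f0// expR_gt0.
have mh : measurable_fun setT h.
  apply: measurableT_comp; first exact: measurable_ln.
  apply: (measurable_comp (F := `]0, +oo[%classic : set R)) => //.
    by move=> _ [u _ <-] /=; rewrite in_itv/= andbT expR_gt0.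
have hcvg a : h (u + a) - h u @[u --> +oo] --> (0 : R).
  rewrite -ln1.
  have : f (expR a * expR u) / f (expR u) @[u --> +oo] --> (1 : R).
    exact: (cvg_comp _ _ cvg_expR_pinfty (fcvg _ (expR_gt0 a))).
  move=> /(continuous_cvg _ (continuous_ln ltr01)).
  apply: cvg_trans; apply: near_eq_cvg; near=> u.
  rewrite /= !hE ln_div ?posrE ?f0 ?mulr_gt0 ?expR_gt0//.
  by rewrite -expRD (addrC a).
have [U hU] := slow_variation_linear mh hcvg e0.
exists (Num.max 1 (expR U)); first by rewrite le_max lexx.
move=> s t; rewrite ge_max => /andP[s1 Us] st.
have s0 : 0 < s by lra.
have t0 : 0 < t by lra.
have [u us] := expR_total s0; have [v vt] := expR_total t0.
subst s t; rewrite !ler_expR in Us st.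
have /ler_normlP[h1 h2] := hU _ _ Us st.
have -> : (expR v / expR u) `^ e = expR (e * (v - u)) by rewrite -expRB -expRM mulrC.
by rewrite !fE -!expRD !ler_expR; split; lra.
Unshelve. all: by end_near. Qed.

End potter.

(** * The product space of the weights *)

Section product_space.
Variables (R : realType) (I : choiceType).

Definition cylinder (J : {fset I}) (B : I -> set R) : set (I -> R) :=
  [set w | forall i, i \in J -> B i (w i)].

Definition cylinders : set (set (I -> R)) :=
  [set cylinder J B | J in setT & B in [set B | forall i, measurable (B i)]].

(** A synonym of [I -> R], on which the sigma-algebra generated by the cylinders
    is the canonical one. *)
Definition field : Type := g_sigma_algebraType cylinders.
HB.instance Definition _ := Measurable.on field.

Lemma measurable_coord i : measurable_fun setT (fun w : field => w i).
Proof.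
move=> _ B mB; rewrite setTI; apply: sub_sigma_algebra.
exists [fset i]%fset => //; exists (fun=> B) => //.
apply/seteqP; split => w /=; first by apply; rewrite inE.
by move=> Bw j; rewrite inE => /eqP ->.
Qed.

Lemma measurable_to_field disp (T : measurableType disp) (f : T -> field) :
  (forall i, measurable_fun setT (fun t => f t i)) -> measurable_fun setT f.
Proof.
move=> mf; apply: (@measurability _ _ _ field _ f cylinders) => //.
move=> _ [_ [J _ [B mB <-]] <-]; rewrite setTI.
rewrite (_ : _ @^-1` _ = \bigcap_(i in [set` J]) ((fun t => f t i) @^-1` B i)).
  apply: fin_bigcap_measurable => [|i _]; first exact: finite_fset.
  by rewrite -[X in measurable X]setTI; exact: mf.
by apply/seteqP; split => t /= H i; exact: H.
Qed.

(** Cylinders are stable under intersection and generate the sigma-algebra. *)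
Lemma cylinder_measure_unique (m1 m2 : {measure set field -> \bar R}) :
  (m1 setT < +oo)%E ->
  (forall J B, (forall i, measurable (B i)) -> m1 (cylinder J B) = m2 (cylinder J B)) ->
  forall A, measurable A -> m1 A = m2 A.
Proof.
move=> m1oo m12; apply: (@measure_unique _ _ field cylinders (fun=> setT)) => //.
- move=> _ _ [J _ [B mB <-]] [K _ [C mC <-]].
  exists (J `|` K)%fset => //; exists (fun i => (if i \in J then B i else setT) `&`
    (if i \in K then C i else setT)).
    by move=> i; apply: measurableI; case: ifP.
  apply/seteqP; split => w /=.
    move=> H; split => i iJ; have := H i; rewrite inE iJ ?orbT => /(_ isT) [] //.
  move=> [H1 H2] i; rewrite inE => _; split; case: ifP => // ?; auto.
- move=> _; exists fset0 => //; exists (fun=> setT) => //.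
  by apply/seteqP; split => w.
- by apply/seteqP; split => // w _; exists 0%N.
- by move=> _ [J _ [B mB <-]]; exact: m12.
Qed.

Definition depends_on T (A : set I) (F : (I -> R) -> T) :=
  forall w w', (forall i, A i -> w i = w' i) -> F w = F w'.

End product_space.

Section independence.
Variables (R : realType) (I : choiceType).
Variable (Q : probability (field R I) R) (nu : set R -> \bar R).
Hypothesis Qcyl : forall J B, (forall i, measurable (B i)) ->
  Q (cylinder J B) = (\prod_(i <- J) nu (B i))%E.

Definition merge (A : set I) (p : field R I * field R I) : field R I :=
  fun i => if `[< A i >] then p.1 i else p.2 i.

Lemma measurable_merge A : measurable_fun setT (merge A).
Proof.
apply: measurable_to_field => i; rewrite /merge; case: asboolP => _.
- exact: (measurableT_comp (@measurable_coord R I i)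
    (@measurable_fst _ _ (field R I) (field R I))).
- exact: (measurableT_comp (@measurable_coord R I i)
    (@measurable_snd _ _ (field R I) (field R I))).
Qed.

(** Resampling the coordinates off [A] from an independent copy does not change
    the law: both sides agree on cylinders. *)
Lemma merge_law A S : measurable S -> (Q \x Q)%E (merge A @^-1` S) = Q S.
Proof.
move: S; have mm := measurable_merge A.
apply: (@cylinder_measure_unique R I
  (measure_function_pushforward__canonical__measure_function_Measure (Q \x Q)%E mm) Q).
  by rewrite /= /pushforward preimage_setT probability_setT ltry.
move=> J B mB; rewrite /= /pushforward.
have mcyl K : measurable (cylinder K B : set (field R I)).
  by apply: sub_sigma_algebra; exists K => //; exists B.
pose J1 := [fset i in J | `[< A i >]]%fset.
pose J2 := [fset i in J | ~~ `[< A i >]]%fset.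
rewrite (_ : _ @^-1` _ = cylinder J1 B `*` cylinder J2 B); last first.
  apply/seteqP; split => -[w w'] /=.
    move=> H; split => i; rewrite !inE => /andP[iJ iA]; have := H i iJ;
      by rewrite /merge ?iA// (negbTE iA).
  move=> [H1 H2] i iJ; rewrite /merge; case: ifP => iA /=.
    by apply: H1; rewrite !inE iJ.
  by apply: H2; rewrite !inE iJ iA.
rewrite product_measure1E// !Qcyl// (big_fsetID _ (fun i => `[< A i >]) J)/=.
by rewrite !Qcyl.
Qed.

(** By [merge_law] the factors may be evaluated at two independent copies, and
    the theorem of Tonelli separates them. *)
Lemma indep_integralM A (F G : field R I -> \bar R) :
  measurable_fun setT F -> measurable_fun setT G ->
  (forall w, 0 <= F w)%E -> (forall w, 0 <= G w)%E ->
  depends_on A F -> depends_on (~` A) G ->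
  (\int[Q]_w (F w * G w) = \int[Q]_w F w * \int[Q]_w G w)%E.
Proof.
move=> mF mG F0 G0 dF dG; have mm := measurable_merge A.
have mFG : measurable_fun setT (fun w => F w * G w)%E by exact: emeasurable_funM.
transitivity (\int[pushforward (Q \x Q) (merge A)]_w (F w * G w))%E.
  apply: eq_measure_integral => S mS _; apply/esym; exact: merge_law.
rewrite ge0_integral_pushforward//; last by move=> w _; exact: mule_ge0.
rewrite preimage_setT.
have -> : (fun w => F w * G w)%E \o merge A = (fun p => F p.1 * G p.2)%E.
  apply/funext => -[w w'] /=; congr (_ * _)%E.
    by apply: dF => i Ai; rewrite /merge asboolT.
  by apply: dG => i Ai; rewrite /merge asboolF.
have mF1 : measurable_fun setT (fun p : field R I * field R I => F p.1).
  exact: (measurableT_comp mF measurable_fst).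
have mG2 : measurable_fun setT (fun p : field R I * field R I => G p.2).
  exact: (measurableT_comp mG measurable_snd).
rewrite fubini_tonelli1//=; last 2 first.
- exact: emeasurable_funM.
- by move=> p; rewrite mule_ge0.
rewrite /fubini_F /=.
under eq_integral do rewrite ge0_integralZl//.
by rewrite ge0_integralZr//; exact: integral_ge0.
Qed.

Lemma indep_prod (T : eqType) (s : seq T) (A : T -> set I) (F : T -> field R I -> \bar R) :
  uniq s ->
  (forall x y, x \in s -> y \in s -> x != y -> A x `&` A y = set0) ->
  (forall x, measurable_fun setT (F x)) -> (forall x w, 0 <= F x w)%E ->
  (forall x, depends_on (A x) (F x)) ->
  (\int[Q]_w \prod_(x <- s) F x w = \prod_(x <- s) \int[Q]_w F x w)%E.
Proof.
move=> us dA mF F0 dF; elim: s us dA => [|x s IH] us dA.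
  under eq_integral do rewrite big_nil.
  by rewrite big_nil integral_cst// mul1e; exact: probability_setT.
under eq_integral do rewrite big_cons.
rewrite big_cons (@indep_integralM (A x))//.
- congr (_ * _)%E; apply: IH; first by case/andP: us.
  by move=> y z ys zs; apply: dA; rewrite inE ?ys ?zs orbT.
- elim: {IH us dA} s => [|y s IH].
    rewrite (_ : (fun w => _) = cst 1%E); first exact: measurable_cst.
    by apply/funext => w; rewrite big_nil.
  rewrite (_ : (fun w => _) = fun w => F y w * \prod_(z <- s) F z w)%E.
    exact: emeasurable_funM.
  by apply/funext => w; rewrite big_cons.
- by move=> w; apply: prode_ge0.
- move=> w w' ww'; apply: eq_big_seq => y ys; apply: dF => i Ai; apply: ww' => Axi.
  have xy : x != y by apply: contraTneq ys => <-; case/andP: us.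
  have : (A x `&` A y) i by [].
  by rewrite dA// ?mem_head// inE ys orbT.
Qed.

End independence.

(** * Passage times of paths *)

Section paths.
Variables (R : realType) (d : nat).
Implicit Types (w : edge d -> R) (x y z : 'rV[int]_d) (p q : seq 'rV[int]_d).
Implicit Types (E : set (edge d)) (J : {fset edge d}).

Lemma path_edges_nil x : path_edges x [::] = set0 :> set (edge d).
Proof. by apply/seteqP; split => // e [i]; rewrite ltn0. Qed.

Lemma path_edges_cons x y p : path_edges x (y :: p) =
  [set e : edge d | val e = [fset x; y]%fset] `|` path_edges y p.
Proof.
apply/seteqP; split => e /=.
  move=> [[|i] /= ilt eE]; [by left|right]; exists i => //.
  apply: (etrans eE) => /=; congr [fset _; _]%fset; last exact: set_nth_default.
  by apply: set_nth_default; rewrite /= ltnS ltnW.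
move=> [eE|[i ilt eE]]; first by exists 0%N.
exists i.+1 => //=; apply: (etrans eE); congr [fset _; _]%fset; last exact: set_nth_default.
by apply: set_nth_default; rewrite /= ltnS ltnW.
Qed.

Lemma path_edges_cat x p q :
  path_edges x (p ++ q) = path_edges x p `|` path_edges (last x p) q.
Proof.
elim: p x => [|y p IH] x; first by rewrite path_edges_nil set0U.
by rewrite cat_cons !path_edges_cons IH /= setUA.
Qed.

Lemma path_edges_card x p : exists J : {fset edge d},
  path_edges x p = [set` J] /\ (#|` J| <= size p)%N.
Proof.
elim: p x => [|y p IH] x.
  by exists fset0; rewrite path_edges_nil cardfs0; split => //; apply/seteqP; split.
have [J [JE cJ]] := IH y; rewrite path_edges_cons JE.
have [[e he]|ne] := pselect (exists e : edge d, val e = [fset x; y]%fset).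
  exists (e |` J)%fset; split; last first.
    by rewrite cardfsU1 (leq_trans (leq_add (leq_b1 _) cJ)).
  apply/seteqP; split => e' /=; rewrite !inE.
    by move=> [h|->]; [rewrite -he in h; rewrite (val_inj h) eqxx|rewrite orbT].
  by case/orP=> [/eqP ->|]; [left|right].
exists J; split; last exact: leq_trans cJ _.
by apply/seteqP; split => e' /=; [case=> // h; case: ne; exists e'|right].
Qed.

Lemma passage_time_fset w x p J : path_edges x p = [set` J] ->
  passage_time w x p = \sum_(e <- J) w e.
Proof. by rewrite /passage_time => ->; rewrite -fsbig_seq. Qed.

Lemma ler_sum_fset w J J' : (forall e, 0 <= w e) -> {subset J <= J'} ->
  \sum_(e <- J) w e <= \sum_(e <- J') w e.
Proof.
move=> w0 JJ'.
rewrite [leRHS](big_fsetID _ (fun e => e \in J))/= (_ : [fset x | x in J' & _]%fset = J).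
  by rewrite lerDl sumr_ge0.
by apply/fsetP => e; rewrite !inE andb_idl//; exact: JJ'.
Qed.

Lemma passage_time_ge0 w x p : (forall e, 0 <= w e) -> 0 <= passage_time w x p.
Proof.
move=> w0; have [K [KE _]] := path_edges_card x p.
by rewrite (passage_time_fset _ KE) sumr_ge0.
Qed.

(** Only an inequality: an edge used by both pieces is counted once on the left. *)
Lemma passage_time_cat w x p q : (forall e, 0 <= w e) ->
  passage_time w x (p ++ q) <= passage_time w x p + passage_time w (last x p) q.
Proof.
move=> w0; have [K [KE _]] := path_edges_card x p.
have [L [LE _]] := path_edges_card (last x p) q.
rewrite (passage_time_fset _ KE) (passage_time_fset _ LE).
have KL : path_edges x (p ++ q) = [set` (K `|` L)%fset].
  by rewrite path_edges_cat KE LE; apply/seteqP; split => e /=; rewrite inE => /orP.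
rewrite (passage_time_fset _ KL) (big_fsetID _ (fun e => e \in K))/=.
apply: lerD; apply: ler_sum_fset => // e; rewrite !inE => /andP[] //.
by case/orP => // -> ; rewrite ?andbF.
Qed.

Lemma is_path_cat x y z p q : is_path x y p -> is_path y z q -> is_path x z (p ++ q).
Proof.
by move=> [pp <-] [pq <-]; split; rewrite ?cat_path ?pp// last_cat.
Qed.

(** Confining the paths to [E] makes the passage time a function of the weights
    in [E], hence independent over disjoint [E]. Its value is [0], the infimum of
    the empty set, when [E] does not connect the two points. *)
Definition fpt E w x y : R :=
  inf [set passage_time w x p | p in [set p | is_path x y p /\ path_edges x p `<=` E]].

Lemma fpt_setT w x y : fpt setT w x y =
  inf [set passage_time w x p | p in [set p | is_path x y p]].
Proof.
congr (inf (_ @` _)); apply/seteqP; split => p /=; first by case.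
by move=> ?; split => // e.
Qed.

Lemma fpt_le E w x y p : (forall e, 0 <= w e) ->
  is_path x y p -> path_edges x p `<=` E -> fpt E w x y <= passage_time w x p.
Proof.
move=> w0 pxy pE; apply: ge_inf; last by exists p.
by exists 0 => _ [q _ <-]; exact: passage_time_ge0.
Qed.

Lemma fpt_ge0 E w x y : (forall e, 0 <= w e) -> 0 <= fpt E w x y.
Proof.
move=> w0; rewrite /fpt; set X := (X in inf X).
have [->|/set0P ne] := eqVneq X set0; first by rewrite inf0.
by apply: lb_le_inf => // _ [q _ <-]; exact: passage_time_ge0.
Qed.

(** Excludes the empty infimum: lower bounds on [fpt] and the triangle
    inequality need a path. *)
Definition joined E x y := exists p, is_path x y p /\ path_edges x p `<=` E.

Lemma fpt_glb E w x y (c : R) : joined E x y ->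
  (forall p, is_path x y p -> path_edges x p `<=` E -> c <= passage_time w x p) ->
  c <= fpt E w x y.
Proof.
move=> [p [pp pE]] H; apply: lb_le_inf; first by exists (passage_time w x p); exists p.
by move=> _ [q [qp qE] <-]; exact: H.
Qed.

Lemma fpt_lt E w x y (c : R) : (forall e, 0 <= w e) -> joined E x y ->
  (fpt E w x y < c) <-> exists p, [/\ is_path x y p, path_edges x p `<=` E &
                                      passage_time w x p < c].
Proof.
move=> w0 [p0 [pp pE]]; split; last first.
  by move=> [p [p1 p2]]; apply: le_lt_trans; exact: fpt_le.
move=> lt; apply: contrapT => H; move: lt; apply/negP; rewrite -leNgt.
apply: fpt_glb; first by exists p0.
by move=> p p1 p2; rewrite leNgt; apply/negP => lt; apply: H; exists p.
Qed.

Lemma joined_trans E x y z : joined E x y -> joined E y z -> joined E x z.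
Proof.
move=> [p [pp pE]] [q [qp qE]]; exists (p ++ q); split; first exact: is_path_cat qp.
by rewrite path_edges_cat; case: pp => _ ->; rewrite subUset.
Qed.

Lemma fpt_triangle E w x y z : (forall e, 0 <= w e) -> joined E x y -> joined E y z ->
  fpt E w x z <= fpt E w x y + fpt E w y z.
Proof.
move=> w0 jxy jyz; apply/ler_addgt0Pr => e e0.
have e20 : 0 < e / 2 by rewrite divr_gt0.
have [|p [pp pE pt]] := (fpt_lt (fpt E w x y + e / 2) w0 jxy).1; first by rewrite ltrDl.
have [|q [qp qE qt]] := (fpt_lt (fpt E w y z + e / 2) w0 jyz).1; first by rewrite ltrDl.
apply: (@le_trans _ _ (passage_time w x (p ++ q))).
  apply: fpt_le => //; first exact: is_path_cat qp.
  by rewrite path_edges_cat; case: pp => _ ->; rewrite subUset.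
apply: (le_trans (passage_time_cat _ _ _ w0)); case: pp => _ ->.
by apply: (le_trans (ltW (ltrD pt qt))); rewrite addrACA -splitr.
Qed.

Lemma fpt_sub E E' w x y : (forall e, 0 <= w e) -> joined E x y -> E `<=` E' ->
  fpt E' w x y <= fpt E w x y.
Proof.
move=> w0 j sub; apply: fpt_glb => // p pp pE; apply: fpt_le => //.
exact: subset_trans sub.
Qed.

Lemma le_passage_time w w' x p : (forall e, w e <= w' e) ->
  passage_time w x p <= passage_time w' x p.
Proof.
move=> ww'; have [K [KE _]] := path_edges_card x p.
by rewrite !(passage_time_fset _ KE); apply: ler_sum.
Qed.

Lemma fpt_le_weight E w w' x y : (forall e, 0 <= w e) -> joined E x y ->
  (forall e, w e <= w' e) -> fpt E w x y <= fpt E w' x y.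
Proof.
move=> w0 j ww'; apply: fpt_glb => // p pp pE.
apply: (le_trans (fpt_le w0 pp pE)); exact: le_passage_time.
Qed.

Lemma fpt_depends E x y (w w' : edge d -> R) : (forall e, E e -> w e = w' e) ->
  fpt E w x y = fpt E w' x y.
Proof.
move=> ww'; congr inf; apply/seteqP; split => _ [p [pp pE] <-]; exists p => //;
  have [K [KE _]] := path_edges_card x p; rewrite !(passage_time_fset _ KE);
  apply: eq_big_seq => e eK; [apply/esym|]; apply: ww'; apply: pE; by rewrite KE.
Qed.

End paths.

(** * Monotone paths and translations *)

Section hull.
Variable d : nat.
Implicit Types (x y z v : 'rV[int]_d) (p : seq 'rV[int]_d).

Definition dist x y : nat := (\sum_(i < d) absz (x 0%R i - y 0%R i)%R)%N.

Definition in_hull x y z : Prop := forall i,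
  (x 0 i <= z 0 i <= y 0 i) || (y 0 i <= z 0 i <= x 0 i).

Lemma adjacent_delta x i (s : int) : `|s| = 1 -> Defs.adjacent x (x + s *: delta_mx 0 i).
Proof.
move=> s1; apply/eqP; rewrite (bigD1 i)//= !mxE !eqxx mulr1 big1 ?addr0.
  by rewrite opprD addrA subrr sub0r normrN.
by move=> j ji; rewrite !mxE (negbTE ji) andbF mulr0 addr0 subrr normr0.
Qed.

(** Each step moves one coordinate towards its final value. *)
Lemma hull_path x y : exists p, [/\ is_path x y p,
  (forall z, z \in x :: p -> in_hull x y z) & size p = dist x y].
Proof.
have [n] := ubnP (dist x y); elim: n x => // n IH x; rewrite ltnS => dn.
have [->|xy] := eqVneq x y.
  exists [::]; split => //.
    by move=> z; rewrite inE => /eqP -> i; rewrite lexx.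
  by rewrite /dist big1// => i _; rewrite subrr.
have [i xyi] : exists i, x 0 i != y 0 i.
  apply/existsP; apply: contraT; rewrite negb_exists => /forallP H.
  by case/eqP: xy; apply/rowP => i; apply/eqP; move: (H i); rewrite negbK.
pose s : int := if x 0 i < y 0 i then 1 else -1.
pose x' := x + s *: delta_mx 0 i.
have x'E j : x' 0 j = if j == i then x 0 i + s else x 0 j.
  rewrite !mxE eqxx /=; have [->|_] := eqVneq j i; first by rewrite mulr1.
  by rewrite mulr0 addr0.
have dE : dist x y = (dist x' y).+1.
  rewrite /dist (bigD1 i)//= [in RHS](bigD1 i)//= x'E eqxx -addSn; congr (_ + _)%N.
    by move: xyi; rewrite /s; case: ifP; lia.
  by apply: eq_bigr => j ji; rewrite x'E (negbTE ji).
have [p [[pp lp] ph ps]] : exists p, [/\ is_path x' y p,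
    (forall z, z \in x' :: p -> in_hull x' y z) & size p = dist x' y].
  by apply: IH; rewrite -dE.
exists (x' :: p); split; last by rewrite /= ps dE.
  split=> //=; rewrite pp andbT; apply: adjacent_delta.
  by rewrite /s; case: ifP.
move=> z; rewrite inE => /orP[/eqP ->|zp] j; first by rewrite lexx; lia.
move: (ph _ zp j); rewrite x'E; case: eqP => [->|//].
by move: xyi; rewrite /s; case: ifP; lia.
Qed.

Lemma path_edges_vertices x p (e : edge d) v : path_edges x p e ->
  v \in val e -> v \in x :: p.
Proof.
move=> [i ilt ->]; rewrite in_fset2 => /orP[] /eqP ->; apply: mem_nth => //=.
by rewrite ltnS ltnW.
Qed.

End hull.

Section translate.
Variables (R : realType) (d : nat).
Implicit Types (x y z v : 'rV[int]_d) (p : seq 'rV[int]_d) (w : edge d -> R).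

Lemma adjacent_shift v x y : Defs.adjacent (x + v) (y + v) = Defs.adjacent x y.
Proof.
rewrite /Defs.adjacent; congr (_ == _); apply: eq_bigr => i _; rewrite !mxE.
by congr `|_|; ring.
Qed.

Lemma shift_is_edge v (e : edge d) :
  is_edge [fset ((u : 'rV[int]_d) + v)%R | u in val e]%fset.
Proof.
case: e => e /= /asboolP[x [y [xy ->]]]; apply/asboolP; exists (x + v), (y + v).
rewrite adjacent_shift; split=> //.
by apply/fsetP => u; rewrite imfsetU !imfset_fset1.
Qed.

Definition shift_edge v (e : edge d) : edge d :=
  exist _ [fset ((u : 'rV[int]_d) + v)%R | u in val e]%fset (shift_is_edge v e).

Lemma shift_edgeK v : cancel (shift_edge v) (shift_edge (- v)).
Proof.
move=> e; apply: val_inj => /=; apply/fsetP => u; apply/imfsetP/idP => /=.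
  by move=> [_ /imfsetP[/= z ze ->] ->]; rewrite addrK.
move=> ue; exists (u + v); last by rewrite addrK.
by apply/imfsetP; exists u.
Qed.

Lemma shift_edgeNK v : cancel (shift_edge (- v)) (shift_edge v).
Proof. by move=> e; rewrite -{1}[v]opprK shift_edgeK. Qed.

Lemma shift_edge_inj v : injective (shift_edge v).
Proof. exact: can_inj (shift_edgeK v). Qed.

Lemma path_edges_shift v x p : path_edges (x + v) [seq y + v | y <- p] =
  shift_edge v @` path_edges x p.
Proof.
elim: p x => [|y p IH] x; first by rewrite /= !path_edges_nil image_set0.
rewrite /= !path_edges_cons image_setU IH; congr (_ `|` _).
apply/seteqP; split => e /=.
  move=> eE; exists (shift_edge (- v) e); last exact: shift_edgeNK.
  apply/fsetP => u; apply/imfsetP/idP => /=.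
    by move=> [z]; rewrite eE => /fset2P[] -> ->; rewrite addrK ?fset21 ?fset22.
  move=> uxy; exists (u + v); last by rewrite addrK.
  rewrite (eE : sval e = _) /=.
  by move: uxy => /fset2P[] ->; rewrite ?fset21 ?fset22.
move=> [e' e'E <-]; apply/fsetP => u /=; rewrite e'E.
by rewrite imfsetU !imfset_fset1.
Qed.

Lemma is_path_shift v x y p : is_path x y p ->
  is_path (x + v) (y + v) [seq z + v | z <- p].
Proof.
move=> [pp <-]; split; last exact: (last_map (fun z => z + v)).
elim: p x pp => //= y' p IH x /andP[xy pp].
by rewrite adjacent_shift xy; exact: IH.
Qed.

Lemma passage_time_shift v w x p :
  passage_time w (x + v) [seq y + v | y <- p] = passage_time (w \o shift_edge v) x p.
Proof.
rewrite /passage_time path_edges_shift (reindex_fsbig (shift_edge v) (path_edges x p))//.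
split; [by move=> e; exists e| |by []].
- by move=> a b _ _; exact: shift_edge_inj.
Qed.

Lemma fpt_shift v (E : set (edge d)) w x y :
  fpt E (w \o shift_edge v) x y = fpt (shift_edge v @` E) w (x + v) (y + v).
Proof.
congr inf; apply/seteqP; split => _ [p [pp pE] <-].
  exists [seq z + v | z <- p]; last by rewrite passage_time_shift.
  by split; [exact: is_path_shift|rewrite path_edges_shift; exact: image_subset].
have pE' : p = [seq z + v | z <- [seq z - v | z <- p]].
  by rewrite -map_comp map_id_in// => z _ /=; rewrite subrK.
have h : path_edges x [seq z - v | z <- p] `<=` E.
  move=> e he; have : (shift_edge v @` path_edges x [seq z - v | z <- p]) (shift_edge v e).
    by exists e.
  by rewrite -path_edges_shift -pE' => /pE[e' Ee' /shift_edge_inj <-].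
exists [seq z - v | z <- p]; last by rewrite -passage_time_shift -pE'.
split=> //; rewrite -[x](addrK v) -[y](addrK v); exact: is_path_shift.
Qed.

Lemma joinedT x y : joined setT x y.
Proof. by have [p [pp _ _]] := hull_path x y; exists p; split=> // e. Qed.

End translate.

(** * Expected passage times *)

Section measurable_fpt.
Variables (R : realType) (d : nat).
Implicit Types (x y z v : 'rV[int]_d) (p : seq 'rV[int]_d).
Local Notation W := (field R (edge d)).

Lemma measurable_sum_weight (g : R -> R) (J : {fset edge d}) : measurable_fun setT g ->
  measurable_fun setT (fun w : W => \sum_(e <- J) g (w e)).
Proof.
move=> mg; apply: measurable_sum => e.
by apply: (measurableT_comp mg); exact: measurable_coord.
Qed.

(** A sublevel set is a countable union over the paths, which can be enumerated. *)
Lemma measurable_fpt (g : R -> R) (E : set (edge d)) x y : measurable_fun setT g ->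
  (forall t, 0 <= g t) ->
  measurable_fun setT (fun w : W => fpt E (fun e => g (w e)) x y).
Proof.
move=> mg g0; have [j|nj] := pselect (joined E x y); last first.
  rewrite (_ : (fun w => _) = cst 0); first exact: measurable_cst.
  apply/funext => w; rewrite /fpt (_ : _ @` _ = set0) ?inf0//.
  by rewrite -subset0 => t [p [pp pE] _]; apply: nj; exists p.
apply: (@measurability _ _ W _ setT (fun w : W => fpt E (fun e => g (w e)) x y) (@RGenInftyO.G R)); first exact: RGenInftyO.measurableE.
move=> _ [_ [c ->] <-]; rewrite setTI.
pose B n : set W := match (choice.unpickle n : option (seq 'rV[int]_d)) with
  | Some p => [set w : W | [/\ is_path x y p, path_edges x p `<=` E &
                passage_time (fun e => g (w e)) x p < c]]
  | None => set0 end.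
rewrite (_ : _ @^-1` _ = \bigcup_n B n).
  apply: bigcupT_measurable => n; rewrite /B; case: (choice.unpickle _) => [p|]; last exact: measurable0.
  have [[pp pE]|np] := pselect (is_path x y p /\ path_edges x p `<=` E); last first.
    rewrite (_ : [set w | _] = set0); first exact: measurable0.
    by apply/seteqP; split => // w [pp pE _]; apply: np.
  have [K [KE _]] := path_edges_card x p.
  rewrite (_ : [set w | _] = (fun w : W => \sum_(e <- K) g (w e)) @^-1` `]-oo, c[).
    by rewrite -[X in measurable X]setTI; apply: measurable_sum_weight => //; exact: measurable_itv.
  apply/seteqP; split => w /=; rewrite in_itv/=.
    by move=> [_ _]; rewrite (passage_time_fset _ KE).
  by move=> h; split=> //; rewrite (passage_time_fset _ KE).
apply/seteqP; split => w /=; rewrite in_itv/=.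
  move=> /(fpt_lt c (fun e => g0 (w e)) j)[p h].
  exists (choice.pickle (p : seq 'rV[int]_d)); first by [].
  by rewrite /B choice.pickleK; exact: h.
move=> [n _]; rewrite /B; case: (choice.unpickle _) => [p h|[]].
by apply/(fpt_lt c (fun e => g0 (w e)) j); exists p; exact: h.
Qed.

End measurable_fpt.

Section expectation.
Variables (R : realType) (d : nat).
Implicit Types (x y z v : 'rV[int]_d) (p : seq 'rV[int]_d).
Local Notation W := (field R (edge d)).
Variables (Q : probability W R) (nu : probability R R).
Hypothesis Qcyl : forall J B, (forall i, measurable (B i)) ->
  Q (cylinder J B) = (\prod_(i <- J) nu (B i))%E.

Lemma integral_coord (g : R -> \bar R) e : measurable_fun setT g -> (forall t, 0 <= g t)%E ->
  (\int[Q]_w g (w e) = \int[nu]_t g t)%E.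
Proof.
move=> mg g0; have mc := @measurable_coord R _ e.
transitivity (\int[pushforward Q (fun w : W => w e)]_t g t)%E.
  by rewrite ge0_integral_pushforward// preimage_setT.
apply: eq_measure_integral => B mB _; rewrite /pushforward.
have := @Qcyl [fset e]%fset (fun=> B) (fun=> mB).
rewrite big_seq_fset1 => h; apply: (etrans _ h); congr (Q _); apply/seteqP; split => w /=.
  by move=> Bw i; rewrite inE => /eqP ->.
by apply; rewrite inE.
Qed.

Lemma measurable_shift_field v :
  measurable_fun setT (fun w : W => (fun e => w (shift_edge v e)) : W).
Proof. by apply: measurable_to_field => e; exact: measurable_coord. Qed.

(** Shifting permutes independent coordinates of the same law, so it preserves
    the probabilities of cylinders. *)
Lemma integral_shift_field v (F : W -> \bar R) :
  measurable_fun setT F -> (forall w, 0 <= F w)%E ->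
  (\int[Q]_w F (fun e => w (shift_edge v e)) = \int[Q]_w F w)%E.
Proof.
move=> mF F0; have ms := measurable_shift_field v.
apply/esym; transitivity (\int[pushforward Q (fun w : W => (fun e => w (shift_edge v e)) : W)]_w F w)%E;
  last by rewrite ge0_integral_pushforward// preimage_setT.
apply: eq_measure_integral => S mS _; apply/esym; move: S mS.
apply: (@cylinder_measure_unique R _
  (measure_function_pushforward__canonical__measure_function_Measure Q ms) Q).
  by rewrite /= /pushforward preimage_setT probability_setT ltry.
move=> J B mB; rewrite /= /pushforward Qcyl//.
have -> : (fun w : W => (fun e => w (shift_edge v e)) : W) @^-1` cylinder J B =
    cylinder [fset shift_edge v e | e in J]%fset (fun e => B (shift_edge (- v) e)).
  apply/seteqP; split => w /=.
    by move=> H _ /imfsetP[e /= eJ ->]; rewrite shift_edgeK; exact: H.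
  move=> H e eJ; have := H (shift_edge v e); rewrite shift_edgeK; apply.
  by apply/imfsetP; exists e.
rewrite Qcyl// big_imfset/=; last by move=> ? ? _ _; exact: shift_edge_inj.
by apply: eq_bigr => e _; rewrite shift_edgeK.
Qed.

Definition moment : \bar R := (\int[nu]_t `|t|%:E)%E.
(** The law lives on all real configurations; absolute values make passage times
    non-negative at every configuration instead of almost every one. *)
Definition ET x y : \bar R := (\int[Q]_w (fpt setT (fun e => `|w e|) x y)%:E)%E.

Lemma ETE x y : ET x y = (\int[Q]_w (fpt setT (fun e => `|w e|) x y)%:E)%E.
Proof. by []. Qed.

Lemma moment_ge0 : (0 <= moment)%E.
Proof. by apply: integral_ge0 => t _; rewrite lee_fin. Qed.

Lemma measurable_T E x y : measurable_fun setT (fun w : W => (fpt E (fun e => `|w e|) x y)%:E).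
Proof.
apply/measurable_EFinP; apply: (@measurable_fpt R d (fun t => `|t|)) => //.
Qed.

Lemma integral_sum_weight (J : {fset edge d}) :
  (\int[Q]_w (\sum_(e <- J) `|w e|)%:E = #|` J|%:R%:E * moment)%E.
Proof.
under eq_integral do rewrite -sumEFin.
rewrite ge0_integral_sum//; last first.
  move=> e; apply/measurable_EFinP; apply: measurableT_comp; first exact: normr_measurable.
  exact: measurable_coord.
rewrite (eq_bigr (fun=> moment)).
  rewrite big_const_seq count_predT [RHS]mule_natl.
  by rewrite iter_addr_0.
by move=> e _; rewrite (@integral_coord (fun t => `|t|%:E))//; apply/measurable_EFinP; exact: normr_measurable.
Qed.

Lemma ET_le x y : (ET x y <= (dist x y)%:R%:E * moment)%E.
Proof.
have [p [pp _ sp]] := hull_path x y; have [J [JE cJ]] := path_edges_card x p.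
apply: (@le_trans _ _ (#|` J|%:R%:E * moment)%E).
  rewrite -integral_sum_weight; apply: ge0_le_integral => //.
  - by move=> w _; rewrite lee_fin fpt_ge0.
  - exact: measurable_T.
  - by apply/measurable_EFinP; apply: measurable_sum_weight; exact: normr_measurable.
  - move=> w _; rewrite lee_fin -(passage_time_fset _ JE); exact: fpt_le.
by apply: lee_wpmul2r; [exact: moment_ge0|rewrite lee_fin ler_nat -sp].
Qed.

Lemma ET_ge0 x y : (0 <= ET x y)%E.
Proof. by apply: integral_ge0 => w _; rewrite lee_fin fpt_ge0. Qed.

Lemma ET_shift v x y : ET (x + v) (y + v) = ET x y.
Proof.
rewrite /ET; apply: etrans; last first.
  apply: (@integral_shift_field v (fun w => (fpt setT (fun e => `|w e|) x y)%:E)).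
    exact: measurable_T.
  by move=> w; rewrite lee_fin fpt_ge0.
apply: eq_integral => w _; congr _%:E.
rewrite [in LHS](_ : setT = shift_edge v @` setT).
  by apply/esym; exact: (@fpt_shift R d v setT (fun e => `|w e|) x y).
by apply/seteqP; split => // e _; exists (shift_edge (- v) e) => //; exact: shift_edgeNK.
Qed.

Lemma ET_triangle x y z : (ET x z <= ET x y + ET y z)%E.
Proof.
rewrite /ET -ge0_integralD//; last 4 first.
- by move=> w _; rewrite lee_fin fpt_ge0.
- exact: measurable_T.
- by move=> w _; rewrite lee_fin fpt_ge0.
- exact: measurable_T.
apply: ge0_le_integral => //.
- by move=> w _; rewrite lee_fin fpt_ge0.
- exact: measurable_T.
- by apply: emeasurable_funD; exact: measurable_T.
- by move=> w _; rewrite lee_fin; apply: fpt_triangle => //; exact: joinedT.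
Qed.

End expectation.
(* Unification would otherwise unfold passage times when it compares two of them
   that end at different lattice points. *)
Global Opaque fpt ET.

(** * The limit of expected passage times *)

Section fekete.
Variables (R : realType) (G : R -> R) (C : R).
Hypothesis G0 : forall t, 0 <= t -> 0 <= G t.
Hypothesis GD : forall s t, 0 <= s -> 0 <= t -> G (s + t) <= G s + G t.
Hypothesis GC : forall t, 0 <= t -> G t <= C * (1 + t).

(** Fekete's lemma in continuous time: [t] is a multiple of a nearly optimal [s]
    plus a remainder in [[0, s[], on which [G] is bounded. *)
Lemma subadditive_cvg : exists mu : R,
  t^-1 * G t @[t --> +oo] --> mu.
Proof.
pose X := [set G s / s | s in [set s | 0 < s]].
have X0 : has_inf X.
  split; first by exists (G 1 / 1); exists 1 => //=; exact: ltr01.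
  by exists 0 => _ [s /= s0 <-]; rewrite divr_ge0 ?G0// ltW.
exists (inf X).
have muG t : 0 < t -> inf X * t <= G t.
  move=> t0; rewrite -ler_pdivlMr//; apply: ge_inf; first by case: X0.
  by exists t.
have C0 : 0 <= C.
  by have := le_trans (G0 (lexx 0)) (GC (lexx 0)); rewrite addr0 mulr1.
apply/cvgrPdist_le => e e0.
have e20 : 0 < e / 2 by rewrite divr_gt0.
have [_ [s /= s0 <-] Gs] := inf_adherent e20 X0.
have steps k rho : 0 <= rho -> G (k%:R * s + rho) <= k%:R * G s + G rho.
  move=> rho0; elim: k => [|k IH]; first by rewrite !mul0r !add0r.
  rewrite -natr1 !mulrDl !mul1r.
  rewrite (_ : k%:R * s + s + rho = s + (k%:R * s + rho)); last by ring.
  apply: le_trans (GD (ltW s0) _) _; first by rewrite addr_ge0// mulr_ge0// ltW.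
  by lra.
near=> t.
have t0 : 0 < t by near: t; apply: nbhs_pinfty_gt; exact: num_real.
have tC : C * (1 + s) / (e / 2) <= t by near: t; apply: nbhs_pinfty_ge; exact: num_real.
have lo : inf X <= t^-1 * G t by rewrite mulrC ler_pdivlMr// muG.
have hi : t^-1 * G t <= inf X + e.
  have ts0 : 0 <= t / s by rewrite divr_ge0// ltW.
  have /andP[kl ku] := truncn_itv ts0.
  set k := Num.truncn _ in kl ku.
  rewrite ler_pdivlMr// in kl; rewrite ltr_pdivrMr// -natr1 mulrDl mul1r in ku.
  have rho0 : 0 <= t - k%:R * s by rewrite subr_ge0.
  have := steps k _ rho0; rewrite addrC subrK => Gt.
  have Grho : G (t - k%:R * s) <= C * (1 + s).
    apply: le_trans (GC rho0) _; apply: ler_wpM2l => //; lra.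
  rewrite ler_pdivrMr// in tC.
  have h1 : G s < (inf X + e / 2) * s by rewrite -ltr_pdivrMr.
  rewrite mulrC ler_pdivrMr//.
  have h2 : k%:R * G s <= (inf X + e / 2) * (k%:R * s).
    by rewrite mulrCA; apply: ler_wpM2l => //; exact: ltW.
  have i0 : 0 <= inf X.
    by apply: lb_le_inf; [case: X0|move=> _ [r /= r0 <-]; rewrite divr_ge0 ?G0// ltW].
  have h3 : (inf X + e / 2) * (k%:R * s) <= (inf X + e / 2) * t.
    by apply: ler_wpM2l => //; rewrite addr_ge0// ltW.
  by lra.
by rewrite distrC ger0_norm; lra.
Unshelve. all: by end_near. Qed.

End fekete.

Lemma floorD_bit (R : realType) (s t : R) : exists c : bool,
  Num.floor (s + t) = Num.floor s + Num.floor t + c%:Z.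
Proof.
have /andP[a1 a2] := real_floor_itv (num_real s).
have /andP[b1 b2] := real_floor_itv (num_real t).
have /andP[c1 c2] := real_floor_itv (num_real (s + t)).
move: a1 a2 b1 b2 c1 c2; move: (Num.floor s) (Num.floor t) (Num.floor (s + t)) => a b c.
move=> a1 a2 b1 b2 c1 c2.
have h1 : a + b < c + 1.
  by rewrite -(ltr_int R) intrD; apply: le_lt_trans c2; rewrite lerD.
have h2 : c < a + b + 2.
  rewrite -(ltr_int R) !intrD; apply: le_lt_trans c1 _.
  by apply: lt_le_trans (ltrD a2 b2) _; rewrite !intrD addrACA.
by exists (c == a + b + 1); case: eqP => /=; lia.
Qed.

Section time_constant.
Variables (R : realType) (d : nat).
Local Notation W := (field R (edge d)).
Variables (Q : probability W R) (nu : probability R R).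
Hypothesis Qcyl : forall J B, (forall i, measurable (B i)) ->
  Q (cylinder J B) = (\prod_(i <- J) nu (B i))%E.
Hypothesis mfin : (moment nu < +oo)%E.
Variable x : 'rV[R]_d.
Local Notation m := (fine (moment nu)).

Lemma momentE : moment nu = m%:E.
Proof. by rewrite fineK// ge0_fin_numE// moment_ge0. Qed.

Lemma mean_ge0 : 0 <= m.
Proof. by rewrite fine_ge0// moment_ge0. Qed.

Lemma ET_fin (y z : 'rV[int]_d) : ET Q y z = (fine (ET Q y z))%:E.
Proof.
rewrite fineK// ge0_fin_numE ?ET_ge0//; apply: le_lt_trans (ET_le Qcyl y z) _.
by rewrite momentE -EFinM ltry.
Qed.

Lemma fine_ET_le (y z : 'rV[int]_d) : fine (ET Q y z) <= (dist y z)%:R * m.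
Proof. by rewrite -lee_fin -ET_fin EFinM -momentE; exact: ET_le. Qed.

Lemma fine_ET_triangle (y z u : 'rV[int]_d) :
  fine (ET Q y u) <= fine (ET Q y z) + fine (ET Q z u).
Proof.
rewrite -lee_fin EFinD -[X in (X <= _)%E]ET_fin -[X in (_ <= X + _)%E]ET_fin.
by rewrite -[X in (_ <= _ + X)%E]ET_fin; exact: ET_triangle.
Qed.

Lemma fine_ET_ge0 (y z : 'rV[int]_d) : 0 <= fine (ET Q y z).
Proof. by rewrite fine_ge0// ET_ge0. Qed.

Local Notation fl t := (floor_point (t *: x) : 'rV[int]_d).

Lemma floor_point0 : floor_point (0 : 'rV[R]_d) = 0 :> 'rV[int]_d.
Proof. by apply/rowP => i; rewrite !mxE floor0. Qed.

Lemma dist_floorD s t : (dist (fl s + fl t) (fl (s + t)) <= d)%N.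
Proof.
rewrite -[leqRHS]card_ord -sum1_card; apply: leq_sum => i _; rewrite !mxE mulrDl.
have [c ->] := floorD_bit (s * x 0 i) (t * x 0 i).
by move: (Num.floor _) (Num.floor _) => u v; case: c; lia.
Qed.

Definition linear_size : R := \sum_(i < d) (`|x 0 i| + 1).

Lemma dist_floor_le t : 0 <= t -> (dist 0 (fl t))%:R <= linear_size * (1 + t).
Proof.
move=> t0; rewrite /dist /linear_size natr_sum mulr_suml; apply: ler_sum => i _.
rewrite !mxE sub0r abszN.
have /andP[a1 a2] := real_floor_itv (num_real (t * x 0 i)).
set a := Num.floor _ in a1 a2 *.
rewrite natr_absz intr_norm.
have b := ler_norm (x 0 i); have b' := lerNnormlW (lexx `|x 0 i|).
rewrite intrD in a2.
apply/ler_normlP; split; nra.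
Qed.

(** The expected passage times along the ray through [x], corrected for the
    rounding of lattice points, are subadditive. *)
Lemma expectation_cvg : exists mu : R,
  t^-1 * fine (ET Q 0 (fl t)) @[t --> +oo] --> mu.
Proof.
have m0 := mean_ge0.
have key (y z u : 'rV[int]_d) : (dist (y + z) u <= d)%N ->
    fine (ET Q 0 u) <= fine (ET Q 0 y) + fine (ET Q 0 z) + d%:R * m.
  move=> du; apply: le_trans (fine_ET_triangle 0 (y + z) u) _; apply: lerD.
    apply: le_trans (fine_ET_triangle 0 y (y + z)) _; rewrite lerD2l.
    by rewrite -(ET_shift Qcyl y 0 z) add0r addrC.
  by apply: le_trans (fine_ET_le _ _) _; apply: ler_wpM2r; rewrite ?ler_nat.
have [|||mu cvmu] := @subadditive_cvg R
    (fun t => fine (ET Q 0 (fl t)) + d%:R * m) ((linear_size + d%:R) * m).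
- by move=> t _; rewrite addr_ge0 ?fine_ET_ge0 ?mulr_ge0.
- move=> s t _ _; apply: le_trans (lerD (key _ _ _ (dist_floorD s t)) (lexx _)) _.
  by rewrite [leRHS]addrACA [leRHS]addrA lexx.
- move=> t t0; rewrite mulrDl mulrDl.
  apply: lerD.
    apply: le_trans (fine_ET_le _ _) _; rewrite mulrAC; apply: ler_wpM2r => //.
    exact: dist_floor_le.
  by rewrite ler_peMr ?mulr_ge0// lerDl.
exists mu.
have dc : t^-1 * (d%:R * m) @[t --> +oo] --> 0.
  rewrite -[X in _ --> X](mul0r (d%:R * m)); apply: cvgMl.
  by apply/gtr0_cvgV0; [by apply: nbhs_pinfty_gt; exact: num_real|exact: cvg_id].
rewrite -[mu]subr0; apply: cvg_trans (cvgB cvmu dc).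
by apply: near_eq_cvg; near=> t; rewrite ?fctE /= mulrDr addrK.
Unshelve. all: by end_near. Qed.

End time_constant.

(** * Growth of the rate *)

Section growth.
Variable R : realType.
Implicit Types (t s a e : R) (f b c : R -> R).

(** A single term of the exponential series suffices, of order [N] with [n + 1
    <= s * N]. *)
Lemma poly_le_exp (n : nat) (A a s : R) : 0 < a -> 0 < s ->
  \forall t \near +oo, A * t ^+ n <= expR (a * t `^ s).
Proof.
move=> a0 s0.
pose N := (Num.truncn (n.+1%:R / s)).+1.
have sN : n.+1%:R <= s * N%:R.
  by rewrite mulrC -ler_pdivrMr// ltW// truncnS_gt.
have aN : 0 < a ^+ N / N`!%:R by rewrite divr_gt0 ?exprn_gt0// ltr0n fact_gt0.
near=> t.
have t1 : 1 <= t by near: t; apply: nbhs_pinfty_ge; exact: num_real.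
have tA : A / (a ^+ N / N`!%:R) <= t by near: t; apply: nbhs_pinfty_ge; exact: num_real.
have t0 : 0 < t by lra.
have t0' := ltW t0.
have at0 : 0 <= a * t `^ s by rewrite mulr_ge0 ?powR_ge0// ltW.
have h : (a * t `^ s) ^+ N / N`!%:R <= expR (a * t `^ s).
  have := expR_ge1Dxn (Num.truncn (n.+1%:R / s)) at0; rewrite -/N.
  by apply: le_trans; rewrite lerDr.
apply: le_trans h; rewrite exprMn mulrAC -[t `^ s ^+ N]powR_mulrn ?powR_ge0// -powRrM.
apply: (@le_trans _ _ (a ^+ N / N`!%:R * t `^ (n.+1%:R))); last first.
  by apply: ler_wpM2l; [exact: ltW|exact: ler_powR].
rewrite powR_mulrn// [t ^+ n.+1]exprS mulrA ler_wpM2r ?exprn_ge0//.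
by rewrite mulrC -ler_pdivrMr.
Unshelve. all: by end_near. Qed.

(** Potter's bounds with one argument fixed. *)
Lemma slowly_varying_growth f e : slowly_varying f -> 0 < e ->
  exists2 A, 0 < A & \forall t \near +oo, f t <= A * t `^ e /\ A^-1 * t `^ (- e) <= f t.
Proof.
move=> sf e0; have [T T1 hT] := slowly_varying_potter sf e0.
have T0 : 0 < T by lra.
have fT : 0 < f T by case: sf => _ + _; exact.
pose D := expR e * T `^ (- e).
have D0 : 0 < D by rewrite mulr_gt0 ?expR_gt0 ?powR_gt0.
exists (Num.max (D * f T) (D / f T)); first by rewrite lt_max mulr_gt0.
near=> t.
have tT : T <= t by near: t; apply: nbhs_pinfty_ge; exact: num_real.
have t0 : 0 < t by lra.
have [h1 h2] := hT _ _ (lexx T) tT.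
have E : expR e * (t / T) `^ e = D * t `^ e.
  by rewrite /D powRM ?invr_ge0 ?ltW// -mulrA [T `^ _ * _]mulrC -powR_inv1 ?ltW// -powRrM mulN1r.
rewrite E in h1 h2; split.
  rewrite (le_trans h1)// mulrAC ler_wpM2r ?powR_ge0//.
  by rewrite le_max lexx.
have ft : 0 < f t by case: sf => _ + _; exact.
rewrite powRN -invfM invf_ple ?posrE//; last first.
  by rewrite mulr_gt0 ?powR_gt0// lt_max mulr_gt0.
apply: (@le_trans _ _ (D / f T * t `^ e)); last first.
  by rewrite ler_wpM2r ?powR_ge0// le_max lexx orbT.
rewrite -[leLHS]mul1r ler_pdivrMr//.
rewrite (_ : _ * f t = D * t `^ e * f t / f T); last by rewrite mulrAC -!mulrA; congr (_ * _); ring.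
by rewrite ler_pdivlMr// mul1r.
Unshelve. all: by end_near. Qed.


Lemma near_pinfty_ge (P : R -> Prop) : (\forall t \near +oo, P t) ->
  exists2 T, 1 <= T & forall t, T <= t -> P t.
Proof.
move=> [T [Tr hT]]; exists (Num.max 1 (T + 1)); first by rewrite le_max lexx.
by move=> t; rewrite ge_max => /andP[_ tT]; apply: hT; lra.
Qed.

Lemma rate_lower b r : slowly_varying b -> 0 < r ->
  exists2 B, 0 < B & \forall t \near +oo, B * t `^ (r / 2) <= b t * t `^ r.
Proof.
move=> sb r0; have r20 : 0 < r / 2 by rewrite divr_gt0.
have [A A0 hA] := slowly_varying_growth sb r20.
exists A^-1; first by rewrite invr_gt0.
near=> t; have t0 : 0 < t by near: t; apply: nbhs_pinfty_gt; exact: num_real.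
have [_ h] : b t <= A * t `^ (r / 2) /\ A^-1 * t `^ (- (r / 2)) <= b t by near: t.
apply: le_trans (ler_wpM2r (powR_ge0 t r) h); rewrite -mulrA -powRD; last first.
  by rewrite (gt_eqF t0) implybT.
by rewrite (_ : - (r / 2) + r = r / 2)//; lra.
Unshelve. all: by end_near. Qed.

Lemma rate_sublinear b r a : slowly_varying b -> 0 < r < 1 -> 0 < a ->
  \forall t \near +oo, b t * t `^ r <= a * t.
Proof.
move=> sb /andP[r0 r1] a0; have e0 : 0 < (1 - r) / 2 by rewrite divr_gt0 ?subr_gt0.
have [A A0 hA] := slowly_varying_growth sb e0.
have /near_pinfty_ge[T T1 hT] := poly_le_exp 1 (A / a) ltr01 e0.
near=> t; have t1 : 1 <= t by near: t; apply: nbhs_pinfty_ge; exact: num_real.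
have t0 : 0 < t by lra.
have [h _] : b t <= A * t `^ ((1 - r) / 2) /\ A^-1 * t `^ (- ((1 - r) / 2)) <= b t.
  by near: t.
have tA : (A / a) `^ ((1 - r) / 2)^-1 <= t.
  by near: t; apply: nbhs_pinfty_ge; exact: num_real.
have Aa : A / a <= t `^ ((1 - r) / 2).
  have := ge0_ler_powR (ltW e0) _ _ tA.
  rewrite !nnegrE powR_ge0 (ltW t0) => /(_ isT isT).
  by rewrite -powRrM mulVf ?gt_eqF// powRr1// divr_ge0// ltW.
apply: le_trans (ler_wpM2r (powR_ge0 t r) h) _.
rewrite ler_pdivrMr// in Aa.
apply: (@le_trans _ _ (t `^ ((1 - r) / 2) * a * t `^ ((1 - r) / 2) * t `^ r)).
  by do 2 (apply: ler_wpM2r; first exact: powR_ge0).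
rewrite mulrAC -mulrA mulrAC -!powRD ?(gt_eqF t0) ?implybT//.
rewrite (_ : (1 - r) / 2 + (r + (1 - r) / 2) = 1); last by lra.
by rewrite powRr1 1?mulrC// ltW.
Unshelve. all: by end_near. Qed.

(** Slowly varying functions and powers are negligible against [expR] of a power
    of [t]. The factor [t ^+ 4] is what the summation over the levels of the
    weight will use up. *)
Lemma slowly_varying_subexp b c r e : slowly_varying b -> slowly_varying c ->
  0 < r -> 0 < e ->
  \forall t \near +oo, t ^+ 4 * c t <= expR (e * (b t * t `^ r)) /\
                       expR (- (e * (b t * t `^ r))) <= c t.
Proof.
move=> sb sc r0 e0; have r20 : 0 < r / 2 by rewrite divr_gt0.
have [B B0 hB] := rate_lower sb r0.
have [A A0 hA] := slowly_varying_growth sc ltr01.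
have eB : 0 < e * B by rewrite mulr_gt0.
have hP := poly_le_exp 5 A eB r20.
near=> t; have t1 : 1 <= t by near: t; apply: nbhs_pinfty_ge; exact: num_real.
have t0 : 0 < t by lra.
have [h1 h2] : c t <= A * t `^ 1 /\ A^-1 * t `^ (- 1) <= c t by near: t.
rewrite powRr1 ?(ltW t0)// in h1; rewrite powR_inv1 ?(ltW t0)// -invfM in h2.
have h3 : B * t `^ (r / 2) <= b t * t `^ r by near: t.
have h4 : A * t ^+ 5 <= expR (e * B * t `^ (r / 2)) by near: t.
have h5 : A * t ^+ 5 <= expR (e * (b t * t `^ r)).
  by apply: le_trans h4 _; rewrite ler_expR -mulrA; apply: ler_wpM2l => //; exact: ltW.
split.
  apply: le_trans h5; rewrite [t ^+ 5]exprS mulrA [leRHS]mulrC; apply: ler_wpM2l => //.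
  by rewrite exprn_ge0 ?ltW.
apply: le_trans h2; rewrite expRN lef_pV2 ?posrE ?expR_gt0 ?mulr_gt0//.
apply: le_trans h5; apply: ler_wpM2l; first exact: ltW.
by rewrite exprS ler_peMr ?exprn_ege1// ltW.
Unshelve. all: by end_near. Qed.

(** The exponent of the exponential Chebyshev inequality at scale [t] is
    dominated at every level [k] by the exponent of the tail at [k]: since
    [b t * t `^ (r - 1)] is essentially decreasing, the line of slope
    [b t * t `^ (r - 1)] stays below the curve [b k * k `^ r] up to [t]. *)
Lemma slope_le_rate b r e : slowly_varying b -> 0 < r < 1 -> 0 < e < 1 ->
  exists2 K, 1 <= K & forall t k, K <= t -> K <= k ->
    (1 - e) * (b t * t `^ r / t) * Num.min (k + 1) t <= (1 - e / 2) * (b k * k `^ r).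
Proof.
move=> sb /andP[r0 r1] /andP[e0 e1].
have e41 : 1 < 1 + e / 4 by rewrite ltrDl divr_gt0.
(* With this exponent in Potter's bounds, [expR h <= 1 + e / 4], while [h + r <=
   1] keeps the comparison of the rates per unit length in the right direction. *)
pose h := Num.min (Num.min r (1 - r)) (ln (1 + e / 4)).
have h0 : 0 < h by rewrite !lt_min r0 subr_gt0 r1 ln_gt0.
have hr : h <= r by rewrite !ge_min lexx.
have hr1 : h <= 1 - r by rewrite !ge_min lexx orbT.
have eh : expR h <= 1 + e / 4.
  have -> : 1 + e / 4 = expR (ln (1 + e / 4)) by rewrite lnK// posrE; lra.
  by rewrite ler_expR ge_min lexx orbT.
have [T T1 hT] := slowly_varying_potter sb h0.
have bpos t : 0 < t -> 0 < b t by case: sb => _ + _; exact.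
exists (Num.max T (4 / e)); first by rewrite le_max T1.
move=> t k; rewrite !ge_max => /andP[tT t4] /andP[kT k4].
have t0 : 0 < t by lra.
have k0 : 0 < k by lra.
have ke : k + 1 <= (1 + e / 4) * k.
  by move: k4; rewrite ler_pdivrMr// => k4; lra.
have kr := powR_gt0 r k0; have tr := powR_gt0 r t0.
have bk := bpos k k0; have bt := bpos t t0.
have fin x : 0 <= x -> x <= (1 + e / 4) * (1 + e / 4) * (b k * k `^ r) ->
    (1 - e) * x <= (1 - e / 2) * (b k * k `^ r).
  move=> x0 xle; apply: (@le_trans _ _ ((1 - e) * ((1 + e / 4) * (1 + e / 4) * (b k * k `^ r)))).
    by apply: ler_wpM2l => //; lra.
  by rewrite [leLHS]mulrA; apply: ler_wpM2r; [rewrite mulr_ge0// ltW|nra].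
have [kt|tk] := leP k t.
  rewrite -mulrA; apply: fin.
    by rewrite mulr_ge0 ?divr_ge0 ?mulr_ge0 ?(ltW t0) ?(ltW bt) ?(ltW tr)// le_min; apply/andP; lra.
  apply: (@le_trans _ _ (b t * t `^ r / t * ((1 + e / 4) * k))).
    apply: ler_wpM2l; first by rewrite divr_ge0 ?mulr_ge0// ltW.
    by rewrite ge_min ke.
  have [bth _] := hT _ _ kT kt.
  have pw : (t / k) `^ h * t `^ r / t * k <= k `^ r.
    have tk1 : 1 <= t / k by rewrite ler_pdivlMr// mul1r.
    have -> : (t / k) `^ h * t `^ r / t * k = (t / k) `^ (h + r - 1) * k `^ r.
      have tk0 : 0 < t / k by lra.
      rewrite powRD ?(gt_eqF tk0) ?implybT// powRD ?(gt_eqF tk0) ?implybT//.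
      rewrite powR_inv1 ?(ltW tk0)// invf_div.
      have -> : t `^ r = (t / k) `^ r * k `^ r.
        by rewrite -powRM ?(ltW tk0) ?(ltW k0)// divfK ?gt_eqF.
      by ring.
    rewrite -[leRHS]mul1r; apply: ler_wpM2r; first exact: ltW.
    by rewrite -[leRHS](powRr0 (t / k)); apply: ler_powR => //; lra.
  apply: (@le_trans _ _ (expR h * (t / k) `^ h * b k * t `^ r / t * ((1 + e / 4) * k))).
    apply: ler_wpM2r; first by rewrite mulr_ge0 ?(ltW k0)//; lra.
    apply: ler_wpM2r; first by rewrite invr_ge0 ltW.
    by apply: ler_wpM2r; first exact: ltW.
  have -> : expR h * (t / k) `^ h * b k * t `^ r / t * ((1 + e / 4) * k) =
    expR h * (1 + e / 4) * b k * ((t / k) `^ h * t `^ r / t * k) by ring.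
  rewrite [leRHS]mulrA; apply: ler_pM => //.
  - by rewrite !mulr_ge0 ?expR_ge0 ?(ltW bk)//; lra.
  - by rewrite !mulr_ge0 ?powR_ge0 ?invr_ge0 ?(ltW t0) ?(ltW k0).
  - by do 2 (apply: ler_wpM2r; first lra).
rewrite -mulrA; apply: fin.
  by rewrite mulr_ge0 ?divr_ge0 ?mulr_ge0 ?(ltW t0) ?(ltW bt) ?(ltW tr)// le_min; apply/andP; lra.
apply: (@le_trans _ _ (b t * t `^ r)).
  rewrite -[leRHS](@divfK _ t) ?gt_eqF//.
  apply: ler_wpM2l; first by rewrite divr_ge0 ?mulr_ge0// ltW.
  by rewrite ge_min lexx orbT.
have [_ bth] := hT _ _ tT (ltW tk).
have kt1 : 1 <= k / t by rewrite ler_pdivlMr// mul1r ltW.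
apply: (@le_trans _ _ (expR h * (k / t) `^ r * b k * t `^ r)).
  apply: ler_wpM2r; first exact: ltW.
  apply: le_trans bth _; apply: ler_wpM2r; first exact: ltW.
  by apply: ler_wpM2l; [exact: expR_ge0|exact: ler_powR].
have -> : expR h * (k / t) `^ r * b k * t `^ r = expR h * (b k * k `^ r).
  have -> : k `^ r = (k / t) `^ r * t `^ r.
    by rewrite -powRM ?divr_ge0 ?(ltW t0) ?(ltW k0)// divfK ?gt_eqF.
  by ring.
apply: ler_wpM2r; first by rewrite mulr_ge0// ltW.
by nra.
Qed.

End growth.

(** * Moments of one weight *)

Section tail_integral.
Variables (R : realType) (nu : probability R R) (b c : R -> R) (r : R).
Hypothesis r01 : 0 < r < 1.
Hypothesis sb : slowly_varying b.
Hypothesis sc : slowly_varying c.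
Hypothesis tail : forall t : R, 0 < t ->
  (nu [set s | (t < `|s|)%R] <= (c t * expR (- (b t * t `^ r)))%:E)%E.

Lemma measurable_tail_set (t : R) : measurable [set s : R | t < `|s|].
Proof.
rewrite (_ : [set s | _] = Num.norm @^-1` `]t, +oo[); last first.
  by apply/seteqP; split => s /=; rewrite in_itv/= andbT.
by rewrite -[X in measurable X]setTI; apply: normr_measurable => //; exact: measurable_itv.
Qed.

(** Summation by levels: the level [k < |s| <= k + 1] contributes at most
    [phi (k + 1)] times the tail at [k]. *)
Lemma tail_integral_le (phi : R -> R) (M : nat) (L : R) : (0 < M)%N -> 0 <= L ->
  measurable_fun setT phi -> (forall x, 0 <= phi x) ->
  (forall x y, 0 <= x -> x <= y -> phi x <= phi y) ->
  (forall k : nat, (M <= k)%N ->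
     phi (k%:R + 1) * (c k%:R * expR (- (b k%:R * k%:R `^ r))) <= L / (k%:R * (k%:R + 1))) ->
  (\int[nu]_s (if M%:R < `|s| then phi `|s| else 0)%:E <= (L / M%:R)%:E)%E.
Proof.
move=> M0 L0 mphi phi0 phim H.
pose f j s : \bar R := ((phi ((M + j)%:R + 1))%:E * (\1_[set s : R | (M + j)%:R < `|s|] s)%:E)%E.
have mf j : measurable_fun setT (f j).
  apply: emeasurable_funM; first exact: measurable_cst.
  by apply/measurable_EFinP; apply: measurable_indic; exact: measurable_tail_set.
have f0 j s : (0 <= f j s)%E by rewrite mule_ge0// lee_fin.
apply: (@le_trans _ _ (\int[nu]_s (\sum_(j <oo) f j s))%E).
  apply: ge0_le_integral => //.
  - by move=> s _; rewrite lee_fin; case: ifP.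
  - apply/measurable_EFinP; apply: measurable_fun_ifT => //.
      by apply: measurable_fun_ltr => //; exact: measurable_cst.
    by apply: measurableT_comp => //; exact: normr_measurable.
  - by apply: ge0_emeasurable_sum.
  move=> s _; case: ifPn => [Ms|_]; last by apply: nneseries_ge0.
  have [n sn nmin] : exists2 n : nat, `|s| <= n%:R & forall m, `|s| <= m%:R -> (n <= m)%N.
    have ex : exists n : nat, `|s| <= n%:R.
      by exists (Num.truncn `|s|).+1; rewrite ltW// truncnS_gt.
    by exists (ex_minn ex); case: ex_minnP.
  have Mn : (M < n)%N by rewrite -(ltr_nat R) (lt_le_trans Ms).
  have n1 : (M + (n.-1 - M))%N = n.-1 by rewrite subnKC// -ltnS prednK// (leq_ltn_trans _ Mn).
  have n1s : n.-1%:R < `|s|.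
    rewrite ltNge; apply/negP => /nmin.
    by case: (n) Mn => // k _; rewrite ltnn.
  apply: (@le_trans _ _ (f (n.-1 - M)%N s)).
    rewrite /f n1 indicE mem_set//= mule1 lee_fin natr1 prednK ?(leq_ltn_trans _ Mn)//.
    exact: phim.
  apply: le_trans (nneseries_lim_ge (n.-1 - M).+1 _) => //.
  by rewrite big_nat_recr//= leeDr// sume_ge0.
rewrite integral_nneseries//.
have tele N : \sum_(0 <= j < N) (L / ((M + j)%:R * ((M + j)%:R + 1))) =
    L / M%:R - L / (M + N)%:R.
  elim: N => [|N IH]; first by rewrite big_geq// addn0 subrr.
  rewrite big_nat_recr//= IH addnS -natr1.
  have : (M + N)%:R != 0 :> R by rewrite pnatr_eq0 addn_eq0 (gtn_eqF M0).
  have : (M + N)%:R + 1 != 0 :> R by rewrite natr1 pnatr_eq0.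
  have : M%:R != 0 :> R by rewrite pnatr_eq0 (gtn_eqF M0).
  move: (M + N)%:R M%:R => u v v0 u1 u0.
  by field; rewrite v0 u0 u1.
apply: lime_le; first by apply: is_cvg_nneseries => j _ _; exact: integral_ge0.
near=> N; apply: (@le_trans _ _ (\sum_(0 <= j < N) (L / ((M + j)%:R * ((M + j)%:R + 1)))%:E)%E).
  apply: lee_sum => j _; rewrite /f ge0_integralZl//; last 2 first.
  - by apply/measurable_EFinP; apply: measurable_indic; exact: measurable_tail_set.
  - by rewrite lee_fin.
  rewrite integral_indic//; last exact: measurable_tail_set.
  rewrite setIT.
  have Mj0 : 0 < (M + j)%:R :> R by rewrite ltr0n addn_gt0 M0.
  apply: (@le_trans _ _ ((phi ((M + j)%:R + 1))%:E *
     (c (M + j)%:R * expR (- (b (M + j)%:R * (M + j)%:R `^ r)))%:E)%E).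
    by apply: lee_wpmul2l; [rewrite lee_fin|exact: tail].
  by rewrite -EFinM lee_fin; apply: H; exact: leq_addr.
by rewrite sumEFin tele lee_fin gerBl divr_ge0.
Unshelve. all: by end_near. Qed.

(** Dominates the part of the weight that capping at [M] discards. *)
Definition excess (M : nat) (s : R) : R := if M%:R < `|s| then `|s| else 0.

Lemma excess_ge0 M s : 0 <= excess M s.
Proof. by rewrite /excess; case: ifP. Qed.

Lemma measurable_excess M : measurable_fun setT (excess M).
Proof.
apply: measurable_fun_ifT => //.
by apply: measurable_fun_ltr => //; exact: measurable_cst.
Qed.

Lemma norm_le_excess M s : `|s| <= Num.min `|s| M%:R + excess M s.
Proof.
rewrite /excess minElt; case: (ltgtP `|s| M%:R) => h; rewrite ?addr0//.
  by rewrite lerDr ler0n.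
by rewrite h.
Qed.

(** The level sums converge: a fixed fraction of the exponential decay absorbs
    the slowly varying prefactor and the polynomial weights. *)
Lemma level_bound e : 0 < e -> exists2 K : R, 4 <= K & forall k, K <= k ->
  (k + 1) * (c k * expR (- (e * (b k * k `^ r)))) <= 1 / (k * (k + 1)).
Proof.
move=> e0; case/andP: r01 => r0 _.
have /near_pinfty_ge[K K1 hK] := slowly_varying_subexp sb sc r0 e0.
exists (Num.max 4 K); first by rewrite le_max lexx.
move=> k; rewrite ge_max => /andP[k4 kK]; have [h _] := hK _ kK.
have k0 : 0 < k by lra.
have c0 : 0 < c k by case: sc => _ + _; exact.
rewrite ler_pdivlMr ?mulr_gt0//; last by rewrite addr_gt0.
rewrite expRN mulrA mulrAC ler_pdivrMr ?expR_gt0// mul1r.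
apply: le_trans h; rewrite mulrAC; apply: ler_wpM2r; first exact: ltW.
rewrite (_ : (k + 1) * (k * (k + 1)) = k * (k + 1) ^+ 2); last by ring.
rewrite [leRHS]exprS; apply: ler_wpM2l; first exact: ltW.
rewrite exprS -subr_ge0 (_ : _ - _ = k ^+ 2 * (k - 1) - (2 * k + 1)); last by ring.
(* The bound [4 <= k] makes [(k + 1) ^+ 2] at most [k ^+ 3]. *)
have h1 : 16 <= k ^+ 2 by rewrite expr2; nra.
by rewrite subr_ge0; nra.
Qed.

(** The slope [b t * t `^ r / t], reduced by a factor [1 - e], is small enough
    for the exponential moment of the excess capped at [t] to be barely larger
    than [1]. At the level [k], by [slope_le_rate], the exponential uses up at
    most the fraction [1 - e / 2] of the exponent of the tail, and the rest
    makes the levels summable; the bound is proportional to the slope because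
    [expR u - 1 <= u * expR u]. *)
Lemma exp_moment e : 0 < e < 1 -> exists2 K : nat, (0 < K)%N &
  forall (M : nat) t, (K <= M)%N -> K%:R <= t ->
  (\int[nu]_s (expR ((1 - e) * (b t * t `^ r / t) * Num.min (excess M s) t))%:E <=
   (1 + (1 - e) * (b t * t `^ r / t) / M%:R)%:E)%E.
Proof.
move=> /andP[e0 e1].
have e20 : 0 < e / 2 by rewrite divr_gt0.
have [K1 K14 hK1] := level_bound e20.
have e01 : 0 < e < 1 by rewrite e0.
have [K2 K21 hK2] := slope_le_rate sb r01 e01.
exists (Num.truncn (Num.max K1 K2)).+1 => // M t KM Kt.
have KK : Num.max K1 K2 <= (Num.truncn (Num.max K1 K2)).+1%:R by rewrite ltW// truncnS_gt.
have [tK1 tK2] : K1 <= t /\ K2 <= t.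
  by have := le_trans KK Kt; rewrite ge_max => /andP.
have t0 : 0 < t by lra.
have bt : 0 < b t by case: sb => _ + _; exact.
set lam := (1 - e) * _.
have lam0 : 0 <= lam.
  by rewrite mulr_ge0 ?divr_ge0 ?mulr_ge0 ?powR_ge0 ?(ltW t0) ?(ltW bt)//; lra.
have M0 : (0 < M)%N by exact: leq_trans KM.
pose phi x : R := expR (lam * Num.min (Num.max 0 x) t) - 1.
have phi0 x : 0 <= phi x.
  rewrite subr_ge0 -[leLHS]expR0 ler_expR mulr_ge0// le_min (ltW t0) andbT.
  by rewrite le_max lexx.
have mphi : measurable_fun setT phi.
  apply: measurable_funB; last exact: measurable_cst.
  apply: measurableT_comp; first exact: measurable_expR.
  apply: measurable_funM; first exact: measurable_cst.
  apply: measurable_minr; last exact: measurable_cst.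
  by apply: measurable_maxr => //; exact: measurable_cst.
have := @tail_integral_le phi M lam M0 lam0 mphi phi0 _ _ => /(_ _ _) tl.
apply: (@le_trans _ _ (\int[nu]_s (1%:E + (if M%:R < `|s| then phi `|s| else 0)%:E))%E).
  rewrite le_eqVlt; apply/orP; left; apply/eqP; apply: eq_integral => s _.
  rewrite -EFinD /excess /phi; congr _%:E; case: ifP => _.
    by rewrite (max_idPr _)// addrC subrK.
  by rewrite (min_idPl _) ?(ltW t0)// mulr0 expR0 addr0.
rewrite ge0_integralD//; last 2 first.
- by move=> s _; rewrite lee_fin; case: ifP.
- apply/measurable_EFinP; apply: measurable_fun_ifT => //.
    by apply: measurable_fun_ltr => //; exact: measurable_cst.
  by apply: measurableT_comp => //; exact: normr_measurable.
rewrite EFinD; apply: leeD; first by rewrite integral_cst// mul1e probability_le1.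
apply: tl.
  move=> x y x0 xy; rewrite lerD2r ler_expR; apply: ler_wpM2l => //.
  by rewrite le_min !ge_min lexx orbT andbT !(max_idPr _)// ?xy// (le_trans x0).
move=> k Mk.
have KKk : Num.max K1 K2 <= k%:R.
  by apply: le_trans KK _; rewrite ler_nat (leq_trans KM).
have [kK1 kK2] : K1 <= k%:R /\ K2 <= k%:R by move: KKk; rewrite ge_max => /andP.
have k0 : 0 < k%:R :> R by lra.
have ck : 0 < c k%:R by case: sc => _ + _; exact.
have u0 : 0 <= Num.min (k%:R + 1) t by rewrite le_min (ltW t0) andbT; lra.
have phik : phi (k%:R + 1) <= lam * (k%:R + 1) * expR (lam * Num.min (k%:R + 1) t).
  rewrite /phi (max_idPr _); last lra.
  set u := lam * _.
  have uu : u <= lam * (k%:R + 1) by apply: ler_wpM2l => //; rewrite ge_min lexx.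
  have h : expR u - 1 <= u * expR u.
    have := expR_ge1Dx (- u); rewrite expRN => h.
    have eu := expR_gt0 u.
    rewrite -(ler_pM2r eu) mulVf ?gt_eqF// in h; lra.
  by apply: le_trans h _; apply: ler_wpM2r; [exact: expR_ge0|].
have hs := hK2 t k%:R tK2 kK2; rewrite -/lam in hs.
apply: (@le_trans _ _ (lam * (k%:R + 1) * expR ((1 - e / 2) * (b k%:R * k%:R `^ r)) *
    (c k%:R * expR (- (b k%:R * k%:R `^ r))))).
  apply: ler_wpM2r; first by rewrite mulr_ge0 ?expR_ge0 ?ltW.
  apply: le_trans phik _; apply: ler_wpM2l; last by rewrite ler_expR.
  by rewrite mulr_ge0//; lra.
have h := ler_wpM2l lam0 (hK1 _ kK1); rewrite mul1r in h; apply: le_trans h.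
rewrite le_eqVlt; apply/orP; left; apply/eqP.
rewrite (_ : - (e / 2 * (b k%:R * k%:R `^ r)) =
  (1 - e / 2) * (b k%:R * k%:R `^ r) + - (b k%:R * k%:R `^ r)); last by ring.
by rewrite expRD; ring.
Qed.

Lemma excess_mean : exists2 K : nat, (0 < K)%N &
  forall M : nat, (K <= M)%N -> (\int[nu]_s (excess M s)%:E <= (1 / M%:R)%:E)%E.
Proof.
have [K1 K14 hK1] := level_bound ltr01.
exists (Num.truncn K1).+1 => // M KM.
have KK : K1 <= (Num.truncn K1).+1%:R by rewrite ltW// truncnS_gt.
have M0 : (0 < M)%N by exact: leq_trans KM.
have -> : (\int[nu]_s (excess M s)%:E =
    \int[nu]_s (if (M%:R < `|s|)%R then Num.max 0%R `|s| else 0%R)%:E)%E.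
  by apply: eq_integral => s _; rewrite /excess (max_idPr _).
apply: (@tail_integral_le (fun x => Num.max 0 x)) => //.
- by apply: measurable_maxr => //; exact: measurable_cst.
- by move=> x; rewrite le_max lexx.
- by move=> x y x0 xy; rewrite !(max_idPr _)// (le_trans x0).
move=> k Mk.
have kK1 : K1 <= k%:R by apply: le_trans KK _; rewrite ler_nat (leq_trans KM).
rewrite (max_idPr _); last lra.
by have := hK1 _ kK1; rewrite !mul1r.
Qed.

Lemma moment_lty : (\int[nu]_s `|s|%:E < +oo)%E.
Proof.
have [K K0 /(_ _ (leqnn K)) hK] := excess_mean.
apply: (@le_lt_trans _ _ (\int[nu]_s (K%:R%:E + (excess K s)%:E))%E).
  apply: ge0_le_integral => //.
  - by apply/measurable_EFinP; exact: normr_measurable.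
  - apply: emeasurable_funD; first exact: measurable_cst.
    by apply/measurable_EFinP; exact: measurable_excess.
  move=> s _; rewrite -EFinD lee_fin (le_trans (norm_le_excess K s))// lerD2r.
  by rewrite ge_min lexx orbT.
rewrite ge0_integralD//; last 2 first.
- by move=> s _; rewrite lee_fin excess_ge0.
- by apply/measurable_EFinP; exact: measurable_excess.
rewrite integral_cst// lte_add_pinfty//; last exact: le_lt_trans hK (ltry _).
by apply: lte_mul_pinfty => //; apply: le_lt_trans (probability_le1 _ _) (ltry _).
Qed.

End tail_integral.

(** * Large deviations of sums *)

Section deviations.
Variables (R : realType) (d : nat).
Local Notation W := (field R (edge d)).
Variables (Q : probability W R) (nu : probability R R).
Hypothesis Qcyl : forall J B, (forall i, measurable (B i)) ->
  Q (cylinder J B) = (\prod_(i <- J) nu (B i))%E.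

Lemma prode_le (T : eqType) (s : seq T) (f : T -> \bar R) (a : R) : 0 <= a ->
  (forall x, 0 <= f x)%E -> (forall x, x \in s -> f x <= a%:E)%E ->
  (\prod_(x <- s) f x <= (a ^+ size s)%:E)%E.
Proof.
move=> a0 f0; elim: s => [|x s IH] fa; first by rewrite big_nil expr0.
rewrite big_cons exprS EFinM; apply: lee_pmul => //.
- by apply: prode_ge0.
- by apply: fa; rewrite mem_head.
- by apply: IH => y ys; apply: fa; rewrite inE ys orbT.
Qed.

(** Markov's inequality for the exponential of the sum, whose integral factorises
    over the disjoint sets [A x]. *)
Lemma chernoff (T : eqType) (s : seq T) (A : T -> set (edge d)) (X : T -> W -> R) (th u v : R) :
  uniq s -> (forall x y, x \in s -> y \in s -> x != y -> A x `&` A y = set0) ->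
  (forall x, measurable_fun setT (X x)) -> (forall x, depends_on (A x) (X x)) ->
  0 <= th -> 0 <= v ->
  (forall x, x \in s -> (\int[Q]_w (expR (th * X x w))%:E <= v%:E)%E) ->
  (Q [set w | (u <= \sum_(x <- s) X x w)%R] <= (expR (- (th * u)) * v ^+ size s)%:E)%E.
Proof.
move=> us dA mX dX th0 v0 Xv.
have mS : measurable_fun setT (fun w => \sum_(x <- s) X x w) by exact: measurable_sum.
have mE : measurable [set w : W | (u <= \sum_(x <- s) X x w)%R].
  rewrite (_ : [set w | _] = (fun w : W => \sum_(x <- s) X x w) @^-1` `[u, +oo[).
    by rewrite -[X in measurable X]setTI; apply: mS => //; exact: measurable_itv.
  by apply/seteqP; split => w /=; rewrite in_itv/= andbT.
have mexp x : measurable_fun setT (fun w => (expR (th * X x w))%:E).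
  apply/measurable_EFinP; apply: measurableT_comp; first exact: measurable_expR.
  by apply: measurable_funM => //; exact: measurable_cst.
have prodE w : (\prod_(x <- s) (expR (th * X x w))%:E =
    (expR (th * \sum_(x <- s) X x w))%:E)%E.
  by rewrite prodEFin -expR_sum mulr_sumr.
have mprod : measurable_fun setT (fun w => \prod_(x <- s) (expR (th * X x w))%:E)%E.
  rewrite (_ : (fun w => _) = (fun w => (expR (th * \sum_(x <- s) X x w))%:E)).
    apply/measurable_EFinP; apply: measurableT_comp; first exact: measurable_expR.
    by apply: measurable_funM => //; exact: measurable_cst.
  by apply/funext.
rewrite -(setIT [set w | _]) -integral_indic//.
apply: (@le_trans _ _ (\int[Q]_w ((expR (- (th * u)))%:E *
    \prod_(x <- s) (expR (th * X x w))%:E))%E).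
  apply: ge0_le_integral => //.
  - by apply/measurable_EFinP; exact: measurable_indic.
  - apply: emeasurable_funM; first exact: measurable_cst.
    exact: mprod.
  move=> w _; rewrite prodE -EFinM -expRD lee_fin indicE.
  have [/set_mem /= uw|_] := boolP (w \in _); last exact: expR_ge0.
  by rewrite -[leLHS]expR0 ler_expR addrC subr_ge0; apply: ler_wpM2l.
rewrite ge0_integralZl//; last first.
  by move=> w _; apply: prode_ge0 => x _; rewrite lee_fin expR_ge0.
rewrite EFinM; apply: lee_wpmul2l; first by rewrite lee_fin expR_ge0.
rewrite (indep_prod Qcyl us dA)//.
  by apply: prode_le => // x; apply: integral_ge0 => w _; rewrite lee_fin expR_ge0.
by move=> x w w' ww'; rewrite (dX x w w').
Qed.

(** A sum of excesses deviates at the cost of a single large weight. One excess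
    above [t] is enough for the event, so all may be capped at [t]; then
    [chernoff] applies with the slope [lam] of [exp_moment], for which
    [lam * t = (1 - e) * (b t * t `^ r)]. Each edge of [J] contributes a factor
    [1 + lam / M], and the bound on the size of [J] keeps the product below
    [expR (e * (lam * t))]. *)
Lemma excess_sum_deviation (b c : R -> R) (r e : R) :
  0 < r < 1 -> slowly_varying b -> slowly_varying c ->
  (forall t : R, 0 < t ->
    (nu [set s | (t < `|s|)%R] <= (c t * expR (- (b t * t `^ r)))%:E)%E) ->
  0 < e < 1 -> exists2 K : nat, (0 < K)%N &
  forall (M : nat) (t : R) (J : {fset edge d}), (K <= M)%N -> K%:R <= t ->
  #|` J|%:R <= e * M%:R * t ->
  (Q [set w | (t <= \sum_(i <- J) excess M (w i))%R] <=
   (expR (- ((1 - e) ^+ 2 * (b t * t `^ r))))%:E)%E.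
Proof.
move=> r01 sb sc tail e01; have [K K0 hK] := exp_moment r01 sb sc tail e01.
exists K => // M t J KM Kt Jle.
have M0 : 0 < M%:R :> R by rewrite ltr0n (leq_trans K0).
have t0 : 0 < t by apply: lt_le_trans Kt; rewrite ltr0n.
have bt : 0 < b t by case: sb => _ + _; exact.
have e10 : 0 < 1 - e by case/andP: e01; rewrite subr_gt0.
set lam := (1 - e) * (b t * t `^ r / t).
have lam0 : 0 <= lam by rewrite mulr_ge0 ?divr_ge0 ?mulr_ge0 ?powR_ge0 ?(ltW t0) ?(ltW bt) ?(ltW e10).
have sub : [set w : W | (t <= \sum_(i <- J) excess M (w i))%R] `<=`
    [set w : W | (t <= \sum_(i <- J) Num.min (excess M (w i)) t)%R].
  move=> w /= h; have [/hasP[i iJ ti]|/hasPn small] := boolP (has (fun i => t <= excess M (w i)) J).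
    rewrite (big_rem i)//= (min_idPr ti) lerDl sumr_ge0// => j _.
    by rewrite le_min excess_ge0 ltW.
  apply: le_trans h _; rewrite le_eqVlt; apply/orP; left; apply/eqP.
  apply: eq_big_seq => i iJ; rewrite (min_idPl _)// ltW// ltNge.
  exact: small.
have mmin : measurable_fun setT (fun s => Num.min (excess M s) t).
  by apply: measurable_minr; [exact: measurable_excess|exact: measurable_cst].
have mX i : measurable_fun setT (fun w : W => Num.min (excess M (w i)) t).
  by apply: (measurableT_comp mmin); exact: measurable_coord.
have mS (g : R -> R) : measurable_fun setT g ->
    measurable [set w : W | (t <= \sum_(i <- J) g (w i))%R].
  move=> mg; rewrite (_ : [set w | _] = (fun w : W => \sum_(i <- J) g (w i)) @^-1` `[t, +oo[).
    rewrite -[X in measurable X]setTI; by apply: (measurable_sum_weight J mg).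
  by apply/seteqP; split => w /=; rewrite in_itv/= andbT.
apply: (@le_trans _ _ (Q [set w : W | (t <= \sum_(i <- J) Num.min (excess M (w i)) t)%R])).
  apply: le_measure; rewrite ?inE//.
  - by apply: mS; exact: measurable_excess.
  - exact: (mS _ mmin).
have v0 : 0 <= 1 + lam / M%:R by rewrite addr_ge0// divr_ge0// ltW.
have iexp i : (\int[Q]_w (expR (lam * Num.min (excess M (w i)) t))%:E <=
    (1 + lam / M%:R)%:E)%E.
  rewrite (@integral_coord R d Q nu Qcyl
    (fun s => (expR (lam * Num.min (excess M s) t))%:E)); first exact: hK.
    apply/measurable_EFinP; apply: measurableT_comp; first exact: measurable_expR.
    by apply: measurable_funM => //; exact: measurable_cst.
  by move=> s; rewrite lee_fin expR_ge0.
apply: (@le_trans _ _ (expR (- (lam * t)) * (1 + lam / M%:R) ^+ #|` J|)%:E).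
  apply: (@chernoff _ J (fun i => [set i])
    (fun i (w : W) => Num.min (excess M (w i)) t)) => //.
    by move=> i j _ _ ij; rewrite -subset0 => k [/= -> ji]; rewrite ji eqxx in ij.
  by move=> i w w' ww'; rewrite ww'.
rewrite lee_fin; apply: (@le_trans _ _ (expR (- (lam * t)) * expR (lam / M%:R) ^+ #|` J|)).
  apply: ler_wpM2l; first exact: expR_ge0.
  by apply: lerXn2r; rewrite ?nnegrE ?expR_ge0//; exact: expR_ge1Dx.
rewrite -expRM_natr -expRD ler_expR.
have h : lam / M%:R * #|` J|%:R <= e * (lam * t).
  rewrite -mulrA (_ : e * (lam * t) = lam * (e * t)); last by ring.
  by apply: ler_wpM2l => //; rewrite mulrC ler_pdivrMr// mulrAC.
have lt : lam * t = (1 - e) * (b t * t `^ r).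
  by rewrite /lam -mulrA divfK ?gt_eqF.
by rewrite lt in h *; rewrite expr2; lra.
Qed.

Lemma integral_cst_probability (a : R) : (\int[Q]_w a%:E = a%:E)%E.
Proof.
transitivity (a%:E * Q setT)%E; first exact: integral_cst.
by rewrite probability_setT mule1.
Qed.

Lemma expR_le_quadratic (x : R) : 0 <= x -> x <= 2^-1 -> expR x <= 1 + x + 2 * x ^+ 2.
Proof.
move=> x0 x2; have := expR_ge1Dx (- x); rewrite expRN => h.
have ex := expR_gt0 x.
have {}h : (1 - x) * expR x <= 1.
  by rewrite -ler_pdivlMr// mul1r.
have : 1 <= (1 - x) * (1 + x + 2 * x ^+ 2) by rewrite expr2; nra.
have x1 : 0 < 1 - x by lra.
by move=> /(le_trans h); rewrite ler_pM2l.
Qed.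

(** Second-order expansion of the exponential, for [th * B] small. *)
Lemma bounded_exp_moment (X : W -> R) (B a th : R) : measurable_fun setT X ->
  (forall w, 0 <= X w <= B) -> (\int[Q]_w (X w)%:E <= a%:E)%E ->
  0 <= th -> th * B <= 2^-1 ->
  (\int[Q]_w (expR (th * X w))%:E <= (expR (th * a + 2 * (th * B) ^+ 2))%:E)%E.
Proof.
move=> mX XB Xa th0 thB.
have thX w : 0 <= th * X w <= th * B.
  by have /andP[x0 xB] := XB w; rewrite mulr_ge0//=; exact: ler_wpM2l.
apply: (@le_trans _ _ (\int[Q]_w ((1 + 2 * (th * B) ^+ 2)%:E + th%:E * (X w)%:E))%E).
  apply: ge0_le_integral => //.
  - apply/measurable_EFinP; apply: measurableT_comp; first exact: measurable_expR.
    by apply: measurable_funM => //; exact: measurable_cst.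
  - apply: emeasurable_funD; first exact: measurable_cst.
    by apply/measurable_EFinP; apply: measurable_funM => //; exact: measurable_cst.
  move=> w _; rewrite -EFinM -EFinD lee_fin; have /andP[u0 uB] := thX w.
  apply: le_trans (expR_le_quadratic u0 (le_trans uB thB)) _.
  have : (th * X w) ^+ 2 <= (th * B) ^+ 2 by apply: lerXn2r; rewrite ?nnegrE// (le_trans u0).
  by lra.
have B0 : 0 <= (th * B) ^+ 2 by exact: sqr_ge0.
rewrite ge0_integralD//; last 3 first.
- by move=> w _; rewrite lee_fin addr_ge0// mulr_ge0.
- by move=> w _; rewrite -EFinM lee_fin; have /andP[] := thX w.
- by apply/measurable_EFinP; apply: measurable_funM => //; exact: measurable_cst.
rewrite integral_cst_probability ge0_integralZl//; last 2 first.
- exact/measurable_EFinP.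
- by move=> w _; rewrite lee_fin; have /andP[] := XB w.
apply: (@le_trans _ _ ((1 + 2 * (th * B) ^+ 2)%:E + th%:E * a%:E)%E).
  by rewrite leeD2lE//; apply: lee_wpmul2l.
rewrite -EFinM -EFinD lee_fin; apply: le_trans (expR_ge1Dx _).
by lra.
Qed.

(** Bounded summands that are independent within each residue class modulo [q]
    concentrate exponentially: some class carries its share of the deviation. *)
Lemma block_deviation (B a e : R) (q : nat) : (0 < q)%N -> 0 < B -> 0 < e ->
  exists2 kap : R, 0 < kap & forall (k : nat) (X : nat -> W -> R) (A : nat -> set (edge d)),
  (forall j, measurable_fun setT (X j)) -> (forall j, depends_on (A j) (X j)) ->
  (forall j w, 0 <= X j w <= B) -> (forall j, \int[Q]_w (X j w)%:E <= a%:E)%E ->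
  (forall i j, (i = j %[mod q])%N -> i != j -> A i `&` A j = set0) ->
  (Q [set w | ((a + e) * k%:R <= \sum_(0 <= j < k) X j w)%R] <=
   (q%:R * expR (- (kap * k%:R)))%:E)%E.
Proof.
move=> q0 B0 e0; have q0' : 0 < q%:R :> R by rewrite ltr0n.
(* The quadratic term of [bounded_exp_moment] takes at most half of the gain [th
   * e / q] per summand. *)
pose th := Num.min (2^-1 / B) (e / (4 * B ^+ 2 * q%:R)).
have th0 : 0 < th.
  by rewrite lt_min !divr_gt0 ?mulr_gt0 ?invr_gt0 ?exprn_gt0// ltr0n.
have thB : th * B <= 2^-1 by rewrite -ler_pdivlMr// ge_min lexx.
have the : 4 * B ^+ 2 * th <= e / q%:R.
  rewrite ler_pdivlMr// mulrAC -ler_pdivlMl ?mulr_gt0 ?exprn_gt0//.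
  by rewrite mulrC ge_min lexx orbT.
exists (th * e / (2 * q%:R)); first by rewrite divr_gt0 ?mulr_gt0.
move=> k X A mX dX XB Xa disj.
pose s (c : 'I_q) := [seq j <- index_iota 0 k | (j %% q == c)%N].
have ssum (f : nat -> R) : \sum_(0 <= j < k) f j = \sum_(c < q) \sum_(j <- s c) f j.
  rewrite (partition_big (fun j => Ordinal (ltn_pmod j q0)) xpredT)//=.
  by apply: eq_bigr => c _; rewrite big_filter; apply: eq_bigl => j; rewrite -val_eqE.
have sk c : (size (s c) <= k)%N.
  by rewrite size_filter (leq_trans (count_size _ _))// size_iota subn0.
pose E n : set W := if insub n is Some c then
  [set w | a * (size (s c))%:R + e * k%:R / q%:R <= \sum_(j <- s c) X j w] else set0.
have mS c u : measurable [set w : W | u <= \sum_(j <- s c) X j w].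
  rewrite (_ : [set w | _] = (fun w : W => \sum_(j <- s c) X j w) @^-1` `[u, +oo[).
    rewrite -[X in measurable X]setTI; apply: (measurable_sum (s c) mX) => //.
  by apply/seteqP; split => w /=; rewrite in_itv/= andbT.
have mE n : measurable (E n).
  by rewrite /E; case: insubP => [c _ _|_]; [exact: mS|exact: measurable0].
have mT : measurable [set w : W | (a + e) * k%:R <= \sum_(0 <= j < k) X j w].
  rewrite (_ : [set w | _] = (fun w : W => \sum_(0 <= j < k) X j w) @^-1` `[(a + e) * k%:R, +oo[).
    rewrite -[X in measurable X]setTI; apply: (measurable_sum (index_iota 0 k) mX) => //.
  by apply/seteqP; split => w /=; rewrite in_itv/= andbT.
apply: (@le_trans _ _ (Q (\big[setU/set0]_(c < q) E c))).
  apply: le_measure; rewrite ?inE//; first by apply: bigsetU_measurable.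
  move=> w /= h; rewrite -bigcup_mkord; apply: contrapT => nE.
  move: h; apply/negP; rewrite -ltNge ssum.
  have lt c : \sum_(j <- s c) X j w < a * (size (s c))%:R + e * k%:R / q%:R.
    rewrite ltNge; apply/negP => h; apply: nE; exists (val c) => //=.
    by rewrite /E valK.
  apply: (@lt_le_trans _ _ (\sum_(c < q) (a * (size (s c))%:R + e * k%:R / q%:R))).
    by apply: ltr_sum => //; apply/hasP; exists (Ordinal q0).
  rewrite big_split/= -mulr_sumr sumr_const card_ord -[X in _ + X]mulr_natr divfK ?gt_eqF//.
  have : \sum_(c < q) (size (s c))%:R = k%:R :> R.
    transitivity (\sum_(c < q) \sum_(j <- s c) (1 : R)).
      by apply: eq_bigr => c _; rewrite big_const_seq count_predT iter_addr_0.
    by rewrite -ssum sumr_const_nat subn0.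
  by move=> ->; rewrite mulrDl.
apply: le_trans (Boole_inequality _ _) _; first by move=> i _; exact: mE.
apply: (@le_trans _ _ (\sum_(c < q) (expR (- (th * e / (2 * q%:R) * k%:R)))%:E)%E); last first.
  by rewrite sumEFin sumr_const card_ord [X in (_ <= X%:E)%E]mulr_natl.
apply: lee_sum => c _; rewrite /E valK.
have uniqs : uniq (s c) by rewrite filter_uniq// iota_uniq.
have := @chernoff _ (s c) A X th (a * (size (s c))%:R + e * k%:R / q%:R)
  (expR (th * a + 2 * (th * B) ^+ 2)) uniqs _ mX dX (ltW th0) (expR_ge0 _) _.
move=> /(_ _ _)/le_trans; apply.
- move=> i j; rewrite !mem_filter => /andP[/eqP ic _] /andP[/eqP jc _] ij.
  by apply: disj => //; rewrite ic jc.
- move=> j _; apply: bounded_exp_moment => //; exact: ltW.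
rewrite lee_fin -expRM_natr -expRD ler_expR.
have n0 : 0 <= k%:R :> R by [].
have nk : (size (s c))%:R <= k%:R :> R by rewrite ler_nat.
set n := (size (s c))%:R in nk *.
have h1 : 2 * (th * B) ^+ 2 * n <= th * (e / q%:R) / 2 * k%:R.
  have h2 : 2 * (th * B) ^+ 2 <= th * (e / q%:R) / 2.
    rewrite (_ : 2 * (th * B) ^+ 2 = th * (4 * B ^+ 2 * th) / 2); last by rewrite !expr2; field.
    by rewrite ler_pM2r ?invr_gt0// ler_pM2l.
  apply: ler_pM => //; by rewrite mulr_ge0// sqr_ge0.
rewrite (_ : th * e / (2 * q%:R) * k%:R = th * (e / q%:R) / 2 * k%:R); last first.
  by field; rewrite gt_eqF.
rewrite (_ : e * k%:R / q%:R = e / q%:R * k%:R); last by ring.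
by lra.
Qed.

End deviations.

(** * Raising the edges at the origin *)

Section star.
Variable d : nat.
Implicit Types (x y z v : 'rV[int]_d) (p : seq 'rV[int]_d).

Definition signed_unit (q : 'I_d * bool) : 'rV[int]_d :=
  (if q.2 then 1 else -1) *: delta_mx 0 q.1.

Lemma star_edge_subproof q : is_edge [fset (0 : 'rV[int]_d); signed_unit q]%fset.
Proof.
apply/asboolP; exists 0, (signed_unit q); split=> //.
by rewrite -[signed_unit q]add0r; apply: adjacent_delta; case: q.2.
Qed.

Definition star_edge q : edge d := exist _ [fset (0 : 'rV[int]_d); signed_unit q]%fset (star_edge_subproof q).

Definition star : {fset edge d} := [fset star_edge q | q : 'I_d * bool]%fset.

Lemma card_star : (#|` star| <= 2 * d)%N.
Proof.
apply: leq_trans (leq_imfset_card _ _ _) _.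
by rewrite /= -cardE card_prod card_ord card_bool mulnC.
Qed.

Lemma in_star (e : edge d) : (0 : 'rV[int]_d) \in val e -> e \in star.
Proof.
move: e => [e ee] /= e0; have /asboolP[x [y [xy eE]]] := ee.
have [z [z1 eE']] : exists z, \sum_(i < d) `|z 0 i| = 1 :> int /\
    e = [fset (0 : 'rV[int]_d); z]%fset.
  move: e0; rewrite eE => /fset2P[] h0; [exists y|exists x].
    split=> //; last by rewrite h0.
    apply: etrans (eqP xy); rewrite -h0; apply: eq_bigr => i _.
    by rewrite mxE sub0r normrN.
  split; last by rewrite -h0 fsetUC.
  apply: etrans (eqP xy); rewrite -h0; apply: eq_bigr => i _.
  by rewrite mxE subr0.
have [i zi] : exists i, z 0 i != 0.
  apply/existsP; apply: contraPT z1 => /existsPn H.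
  by rewrite big1// => i _; move: (H i); rewrite negbK => /eqP ->; rewrite normr0.
rewrite (bigD1 i)//= in z1.
have r0 : 0 <= \sum_(j < d | j != i) `|z 0 j| by apply: sumr_ge0.
have rE : \sum_(j < d | j != i) `|z 0 j| = 0.
  move: zi z1 r0; move: (\sum_(j < d | j != i) _) (z 0 i) => S t; lia.
have zj j : j != i -> z 0 j = 0.
  move=> ji; apply/eqP; rewrite -normr_eq0 eq_le normr_ge0 andbT -rE.
  by rewrite (bigD1 j)//= lerDl sumr_ge0.
apply/imfsetP; exists (i, 0 < z 0 i) => //=.
apply: val_inj => /=; rewrite eE'; congr [fset _; _]%fset.
apply/rowP => j; rewrite !mxE /= eq_sym; case: eqP => [ji|/eqP ji] /=; last by rewrite mulr0 zj 1?eq_sym.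
rewrite -ji; move: zi z1; rewrite rE addr0; move: (z 0 i) => t; rewrite mulr1; case: ifP; lia.
Qed.

Lemma path_from0_meets_star y p : y != 0 -> is_path 0 y p ->
  exists2 e, path_edges 0 p e & e \in star.
Proof.
case: p => [|z p] y0 [/= pp lp]; first by rewrite lp eqxx in y0.
case/andP: pp => az _.
have ee : is_edge [fset (0 : 'rV[int]_d); z]%fset by apply/asboolP; exists 0, z.
exists (exist _ [fset (0 : 'rV[int]_d); z]%fset ee : edge d); first by rewrite path_edges_cons; left.
by apply: in_star => /=; rewrite fset21.
Qed.

End star.

Section lower_bound.
Variables (R : realType) (d : nat).
Local Notation W := (field R (edge d)).
Variables (Q : probability W R) (nu : probability R R).
Hypothesis Qcyl : forall J B, (forall i, measurable (B i)) ->
  Q (cylinder J B) = (\prod_(i <- J) nu (B i))%E.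
Implicit Types (w : edge d -> R) (y : 'rV[int]_d).

Definition zero_star w : edge d -> R := fun e => if e \in star d then 0 else `|w e|.

Lemma zero_star_ge0 w e : 0 <= zero_star w e.
Proof. by rewrite /zero_star; case: ifP. Qed.

(** A path that leaves the origin uses an edge of the star, which costs at least
    [u]. *)
Lemma fpt_ge_star w y (u : R) : y != 0 -> 0 <= u -> (forall e, e \in star d -> u <= `|w e|) ->
  u + fpt setT (zero_star w) 0 y <= fpt setT (fun e => `|w e|) 0 y.
Proof.
move=> y0 u0 wu; apply: fpt_glb; first exact: joinedT.
move=> p pp _; have [e0 pe0 se0] := path_from0_meets_star y0 pp.
have h := @fpt_le R d setT (zero_star w) 0 y p (zero_star_ge0 w) pp (fun e _ => I).
apply: (@le_trans _ _ (u + passage_time (zero_star w) 0 p)); first by rewrite lerD2l.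
have [J [JE _]] := path_edges_card 0 p; rewrite !(passage_time_fset _ JE).
have e0J : e0 \in J by move: pe0; rewrite JE.
rewrite (big_rem e0)//= [in leRHS](big_rem e0)//= {1}/zero_star se0 add0r.
apply: lerD; first exact: wu.
by apply: ler_sum => e _; rewrite /zero_star; case: ifP.
Qed.

Lemma fpt_le_star w y : fpt setT (fun e => `|w e|) 0 y <=
  fpt setT (zero_star w) 0 y + \sum_(e <- star d) `|w e|.
Proof.
rewrite -lerBlDr; apply: fpt_glb; first exact: joinedT.
move=> p pp _; rewrite lerBlDr.
apply: le_trans (@fpt_le R d setT (fun e => `|w e|) 0 y p (fun=> normr_ge0 _) pp (fun e _ => I)) _.
have [J [JE _]] := path_edges_card 0 p; rewrite !(passage_time_fset _ JE).
apply: (@le_trans _ _ (\sum_(e <- J) (zero_star w e + (if e \in star d then `|w e| else 0)))).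
  by apply: ler_sum => e _; rewrite /zero_star; case: ifP; rewrite ?add0r ?addr0.
rewrite big_split lerD2l -big_mkcond -big_filter.
rewrite [leRHS](big_fsetID _ (fun e => e \in J))/=.
rewrite (_ : \sum_(i <- _) _ = \sum_(e <- [fset x | x in star d & x \in J]%fset) `|w e|).
  by rewrite lerDl sumr_ge0.
apply: perm_big; apply: uniq_perm; rewrite ?filter_uniq ?fset_uniq//.
by move=> e; rewrite mem_filter !inE.
Qed.

Lemma measurable_zero_star y :
  measurable_fun setT (fun w : W => fpt setT (zero_star w) 0 y).
Proof.
pose z (w : W) : W := fun e => if e \in star d then 0 else w e.
have mz : measurable_fun setT z.
  apply: measurable_to_field => e; rewrite /z; case: (e \in star d); first exact: measurable_cst.
  exact: measurable_coord.
have mN : measurable_fun setT (fun w : W => fpt setT (fun e => `|w e|) 0 y).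
  by apply: (@measurable_fpt R d (fun t => `|t|)) => //; exact: normr_measurable.
rewrite (_ : (fun w => _) = (fun w : W => fpt setT (fun e => `|w e|) 0 y) \o z).
  exact: measurableT_comp.
apply/funext => w /=; congr (fpt _ _ _ _); apply/funext => e.
by rewrite /zero_star /z; case: ifP; rewrite ?normr0.
Qed.

Definition zeroed_ge y (v : R) : set W := [set w | v <= fpt setT (zero_star w) 0 y].

Lemma measurable_zeroed_ge y v : measurable (zeroed_ge y v).
Proof.
rewrite (_ : zeroed_ge y v = (fun w : W => fpt setT (zero_star w) 0 y) @^-1` `[v, +oo[).
  by rewrite -[X in measurable X]setTI; apply: measurable_zero_star => //; exact: measurable_itv.
by apply/seteqP; split => w; rewrite /zeroed_ge /= in_itv/= andbT.
Qed.

(** Raising the [2 d] edges at the origin is independent of the passage time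
    computed with these edges set to zero. *)
Lemma star_raise y (u v : R) : y != 0 -> 0 <= u ->
  ((\prod_(e <- star d) nu [set s | (u < `|s|)%R]) * Q (zeroed_ge y v) <=
   Q [set w | (u + v <= fpt setT (fun e => `|w e|) 0 y)%R])%E.
Proof.
move=> y0 u0.
have mB : measurable [set s : R | u < `|s|] by exact: measurable_tail_set.
pose D : set W := cylinder (star d) (fun=> [set s | u < `|s|]).
have mD : measurable D by apply: sub_sigma_algebra; exists (star d) => //; exists (fun=> [set s | u < `|s|]).
have mF := measurable_zeroed_ge y v.
rewrite -(Qcyl _ (fun=> mB)) -/D.
have -> : (Q D * Q (zeroed_ge y v) = Q (D `&` zeroed_ge y v))%E.
  rewrite -[X in (Q X * _)%E]setIT -[X in (_ * Q X)%E]setIT -[X in _ = Q X]setIT.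
  rewrite -!integral_indic//; last exact: measurableI.
  rewrite -(@indep_integralM R _ Q nu Qcyl [set` star d])//.
  - by apply: eq_integral => w _; rewrite indicI -EFinM.
  - by apply/measurable_EFinP; exact: measurable_indic.
  - by apply/measurable_EFinP; exact: measurable_indic.
  - move=> w w' ww'; congr (_%:E); rewrite !indicE; congr ((nat_of_bool _)%:R).
    apply/idP/idP => /set_mem H; apply/mem_set => e es; have := H e es.
      by rewrite /= (ww' e).
    by rewrite /= (ww' e).
  - move=> w w' ww'; congr (_%:E); rewrite !indicE; congr ((nat_of_bool _)%:R).
    have E : zero_star w = zero_star w'.
      apply/funext => e; rewrite /zero_star; case: ifPn => // es.
      by rewrite ww'// => /= h; rewrite h in es.
    by rewrite /zeroed_ge; apply/idP/idP => /set_mem /= H; apply/mem_set => /=; rewrite ?E// -E.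
apply: le_measure; rewrite ?inE.
- exact: measurableI.
- rewrite (_ : [set w | _] = (fun w : W => fpt setT (fun e => `|w e|) 0 y) @^-1` `[u + v, +oo[).
    by rewrite -[X in measurable X]setTI; apply: (@measurable_fpt R d (fun t => `|t|)).
  by apply/seteqP; split => w; rewrite /= in_itv/= andbT.
move=> w [/= Dw Fw]; apply: le_trans (fpt_ge_star y0 u0 _); first by rewrite lerD2l.
by move=> e es; apply/ltW; exact: (Dw e es).
Qed.

(** Off the event [zeroed_ge y v] the passage time is at most [v] plus the
    weights at the origin; on the event, a fixed path of length [dist 0 y]
    bounds it by [K] per edge plus the excesses above [K]. When the mean is much
    larger than [v], the event must therefore have a probability bounded away
    from zero. *)
Lemma ET_le_zeroed y (v : R) (K : nat) : 0 <= v ->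
  (\int[nu]_s (excess K s)%:E <= (1 / K%:R)%:E)%E ->
  (ET Q 0 y <= (v + (dist 0 y)%:R * K%:R * fine (Q (zeroed_ge y v)) + (dist 0 y)%:R / K%:R)%:E
     + (2 * d)%:R%:E * moment nu)%E.
Proof.
move=> v0 hK.
have [p [pp _ sp]] := hull_path 0 y; have [J [JE cJ]] := path_edges_card 0 p.
have mF := measurable_zeroed_ge y v.
have Qfin : Q (zeroed_ge y v) = (fine (Q (zeroed_ge y v)))%:E.
  by rewrite fineK// fin_num_measure.
pose N : R := (dist 0 y)%:R.
have JN : #|` J|%:R <= N by rewrite ler_nat -sp.
have N0 : 0 <= N by [].
have NK0 : 0 <= N * K%:R by rewrite mulr_ge0.
have ptw w : fpt setT (fun e => `|w e|) 0 y <=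
    v + N * K%:R * \1_(zeroed_ge y v) w + \sum_(e <- J) excess K (w e)
    + \sum_(e <- star d) `|w e|.
  have S0 : 0 <= \sum_(e <- star d) `|w e| by rewrite sumr_ge0.
  have X0 : 0 <= \sum_(e <- J) excess K (w e) by apply: sumr_ge0 => e _; exact: excess_ge0.
  rewrite indicE; have [_|/negP Fv] := boolP (w \in zeroed_ge y v).
    have h1 : fpt setT (fun e => `|w e|) 0 y <= \sum_(e <- J) `|w e|.
      by rewrite -(passage_time_fset _ JE); exact: fpt_le.
    have h2 : \sum_(e <- J) `|w e| <= N * K%:R + \sum_(e <- J) excess K (w e).
      apply: (@le_trans _ _ (\sum_(e <- J) (K%:R + excess K (w e)))).
        apply: ler_sum => e _; apply: le_trans (norm_le_excess K _) _.
        by rewrite lerD2r ge_min lexx orbT.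
      rewrite big_split/= lerD2r big_const_seq count_predT iter_addr_0 -[leLHS]mulr_natl.
      exact: ler_wpM2r.
    apply: le_trans h1 _; apply: le_trans h2 _.
    rewrite /= mulr1.
    by move: (\sum_(e <- star d) _) (\sum_(e <- J) _) (N * _) S0 X0 => a b' g a0 b0; lra.
  have h1 := fpt_le_star w y.
  have h2 : fpt setT (zero_star w) 0 y <= v.
    by rewrite leNgt; apply/negP => lt; apply: Fv; apply/mem_set; exact: ltW.
  apply: le_trans h1 _; rewrite mulr0 addr0 lerD2r.
  by apply: le_trans h2 _; rewrite lerDl.
have mexc : measurable_fun setT (fun w : W => \sum_(e <- J) excess K (w e)).
  by apply: (measurable_sum_weight J); exact: measurable_excess.
have mstar : measurable_fun setT (fun w : W => \sum_(e <- star d) `|w e|).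
  by apply: (measurable_sum_weight (star d)); exact: normr_measurable.
have mind : measurable_fun setT (fun w : W => N * K%:R * \1_(zeroed_ge y v) w).
  by apply: measurable_funM; [exact: measurable_cst|exact: measurable_indic].
apply: (@le_trans _ _ (\int[Q]_w (v%:E + (N * K%:R * \1_(zeroed_ge y v) w)%:E
   + (\sum_(e <- J) excess K (w e))%:E + (\sum_(e <- star d) `|w e|)%:E))%E).
  rewrite ETE; apply: ge0_le_integral => //.
  - by move=> w _; rewrite lee_fin fpt_ge0.
  - exact: measurable_T.
  - apply: emeasurable_funD; last exact/measurable_EFinP.
    apply: emeasurable_funD; last exact/measurable_EFinP.
    by apply: emeasurable_funD; [exact: measurable_cst|exact/measurable_EFinP].
  by move=> w _; rewrite -!EFinD lee_fin; exact: ptw.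
have i0 w : (0 <= (N * K%:R * \1_(zeroed_ge y v) w)%:E)%E.
  by rewrite lee_fin mulr_ge0.
have e0 w : (0 <= (\sum_(e <- J) excess K (w e))%:E)%E.
  by rewrite lee_fin; apply: sumr_ge0 => e _; exact: excess_ge0.
have s0 w : (0 <= (\sum_(e <- star d) `|w e|)%:E)%E by rewrite lee_fin sumr_ge0.
have v0' : (0 <= v%:E)%E by rewrite lee_fin.
have mv : measurable_fun [set: W] (fun=> v%:E) by exact: measurable_cst.
rewrite ge0_integralD//; last 3 first.
- by move=> w _; rewrite !adde_ge0.
- apply: emeasurable_funD; last exact/measurable_EFinP.
  by apply: emeasurable_funD => //; exact/measurable_EFinP.
- exact/measurable_EFinP.
rewrite ge0_integralD//; last 3 first.
- by move=> w _; rewrite !adde_ge0.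
- by apply: emeasurable_funD => //; exact/measurable_EFinP.
- exact/measurable_EFinP.
rewrite ge0_integralD//; last first.
  exact/measurable_EFinP.
rewrite integral_cst_probability (integral_sum_weight Qcyl) 2!EFinD.
apply: leeD; last first.
  by apply: lee_wpmul2r; [exact: moment_ge0|rewrite lee_fin ler_nat card_star].
apply: leeD; first apply: leeD => //.
  under eq_integral do rewrite EFinM.
  rewrite ge0_integralZl//; last first.
    by apply/measurable_EFinP; exact: measurable_indic.
  have -> : (\int[Q]_w (\1_(zeroed_ge y v) w)%:E = (fine (Q (zeroed_ge y v)))%:E)%E.
    by rewrite integral_indic// setIT; exact: Qfin.
  by rewrite -EFinM.
under eq_integral do rewrite -sumEFin.
rewrite ge0_integral_sum//; last 2 first.
- move=> e; apply/measurable_EFinP; apply: measurableT_comp; first exact: measurable_excess.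
  exact: measurable_coord.
- by move=> e w _; rewrite lee_fin excess_ge0.
apply: (@le_trans _ _ (\sum_(e <- J) (1 / K%:R)%:E)%E).
  apply: lee_sum => e _; rewrite (@integral_coord R d Q nu Qcyl (fun s => (excess K s)%:E))//.
  - by apply/measurable_EFinP; exact: measurable_excess.
  - by move=> s; rewrite lee_fin excess_ge0.
rewrite sumEFin lee_fin big_const_seq count_predT iter_addr_0 -[leLHS]mulr_natl mulrA mulr1.
by apply: ler_wpM2r; rewrite ?invr_ge0.
Qed.

End lower_bound.

(** * Disjoint regions for the routes *)

(** The routes progress along the axis [a] in the direction of the sign [sg], the
    height being the coordinate in this direction, and are separated along a
    second axis [b]. *)

Section fans.
Variables (d : nat) (a b : 'I_d) (sg : int) (A S : int).
Implicit Types (q : 'I_d * bool) (g p y : 'rV[int]_d).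

Definition axis_height p : int := sg * p 0 a.

(** The lane of the forward unit vector is the middle one. In the plane of the
    axes [a] and [b] the fans have to be nested: the fan of the backward vector
    passes under that of [+ e_b] and climbs outside of it, hence the index [2].
    Any distinct indices do for the other vectors. *)
Definition lane_index q : int :=
  if q.1 == a then (if q.2 == (0 < sg) then 0 else 2)
  else if q.1 == b then (if q.2 then 1 else -1)
  else 3 + (enum_rank q)%:Z.

Definition lane_offset q : int := S * lane_index q.

Definition between (s t u : int) : bool := (s <= u <= t) || (t <= u <= s).

(** A crossbar at the height of the unit vector, which leads from this vector to
    the coordinate of the lane, followed by a climb of length [A]. *)
Definition fan q g : Prop :=
  (forall c, c != a -> c != b -> g 0 c = signed_unit q 0 c) /\
  ((axis_height g = axis_height (signed_unit q) /\
    between (signed_unit q 0 b) (signed_unit q 0 b + lane_offset q) (g 0 b)) \/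
   (g 0 b = signed_unit q 0 b + lane_offset q /\
    axis_height (signed_unit q) <= axis_height g <= axis_height (signed_unit q) + A)).

Lemma signed_unitE q c :
  signed_unit q 0 c = if c == q.1 then (if q.2 then 1 else -1) else 0.
Proof. by rewrite !mxE eqxx /=; case: eqP => _; rewrite ?mulr1 ?mulr0. Qed.

Lemma lane_index_inj : injective lane_index.
Proof.
move=> q q'; rewrite /lane_index.
case: (q.1 =P a) => [qa|_].
  case: (q'.1 =P a) => [q'a|_]; last by case: ifP => _; case: ifP => _; case: (q'.2); lia.
  case: eqP => [q2|q2]; case: eqP => [q2'|q2'] // _; move: qa q'a q2 q2'.
    by case: q => ? ?; case: q' => ? ? /= -> -> -> ->.
  case: q => ? s; case: q' => ? s' /= -> ->.
  by case: s; case: s' => //; case: (0 < sg).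
case: (q.1 =P b) => [qb|_].
  case: (q'.1 =P a) => [q'a|_]; first by case: (q.2); case: ifP; lia.
  case: (q'.1 =P b) => [q'b|_]; last by case: (q.2); lia.
  move: qb q'b; case: q => ? s; case: q' => ? s' /= -> ->.
  by case: s; case: s'.
case: (q'.1 =P a) => [q'a|_]; first by case: ifP; lia.
case: (q'.1 =P b) => [q'b|_]; first by case: (q'.2); lia.
by move=> /addrI[h]; apply: enum_rank_inj; exact: val_inj.
Qed.

(** Reversing the direction [a] turns a fan leaving the origin into a fan
    arriving at it. *)
Definition flip g : 'rV[int]_d := \row_c (if c == a then - g 0 c else g 0 c).

Lemma flipE g c : flip g 0 c = if c == a then - g 0 c else g 0 c.
Proof. by rewrite mxE. Qed.

Lemma height_flip g : axis_height (flip g) = - axis_height g.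
Proof. by rewrite /axis_height flipE eqxx mulrN. Qed.

Lemma flipK : involutive flip.
Proof. by move=> g; apply/rowP => c; rewrite !flipE; case: eqP; rewrite ?opprK. Qed.

Hypothesis sg1 : sg = 1 \/ sg = -1.

Lemma height_unit q : -1 <= axis_height (signed_unit q) <= 1.
Proof. by rewrite /axis_height signed_unitE; case: ifP; case: q.2; case: sg1 => ->; lia. Qed.

Hypothesis A0 : 0 <= A.

Lemma fan_height q g : fan q g -> -1 <= axis_height g <= 1 + A.
Proof. by have := height_unit q; move=> + [_ [[-> _]|[_ +]]]; lia. Qed.

Lemma fan_adjacent_lane q g : fan q g -> 1 < axis_height g \/ axis_height g < -1 ->
  g 0 b = signed_unit q 0 b + lane_offset q /\ axis_height (signed_unit q) <= axis_height g <= axis_height (signed_unit q) + A.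
Proof. by move=> [_ [[hE _]|//]]; have := height_unit q; rewrite -hE; lia. Qed.

Hypotheses (ab : a != b) (S1 : 1 < S).

(** A fan is confined to the plane through [signed_unit q] spanned by the
    directions [a] and [b]; distinct fans can share a plane only when both start
    in that plane, and there the lanes are nested so that they do not cross. *)
Lemma fan_disjoint q q' g : fan q g -> fan q' g -> q = q'.
Proof.
case: q => c s; case: q' => c' s' [off1 H1] [off2 H2].
have [ca|ca] := eqVneq c a; last first.
  have [cb|cb] := eqVneq c b; last first.
    have := off1 _ ca cb; rewrite (off2 _ ca cb) !signed_unitE eqxx /=.
    case: eqP => [<-|_]; last by case: (s).
    by case: (s); case: (s').
  have [c'a|c'a] := eqVneq c' a; last first.
    have [c'b|c'b] := eqVneq c' b; last first.
      have := off2 _ c'a c'b; rewrite (off1 _ c'a c'b) !signed_unitE eqxx /=.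
      by case: eqP => [h|_]; [rewrite h cb eqxx in c'b|case: (s')].
    subst c c'; move: H1 H2.
    rewrite /between /axis_height /lane_offset /lane_index !signed_unitE /= !eqxx (negbTE ab) eq_sym (negbTE ab).
    by case: s {off1}; case: s' {off2} => //; move: (g 0 a) (g 0 b) => ha hb; lia.
  subst c c'; move: H1 H2.
  rewrite /between /axis_height /lane_offset /lane_index !signed_unitE /= !eqxx (negbTE ab) eq_sym (negbTE ab).
  by case: sg1 => ->; case: s {off1}; case: s' {off2} => /=; move: (g 0 a) (g 0 b) => ha hb; lia.
have [c'a|c'a] := eqVneq c' a; last first.
  have [c'b|c'b] := eqVneq c' b; last first.
    have := off2 _ c'a c'b; rewrite (off1 _ c'a c'b) !signed_unitE eqxx /=.
    by case: eqP => [h|_]; [rewrite h ca eqxx in c'a|case: (s')].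
  subst c c'; move: H1 H2.
  rewrite /between /axis_height /lane_offset /lane_index !signed_unitE /= !eqxx (negbTE ab) eq_sym (negbTE ab).
  by case: sg1 => ->; case: s {off1}; case: s' {off2} => /=; move: (g 0 a) (g 0 b) => ha hb; lia.
subst c c'; move: H1 H2.
rewrite /between /axis_height /lane_offset /lane_index !signed_unitE /= !eqxx eq_sym (negbTE ab).
by case: sg1 => ->; case: s {off1}; case: s' {off2} => //=; move: (g 0 a) (g 0 b) => ha hb; lia.
Qed.

End fans.

Section coordinates.
Variables (R : realType) (d : nat) (a : 'I_d) (sg : int).
Implicit Types (q : 'I_d * bool) (p : 'rV[int]_d).

Lemma unit_abs q c : `|(signed_unit q 0 c)%:~R : R| <= 1.
Proof.
rewrite signed_unitE; case: ifP => _; last by rewrite normr0 ler01.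
by case: q.2; rewrite ?intrN ?normrN normr1.
Qed.

Hypothesis sg1 : sg = 1 \/ sg = -1.

Lemma height_int p : `|(p 0 a)%:~R : R| = `|(axis_height a sg p)%:~R|.
Proof. by rewrite /axis_height; case: sg1 => ->; rewrite ?mul1r// mulN1r intrN normrN. Qed.

Lemma height_abs p (m : int) : - m <= axis_height a sg p <= m -> `|(p 0 a)%:~R : R| <= m%:~R.
Proof. by move=> h; rewrite height_int -intr_norm ler_int; lia. Qed.

End coordinates.

Section regions.
Variables (R : realType) (d : nat) (x : 'rV[R]_d) (a b : 'I_d) (sg : int) (A S : int).
Variables (rho : R) (n : R) (y : 'rV[int]_d).
Hypotheses (ab : a != b) (sg1 : sg = 1 \/ sg = -1) (A0 : 0 <= A).
Hypotheses (xa : x 0 a != 0) (xba : `|x 0 b| <= `|x 0 a|).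
Hypotheses (rhoA : A%:~R + 2 <= rho) (Srho : 4 * rho < S%:~R).
Hypothesis yE : forall c, `|(y 0 c)%:~R - n * x 0 c| <= 1.
Hypothesis hy : 2 * A + 10 <= axis_height a sg y.
Implicit Types (q : 'I_d * bool) (p : 'rV[int]_d).
Local Notation offset := (lane_offset a b sg S).
Local Notation fan := (fan a b sg A S).
Local Notation height := (axis_height a sg).

(** A tube around the ray through [x], translated by the offset along [b]. The
    coordinates [a] and [b] suffice to separate the lanes. *)
Definition lane q p : Prop := exists t : R,
  `|(p 0 a)%:~R - t * x 0 a| <= rho /\ `|(p 0 b)%:~R - (offset q)%:~R - t * x 0 b| <= rho.

(** The coordinate [a] determines the parameter [t] up to [2 * rho / |x a|]; as
    [|x b| <= |x a|], the offsets of two lanes through the same point differ by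
    at most [4 * rho < S]. *)
Lemma lane_disjoint q q' p : lane q p -> lane q' p -> q = q'.
Proof.
move=> [t [ta tb]] [t' [ta' tb']]; apply: (@lane_index_inj _ a b sg).
have h1 : `|(t - t') * x 0 a| <= 2 * rho.
  rewrite (_ : _ * _ = ((p 0 a)%:~R - t' * x 0 a) - ((p 0 a)%:~R - t * x 0 a)); last by ring.
  by apply: le_trans (ler_normB _ _) _; lra.
have h2 : `|(t - t') * x 0 b| <= 2 * rho.
  by apply: le_trans h1; rewrite !normrM ler_wpM2l.
have h3 : `|(offset q - offset q')%:~R : R| <= 4 * rho.
  rewrite intrB (_ : _ - _ = ((p 0 b)%:~R - (offset q')%:~R - t' * x 0 b)
    - ((p 0 b)%:~R - (offset q)%:~R - t * x 0 b) - (t - t') * x 0 b); last by ring.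
  apply: le_trans (ler_normB _ _) _; apply: le_trans (lerD (ler_normB _ _) (lexx _)) _.
  by lra.
have : `|offset q - offset q'| < S.
  by rewrite -(ltr_int R) intr_norm; exact: le_lt_trans Srho.
rewrite /lane_offset -mulrBr normrM => h.
have S0 : 0 < S by apply: le_lt_trans h; rewrite mulr_ge0.
move: h; rewrite (gtr0_norm S0) -[X in _ < X]mulr1 ltr_pM2l//.
by move: (lane_index _ _ _ q) (lane_index _ _ _ q') => k k'; lia.
Qed.

Lemma fan_lane q p : fan q p -> 1 < height p -> lane q p.
Proof.
move=> fp hp; exists 0; rewrite !mul0r !subr0.
have [] := fan_adjacent_lane sg1 A0 fp (or_introl hp) => pb ph.
have := height_unit a sg1 q => hu.
have A0R : 0 <= A%:~R :> R by rewrite ler0z.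
have rho1 : 1 <= rho by move: (A%:~R : R) A0R rhoA => AR; lra.
split; last by rewrite pb intrD addrK; apply: le_trans (unit_abs R q b) _.
have : `|(p 0 a)%:~R : R| <= (A + 1)%:~R by apply: (height_abs _ sg1); lia.
by rewrite intrD; move: (A%:~R : R) rhoA => AR; lra.
Qed.

Lemma fan_flip_lane q p : fan q (flip a (p - y)) -> 1 < height (flip a (p - y)) -> lane q p.
Proof.
move=> fp hp; exists n.
have [] := fan_adjacent_lane sg1 A0 fp (or_introl hp) => pb ph.
have := height_unit a sg1 q => hu.
have ya := yE a; have yb := yE b.
have ma : (p 0 a)%:~R - n * x 0 a = ((p - y) 0 a)%:~R + ((y 0 a)%:~R - n * x 0 a).
  by rewrite !mxE intrD intrN; ring.
have A0R : 0 <= A%:~R :> R by rewrite ler0z.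
split.
  rewrite ma; apply: le_trans (ler_normD _ _) _.
  have : `|((p - y) 0 a)%:~R : R| <= (A + 1)%:~R.
    apply: (height_abs _ sg1); move: ph hu; rewrite height_flip; lia.
  by rewrite intrD; move: (A%:~R : R) rhoA => AR; lra.
move: pb; rewrite flipE eq_sym (negbTE ab) => pb.
have pyb : (p - y) 0 b = p 0 b - y 0 b by rewrite !mxE.
rewrite (_ : _ - _ = (signed_unit q 0 b)%:~R + ((y 0 b)%:~R - n * x 0 b)); last first.
  rewrite (_ : p 0 b = y 0 b + (signed_unit q 0 b + offset q)); last by rewrite -pb pyb addrC subrK.
  by rewrite !intrD; ring.
apply: le_trans (ler_normD _ _) _; have := unit_abs R q b.
by move: (A%:~R : R) A0R rhoA => AR; lra.
Qed.

(** The fan at the origin, the lane, and the reflected fan at the target [y].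
    The bounds on the height keep the lanes above the crossbars at the origin
    and below those at [y]. *)
Definition region q p : Prop :=
  [\/ fan q p, lane q p /\ 2 <= height p <= height y - 2 | fan q (flip a (p - y))].

Lemma S_gt1 : 1 < S.
Proof.
by rewrite -(ltr_int R); apply: le_lt_trans Srho; have : 0 <= A%:~R :> R; [by rewrite ler0z|move: (A%:~R : R) rhoA => AR; lra].
Qed.

(** Above height [1] a fan lies in the lane of its unit vector, so that a fan
    and a lane can meet only if they belong together; the fans at the two ends
    are at different heights. *)
Lemma region_disjoint q q' p : region q p -> region q' p -> q = q'.
Proof.
have hpy : height (flip a (p - y)) = height y - height p.
  by rewrite height_flip /axis_height !mxE mulrBr opprB.
have key q1 q2 : region q1 p -> fan q2 p -> q1 = q2.
  move=> [f1|[l1 h1]|f1] f2.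
  - exact: (fan_disjoint sg1 A0 ab S_gt1 f1 f2).
  - by apply: (lane_disjoint l1); apply: fan_lane => //; lia.
  - have := fan_height sg1 A0 f1; have := fan_height sg1 A0 f2; rewrite hpy; lia.
have key' q1 q2 : region q1 p -> fan q2 (flip a (p - y)) -> q1 = q2.
  move=> [f1|[l1 h1]|f1] f2.
  - have := fan_height sg1 A0 f1; have := fan_height sg1 A0 f2; rewrite hpy; lia.
  - by apply: (lane_disjoint l1); apply: fan_flip_lane => //; rewrite hpy; lia.
  - exact: (fan_disjoint sg1 A0 ab S_gt1 f1 f2).
move=> r1 [f2|[l2 h2]|f2]; [exact: key|case: r1 => [f1|[l1 h1]|f1]|exact: key'].
- by apply/esym; apply: (key q' q) => //; apply: Or32; split.
- exact: lane_disjoint l1 l2.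
- by apply/esym; apply: (key' q' q) => //; apply: Or32; split.
Qed.

(** An edge meets at most one region, since it cannot join the two endpoints. *)
Lemma region_edge_disjoint q q' (e : edge d) :
  (forall v : 'rV[int]_d, v \in val e -> [\/ region q v, v = 0 | v = y]) ->
  (forall v : 'rV[int]_d, v \in val e -> [\/ region q' v, v = 0 | v = y]) -> q = q'.
Proof.
move=> h h'.
have [u [ue u0 uy]] : exists u : 'rV[int]_d, [/\ u \in val e, u != 0 & u != y].
  case: e {h h'} => e ee /=; have /asboolP[u [v [uv eE]]] := ee; rewrite eE.
  have au : `|u 0 a - v 0 a| <= 1.
    by rewrite -(eqP uv) (bigD1 a)//= lerDl sumr_ge0.
  have uv' : u != v.
    by apply: contraTneq uv => ->; rewrite /Defs.adjacent big1// => i _; rewrite subrr normr0.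
  have ya : 1 < `|y 0 a|.
    by move: hy; rewrite /axis_height; case: sg1 => ->; lia.
  have [u0|u0] := eqVneq u 0.
    exists v; rewrite fset22; split=> //; first by rewrite -u0 eq_sym.
    apply/eqP => vy; move: au; rewrite u0 vy mxE sub0r normrN => au.
    by have := lt_le_trans ya au; rewrite ltxx.
  have [uy|uy] := eqVneq u y; last by exists u; rewrite fset21.
  exists v; rewrite fset22; split=> //; last by rewrite -uy eq_sym.
  apply/eqP => v0; move: au; rewrite uy v0 mxE subr0 => au.
  by have := lt_le_trans ya au; rewrite ltxx.
case: (h _ ue) => [r1|E|E]; [|by rewrite E eqxx in u0|by rewrite E eqxx in uy].
case: (h' _ ue) => [r2|E|E]; [|by rewrite E eqxx in u0|by rewrite E eqxx in uy].
exact: region_disjoint r1 r2.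
Qed.

End regions.

(** * Boxes and segments as sets of edges *)

Section hull_edges.
Variables (R : realType) (d : nat).
Implicit Types (x y z v g : 'rV[int]_d) (w : edge d -> R) (J : {fset edge d}).

Lemma hull_connect x y : exists J : {fset edge d},
  [/\ exists p, is_path x y p /\ path_edges x p = [set` J], (#|` J| <= dist x y)%N &
      forall e v, e \in J -> v \in val e -> in_hull x y v].
Proof.
have [p [pp ph sp]] := hull_path x y; have [J [JE cJ]] := path_edges_card x p.
exists J; split; [by exists p|by rewrite -sp|].
move=> e v eJ ve; apply: ph; apply: (path_edges_vertices _ ve).
by rewrite JE.
Qed.

(** The edges of one monotone path, chosen once and for all. *)
Definition hull_edges x y : {fset edge d} := projT1 (cid (hull_connect x y)).

Lemma card_hull_edges x y : (#|` hull_edges x y| <= dist x y)%N.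
Proof. by rewrite /hull_edges; case: cid => J []. Qed.

Lemma hull_edges_in x y e v : e \in hull_edges x y -> v \in val e -> in_hull x y v.
Proof. by rewrite /hull_edges; case: cid => J [_ _] /= h; exact: h. Qed.

Lemma hull_edges_joined (E : set (edge d)) x y : [set` hull_edges x y] `<=` E -> joined E x y.
Proof.
rewrite /hull_edges; case: cid => J [[p [pp pE]] _ _] /= JE.
by exists p; split=> //; rewrite pE.
Qed.

Lemma hull_edges_fpt (E : set (edge d)) w (M : R) x y : 0 <= M -> (forall e, 0 <= w e <= M) ->
  [set` hull_edges x y] `<=` E -> fpt E w x y <= M * (dist x y)%:R.
Proof.
move=> M0 wM; have w0 e : 0 <= w e by case/andP: (wM e).
have := card_hull_edges x y.
rewrite /hull_edges; case: cid => J [[p [pp pE]] _ _] /= cJ JE.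
apply: le_trans (fpt_le w0 pp _) _; first by rewrite pE.
rewrite (passage_time_fset _ pE).
apply: (@le_trans _ _ (\sum_(e <- J) M)); first by apply: ler_sum => e _; case/andP: (wM e).
by rewrite big_const_seq count_predT iter_addr_0 -[leLHS]mulr_natr ler_wpM2l ?ler_nat.
Qed.

End hull_edges.

Section boxes.
Variables (R : realType) (d : nat).
Implicit Types (x y z v c g : 'rV[int]_d) (w : edge d -> R) (K : nat).

Definition cube_point K (f : {ffun 'I_d -> 'I_(2 * K).+1}) : lattice d :=
  \row_i ((nat_of_ord (f i))%:Z - K%:Z).

Definition cube K : {fset lattice d} :=
  [fset cube_point f | f : {ffun 'I_d -> 'I_(2 * K).+1}]%fset.

Lemma in_cube K v : (forall i, `|v 0 i| <= K%:Z) -> v \in cube K.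
Proof.
move=> vK; apply/imfsetP; exists [ffun i : 'I_d => inord (absz (v 0 i + K%:Z))] => //.
apply/rowP => i; rewrite mxE ffunE; have := vK i.
move: (v 0 i) => t tK; rewrite inordK; lia.
Qed.

(** Finiteness comes from selecting the edges among the subsets of the cube. *)
Definition box_edges K : {fset edge d} :=
  [fset e in [seq e <- pmap insub (fpowerset (cube K)) |
    [forall i : 'I_d, all (fun v : lattice d => `|v 0 i| <= K%:Z) (val (e : edge d))]]]%fset.

Lemma box_edgesP K (e : edge d) : reflect
  (forall v i, v \in val e -> `|v 0 i| <= K%:Z) (e \in box_edges K).
Proof.
apply: (iffP idP).
  rewrite !inE /= mem_filter => /andP[/forallP h _] v i ve.
  by have /allP := h i; apply.
move=> h; rewrite !inE /= mem_filter; apply/andP; split.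
  by apply/forallP => i; apply/allP => v ve; exact: h.
rewrite mem_pmap_sub fpowersetE; apply/fsubsetP => v ve.
by apply: in_cube => i; exact: h.
Qed.

Definition box_at K c : {fset edge d} := [fset shift_edge c e | e in box_edges K]%fset.

Lemma card_box_at K c : (#|` box_at K c| <= #|` box_edges K|)%N.
Proof. exact: leq_imfset_card. Qed.

Lemma box_atE K c : [set` box_at K c] = shift_edge c @` [set` box_edges K].
Proof.
apply/seteqP; split => e /=; first by move=> /imfsetP[e' /= h ->]; exists e'.
by move=> [e' h <-]; apply/imfsetP; exists e'.
Qed.

Lemma box_atP K c (e : edge d) : reflect
  (forall v i, v \in val e -> `|v 0 i - c 0 i| <= K%:Z) (e \in box_at K c).
Proof.
apply: (iffP idP) => [/imfsetP[e' /= /box_edgesP h ->] v i|h].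
  move=> /imfsetP[u /= ue ->]; rewrite mxE addrK; exact: h.
apply/imfsetP; exists (shift_edge (- c) e); last by rewrite shift_edgeNK.
apply/box_edgesP => v i /imfsetP[u /= ue ->]; rewrite !mxE; exact: h.
Qed.

Lemma box_at_joined K c y : (forall i, `|y 0 i - c 0 i| <= K%:Z) ->
  [set` hull_edges c y] `<=` [set` box_at K c].
Proof.
move=> yc e /= eh; apply/box_atP => v i ve.
have := hull_edges_in eh ve i; have := yc i.
by move: (v 0 i) (y 0 i) (c 0 i) => s t u; lia.
Qed.

End boxes.

(** * Routes *)

Section reflection.
Variables (d : nat) (a : 'I_d).
Implicit Types (g v y : 'rV[int]_d).

Lemma flip0 : flip a 0 = 0.
Proof. by apply/rowP => c; rewrite flipE !mxE oppr0; case: eqP. Qed.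

Lemma in_hull_flip y g g' v : in_hull (y + flip a g) (y + flip a g') v ->
  in_hull g' g (flip a (v - y)).
Proof.
move=> h c; have := h c; rewrite !mxE.
by case: eqP => _; move: (v 0 c) (y 0 c) (g 0 c) (g' 0 c) => t u s s'; lia.
Qed.

Lemma dist_flip y g g' : dist (y + flip a g) (y + flip a g') = dist g g'.
Proof.
rewrite /dist; apply: eq_bigr => c _; rewrite !mxE.
by case: eqP => _; move: (y 0 c) (g 0 c) (g' 0 c) => t u s; lia.
Qed.

Lemma distC y g : dist y g = dist g y.
Proof.
rewrite /dist; apply: eq_bigr => c _.
by move: (y 0 c) (g 0 c) => t u; lia.
Qed.

End reflection.

Section fan_hulls.
Variables (d : nat) (a b : 'I_d) (sg : int) (A S : int).
Hypotheses (ab : a != b) (sg1 : sg = 1 \/ sg = -1) (A0 : 0 <= A).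
Implicit Types (q : 'I_d * bool) (g v y : 'rV[int]_d).
Local Notation offset := (lane_offset a b sg S).
Local Notation fan := (fan a b sg A S).
Local Notation height := (axis_height a sg).

Definition lane_foot q : 'rV[int]_d := signed_unit q + offset q *: delta_mx 0 b.
Definition lane_start q : 'rV[int]_d := lane_foot q + (sg * A) *: delta_mx 0 a.

Lemma lane_footE q c :
  lane_foot q 0 c = if c == b then signed_unit q 0 b + offset q else signed_unit q 0 c.
Proof.
rewrite /lane_foot [LHS]mxE [X in _ + X]mxE [X in _ * X]mxE eqxx /=.
by case: eqP => [->|_]; rewrite ?mulr1 ?mulr0 ?addr0.
Qed.

Lemma lane_startE q c :
  lane_start q 0 c = if c == a then signed_unit q 0 a + sg * A else lane_foot q 0 c.
Proof.
rewrite /lane_start [LHS]mxE [X in _ + X]mxE [X in _ * X]mxE eqxx /=.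
case: eqP => [->|_]; rewrite ?mulr1 ?mulr0 ?addr0// lane_footE.
by rewrite (negbTE ab).
Qed.

Lemma hull_unit_fan q v : in_hull 0 (signed_unit q) v -> fan q v \/ v = 0.
Proof.
move=> h; have hc c : c != q.1 -> v 0 c = 0.
  by move=> cq; have := h c; rewrite signed_unitE (negbTE cq) mxE; move: (v 0 c) => t; lia.
have := h q.1; rewrite signed_unitE eqxx mxE => hq.
have [v0|v0] := eqVneq (v 0 q.1) 0.
  right; apply/rowP => c; rewrite mxE; have [->//|] := eqVneq c q.1; exact: hc.
left; have -> : v = signed_unit q.
  apply/rowP => c; rewrite signed_unitE; have [->|cq] := eqVneq c q.1; last exact: hc.
  by move: v0 hq; move: (v 0 q.1) => t; case: q.2; lia.
split=> //; left; split=> //; rewrite /between.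
by move: (signed_unit q 0 b) (offset q) => t o; lia.
Qed.

Lemma hull_crossbar_fan q v : in_hull (signed_unit q) (lane_foot q) v -> fan q v.
Proof.
move=> h; have hc c : c != b -> v 0 c = signed_unit q 0 c.
  move=> cb; have := h c; rewrite lane_footE (negbTE cb).
  by move: (v 0 c) (signed_unit q 0 c) => t u; lia.
split; first by move=> c ca cb; exact: hc.
left; split; first by rewrite /axis_height hc.
by have := h b; rewrite lane_footE eqxx.
Qed.

Lemma hull_lane_fan q v : in_hull (lane_foot q) (lane_start q) v -> fan q v.
Proof.
move=> h; have hc c : c != a -> v 0 c = lane_foot q 0 c.
  move=> ca; have := h c; rewrite lane_startE (negbTE ca).
  by move: (v 0 c) (lane_foot q 0 c) => t u; lia.
split; first by move=> c ca cb; rewrite hc// lane_footE (negbTE cb).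
right; split; first by rewrite hc 1?eq_sym// lane_footE eqxx.
have := h a; rewrite lane_startE eqxx lane_footE (negbTE ab) /axis_height.
by move: (v 0 a) (signed_unit q 0 a) => t u; case: sg1 => ->; lia.
Qed.

Lemma height_lane_start q : A - 1 <= height (lane_start q) <= A + 1.
Proof.
have := height_unit a sg1 q; rewrite /axis_height lane_startE eqxx mulrDr.
by case: sg1 => ->; move: (signed_unit q 0 a) => u; lia.
Qed.

End fan_hulls.

Section routes.
(** A lane is traversed through boxes of radius [K] around the milestones [0],
    ..., [k - 1]. The last milestone stays below the target [y]: in units of
    height the gap is at least [A + K + 5], which leaves room for the fan at
    [y], and at most [D], so that the gap has bounded length. *)
Variables (R : realType) (d : nat) (x : 'rV[R]_d) (a b : 'I_d) (sg : int) (A S : int).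
Variables (K k : nat) (L n D rho : R).
Hypotheses (ab : a != b) (sg1 : sg = 1 \/ sg = -1) (sgx : sg%:~R * x 0 a = `|x 0 a|).
Hypotheses (xa : x 0 a != 0) (xmax : forall c, `|x 0 c| <= `|x 0 a|).
Hypotheses (L0 : 0 <= L) (AK : K%:Z + 4 <= A).
Hypothesis kD : (n - k%:R * L) * `|x 0 a| <= D.
Hypothesis kn : A%:~R + K%:R + 5 <= (n - k%:R * L) * `|x 0 a|.
Hypotheses (rhoE : K%:R + A%:~R + D + 3 <= rho) (Srho : 4 * rho < S%:~R).
Implicit Types (q : 'I_d * bool) (v g : 'rV[int]_d) (w : edge d -> R).

Definition ray_point (t : R) : 'rV[int]_d := floor_point (t *: x).
Definition milestone (j : nat) : 'rV[int]_d := ray_point (j%:R * L).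
Local Notation y := (ray_point n).
Local Notation offset := (lane_offset a b sg S).
Local Notation fan := (fan a b sg A S).
Local Notation height := (axis_height a sg).
Local Notation foot := (lane_foot a b sg S).
Local Notation start := (lane_start a b sg A S).
Local Notation region := (region x a b sg A S rho y).
Local Notation lane := (lane x a b sg S rho).

Hypothesis hy : 2 * A + 10 <= height y.
Hypothesis vstep : forall j c, `|milestone j.+1 0 c - milestone j 0 c| <= K%:Z.

Lemma ray_pointE t c : `|(ray_point t 0 c)%:~R - t * x 0 c| <= 1.
Proof.
rewrite !mxE; have /andP[h1 h2] := real_floor_itv (num_real (t * x 0 c)).
by move: h2; rewrite intrD => h2; apply/ler_normlP; split; lra.
Qed.

Lemma height_ray t : `|(height (ray_point t))%:~R - t * `|x 0 a| | <= 1.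
Proof.
rewrite -sgx mulrCA /axis_height intrM -mulrBr normrM.
rewrite (_ : `|sg%:~R| = 1 :> R) ?mul1r; first exact: ray_pointE.
by case: sg1 => ->; rewrite ?intrN ?normrN normr1.
Qed.

Lemma start_b q : start q 0 b = signed_unit q 0 b + offset q.
Proof. by rewrite lane_startE// eq_sym (negbTE ab) lane_footE eqxx. Qed.

Lemma A_ge0 : 0 <= A. Proof. by move: AK; clear; lia. Qed.

(** A box at a milestone stays within the lane since [rho] exceeds its radius,
    the climb and the rounding errors; the lower bound on the gap keeps it below
    the fan at [y]. *)
Lemma box_lane q j v : (j <= k)%N ->
  (forall c, `|v 0 c - (start q + milestone j) 0 c| <= K%:Z) ->
  lane q v /\ 2 <= height v <= height y - 2.
Proof.
move=> jk vK.
have A0 := A_ge0.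
have hz := height_lane_start S ab sg1 A0 q.
have hm := height_ray (j%:R * L); rewrite -/(milestone j) in hm.
have hE : height v = (height v - height (start q + milestone j)) + height (start q) + height (milestone j).
  rewrite (_ : height (start q + milestone j) = height (start q) + height (milestone j)); last first.
    by rewrite /axis_height mxE mulrDr.
  by ring.
have hv : `|height v - height (start q + milestone j)| <= K%:Z.
  rewrite /axis_height -mulrBr normrM (_ : `|sg| = 1) ?mul1r; first exact: vK.
  by case: sg1 => ->.
have jkL : j%:R * L <= k%:R * L by apply: ler_wpM2r => //; rewrite ler_nat.
have xa0 : 0 < `|x 0 a| by rewrite normr_gt0.
have jL0 : 0 <= j%:R * L by rewrite mulr_ge0.
split.
  exists (j%:R * L).
  have va := vK a; have vb := vK b.
  rewrite -(ler_int R) intr_norm intrB [X in _ - X%:~R]mxE intrD in va.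
  rewrite -(ler_int R) intr_norm intrB [X in _ - X%:~R]mxE intrD start_b intrD in vb.
  have ma := ray_pointE (j%:R * L) a; have mb := ray_pointE (j%:R * L) b.
  rewrite -/(milestone j) in ma mb.
  have ub := unit_abs R q b.
  have sa : `|(start q 0 a)%:~R : R| <= (A + 1)%:~R.
    by apply: (height_abs _ sg1); move: hz A0; clear; move: (axis_height _ _ _) => H; lia.
  rewrite intrD in sa.
  have A0R : 0 <= A%:~R :> R by rewrite ler0z.
  have D0 : 0 <= D.
    apply: le_trans kD; apply: le_trans kn.
    by move: (A%:~R : R) A0R => AR ?; rewrite !addr_ge0.
  have K0 : 0 <= K%:R :> R by [].
  rewrite [K%:Z%:~R](_ : _ = K%:R)// in va; rewrite [K%:Z%:~R](_ : _ = K%:R)// in vb.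
  move: va vb ma mb ub sa rhoE A0R K0 D0.
  move: (v 0 a)%:~R (v 0 b)%:~R (start q 0 a)%:~R (milestone j 0 a)%:~R (milestone j 0 b)%:~R
    (offset q)%:~R (signed_unit q 0 b)%:~R (A%:~R : R) (K%:R : R) (j%:R * L * x 0 a) (j%:R * L * x 0 b).
  move=> va vb za ma mb o u AR KR ja jb.
  move=> /ler_normlP[? ?] /ler_normlP[? ?] /ler_normlP[? ?] /ler_normlP[? ?] /ler_normlP[? ?] /ler_normlP[? ?] ? ? ? ?.
  by split; apply/ler_normlP; split; lra.
have hn := height_ray n.
have lower : (A - 2 - K%:Z)%:~R <= (height v)%:~R :> R.
  have : - 1 <= (height (milestone j))%:~R :> R.
    move: hm => /ler_normlP[h1 h2].
    have : 0 <= j%:R * L * `|x 0 a| by rewrite mulr_ge0.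
    by move: (height _)%:~R h1 h2 => H; lra.
  rewrite -[- 1 : R](intrN _ 1) ler_int ler_int => h1.
  move: hE hv hz h1; clear.
  move: (height v) (height (start q + milestone j)) (height (start q)) (height (milestone j)).
  by move=> h1 h2 h3 h4; lia.
rewrite ler_int in lower.
apply/andP; split.
  by move: lower AK; clear; move: (height v) => h; lia.
have upper : (height (milestone j) + K%:Z + A + 3)%:~R <= (height y)%:~R :> R.
  have h3 : j%:R * L * `|x 0 a| + A%:~R + K%:R + 5 <= n * `|x 0 a|.
    have : j%:R * L * `|x 0 a| <= k%:R * L * `|x 0 a| by apply: ler_wpM2r.
    move: kn; rewrite mulrBl.
    by move: (j%:R * L * _) (k%:R * L * _) (n * _) (A%:~R : R) => *; lra.
  rewrite !intrD; move: hm hn => /ler_normlP[h1 h2] /ler_normlP[h1' h2'].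
  move: h3 h1 h2 h1' h2'; rewrite -[K%:Z%:~R]/(K%:R).
  move: (j%:R * L * _) (n * _) (A%:~R : R) (K%:R : R) (height _)%:~R (height _)%:~R => *; lra.
rewrite ler_int in upper.
move: hE hv hz upper; clear.
move: (height v) (height (start q + milestone j)) (height (start q)) (height (milestone j)) (height y).
by move=> h1 h2 h3 h4 h5; lia.
Qed.

(** Both ends of the gap lie in the lane, and so does the box that they span, as
    the gap has length at most [D]. *)
Lemma gap_region q v : in_hull (start q + milestone k) (y + flip a (start q)) v -> region q v.
Proof.
move=> h; apply: Or32.
have A0 := A_ge0.
have hz := height_lane_start S ab sg1 A0 q.
have sa : `|(start q 0 a)%:~R : R| <= (A + 1)%:~R.
  by apply: (height_abs _ sg1); move: hz A0; clear; move: (axis_height _ _ _) => H; lia.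
rewrite intrD in sa.
have ub := unit_abs R q b.
have A0R : 0 <= A%:~R :> R by rewrite ler0z.
have K0 : 0 <= K%:R :> R by [].
have gap0 : 0 <= n - k%:R * L.
  have xa0 : 0 < `|x 0 a| by rewrite normr_gt0.
  rewrite -(pmulr_lge0 _ xa0); apply: le_trans kn.
  by move: (A%:~R : R) A0R => AR ?; rewrite !addr_ge0.
have gapc c : `|(n - k%:R * L) * x 0 c| <= D.
  rewrite normrM (ger0_norm gap0); apply: le_trans kD.
  exact: ler_wpM2l.
split.
  exists n; have ha := h a; have hb := h b.
  have ma := ray_pointE (k%:R * L) a; have mb := ray_pointE (k%:R * L) b.
  rewrite -/(milestone k) in ma mb.
  have na := ray_pointE n a; have nb := ray_pointE n b.
  have ga := gapc a; have gb := gapc b; rewrite mulrBl in ga; rewrite mulrBl in gb.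
  rewrite [(start q + milestone k) 0 a]mxE [(y + flip a (start q)) 0 a]mxE flipE eqxx in ha.
  rewrite [(start q + milestone k) 0 b]mxE [(y + flip a (start q)) 0 b]mxE flipE eq_sym (negbTE ab) start_b in hb.
  rewrite -!(ler_int R) !intrD !intrN in ha; rewrite -!(ler_int R) !intrD in hb.
  move: ha hb ma mb na nb ga gb sa ub rhoE A0R K0.
  move: (v 0 a)%:~R (v 0 b)%:~R (start q 0 a)%:~R (milestone k 0 a)%:~R (milestone k 0 b)%:~R
    (y 0 a)%:~R (y 0 b)%:~R (offset q)%:~R (signed_unit q 0 b)%:~R (A%:~R : R) (K%:R : R)
    (k%:R * L * x 0 a) (k%:R * L * x 0 b) (n * x 0 a) (n * x 0 b).
  move=> va vb za ma mb ya yb o u AR KR ka kb na nb ha hb.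
  move=> /ler_normlP[? ?] /ler_normlP[? ?] /ler_normlP[? ?] /ler_normlP[? ?] /ler_normlP[? ?] /ler_normlP[? ?] /ler_normlP[? ?] /ler_normlP[? ?] ? ? ?.
  split; apply/ler_normlP; split; case/orP: ha => /andP[? ?]; case/orP: hb => /andP[? ?]; lra.
have [r1 /andP[h1 h2]] : lane q (start q + milestone k) /\ 2 <= height (start q + milestone k) <= height y - 2.
  by apply: (@box_lane q k) => // c; rewrite subrr normr0.
have h3 : height (y + flip a (start q)) = height y - height (start q).
  by rewrite /axis_height [X in _ * X = _]mxE flipE eqxx mulrDr mulrN.
have h4 : 2 <= height y - height (start q) <= height y - 2.
  by move: hz A0 AK hy; clear; move: (height y) (height (start q)) => hy' hs; lia.
rewrite -h3 in h4; have := h a; move: h1 h2 h4; rewrite /axis_height; move: sg1; clear.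
move: (v 0 a) ((start q + milestone k) 0 a) ((y + flip a (start q)) 0 a) (y 0 a) => t u u' yy.
by case=> ->; lia.
Qed.

(** The point reached on the way back from the target by the reflection of a
    move away from the origin. *)
Definition arrival g : 'rV[int]_d := y + flip a g.

Definition route_ends q : {fset edge d} :=
  (hull_edges 0 (signed_unit q) `|` hull_edges (signed_unit q) (foot q)
   `|` hull_edges (foot q) (start q)
   `|` hull_edges (start q + milestone k) (arrival (start q))
   `|` hull_edges (arrival (start q)) (arrival (foot q))
   `|` hull_edges (arrival (foot q)) (arrival (signed_unit q))
   `|` hull_edges (arrival (signed_unit q)) (arrival 0))%fset.

Definition route_boxes q : {fset edge d} :=
  (\bigcup_(j <- iota 0 k) box_at K (start q + milestone j))%fset.

Definition route q : {fset edge d} := (route_ends q `|` route_boxes q)%fset.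

Lemma route_region q (e : edge d) : e \in route q ->
  forall v : 'rV[int]_d, v \in val e -> [\/ region q v, v = 0 | v = y].
Proof.
have A0 := A_ge0.
have arr g g' v : (forall v, in_hull g' g v -> fan q v \/ v = 0) ->
    in_hull (arrival g) (arrival g') v -> [\/ region q v, v = 0 | v = y].
  move=> H h; have [f|f0] := H _ (in_hull_flip h); first by apply: Or31; apply: Or33.
  apply: Or33; apply/eqP; rewrite -subr_eq0; apply/eqP.
  by rewrite -[LHS](flipK a) f0 flip0.
move=> er v ve; move: er; rewrite !inE -!orbA => /or4P[h|h|h|/or4P[h|h|h|/orP[h|h]]].
- have [f|->] := hull_unit_fan S ab sg1 A0 (hull_edges_in h ve); last exact: Or32.
  by apply: Or31; apply: Or31.
- by apply: Or31; apply: Or31; exact: (hull_crossbar_fan ab sg1 A0 (hull_edges_in h ve)).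
- by apply: Or31; apply: Or31; exact: (hull_lane_fan ab sg1 A0 (hull_edges_in h ve)).
- by apply: Or31; exact: (gap_region (hull_edges_in h ve)).
- apply: arr (hull_edges_in h ve) => u hu; left; exact: (hull_lane_fan ab sg1 A0 hu).
- apply: arr (hull_edges_in h ve) => u hu; left; exact: (hull_crossbar_fan ab sg1 A0 hu).
- apply: arr (hull_edges_in h ve) => u hu; exact: (hull_unit_fan S ab sg1 A0 hu).
move: h => /bigfcupP[j]; rewrite mem_iota andbT /= add0n => jk /box_atP h.
by apply: Or31; apply: Or32; apply: (@box_lane q j) => [|c]; [exact: ltnW|exact: h].
Qed.

Lemma rho_ge : A%:~R + 2 <= rho.
Proof.
have K0 : 0 <= K%:R :> R by [].
have D0 : 0 <= D.
  apply: le_trans kD; apply: le_trans kn.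
  have : 0 <= A%:~R :> R by rewrite ler0z A_ge0.
  by move=> A0; rewrite !addr_ge0.
by move: rhoE K0 D0; move: (A%:~R : R) (K%:R : R) => AR KR; lra.
Qed.

Lemma route_disjoint q q' : q != q' -> [set` route q] `&` [set` route q'] = set0.
Proof.
move=> qq'; rewrite -subset0 => e [/= e1 e2]; case/eqP: qq'.
apply: (@region_edge_disjoint R d x a b sg A S rho n y ab sg1 A_ge0 xa (xmax b) rho_ge Srho _ hy q q' e).
- by move=> c; exact: ray_pointE.
- exact: route_region e1.
- exact: route_region e2.
Qed.

Definition ends_length q : nat :=
  (2 * (dist 0 (signed_unit q) + dist (signed_unit q) (foot q) + dist (foot q) (start q))
   + dist (start q + milestone k) (arrival (start q)))%N.

Lemma card_route q : (#|` route q| <= ends_length q + k * #|` box_edges d K|)%N.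
Proof.
have h (I J : {fset edge d}) m m' : (#|` I| <= m)%N -> (#|` J| <= m')%N ->
    (#|` (I `|` J)%fset| <= m + m')%N.
  by move=> Im Jm; rewrite (leq_trans _ (leq_add Im Jm))// cardfsU leq_subr.
apply: (h); last first.
  rewrite /route_boxes -[k in (k * _)%N](size_iota 0).
  elim: (iota 0 k) => [|j s IH]; first by rewrite big_nil cardfs0.
  by rewrite big_cons mulSn; apply: (h) => //; exact: card_box_at.
have e1 : dist (arrival (start q)) (arrival (foot q)) = dist (foot q) (start q).
  by rewrite dist_flip distC.
have e2 : dist (arrival (foot q)) (arrival (signed_unit q)) = dist (signed_unit q) (foot q).
  by rewrite dist_flip distC.
have e3 : dist (arrival (signed_unit q)) (arrival 0) = dist 0 (signed_unit q).
  by rewrite dist_flip distC.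
rewrite /ends_length (_ : (2 * _ + _ = dist 0 (signed_unit q) + dist (signed_unit q) (foot q) + dist (foot q) (start q)
   + dist (start q + milestone k) (arrival (start q))
   + dist (arrival (start q)) (arrival (foot q))
   + dist (arrival (foot q)) (arrival (signed_unit q))
   + dist (arrival (signed_unit q)) (arrival 0))%N).
  by do 6! (apply: (h); last exact: card_hull_edges); exact: card_hull_edges.
rewrite e1 e2 e3.
by move: (dist 0 _) (dist _ (foot q)) (dist (foot q) _) (dist _ (arrival _)); clear; lia.
Qed.

(** Capped weights are bounded, so their sums concentrate exponentially; what
    exceeds the cap is accounted for by [excess]. *)
Definition cap (M : nat) w : edge d -> R := fun e => Num.min `|w e| M%:R.

Lemma cap_ge0 M w e : 0 <= cap M w e <= M%:R.
Proof. by rewrite le_min normr_ge0 ler0n /= ge_min lexx orbT. Qed.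

Definition block (M : nat) q (j : nat) w : R :=
  fpt [set` box_at K (start q + milestone j)] (cap M w)
    (start q + milestone j) (start q + milestone j.+1).

Lemma block_joined q j : [set` hull_edges (start q + milestone j) (start q + milestone j.+1)] `<=`
  [set` box_at K (start q + milestone j)].
Proof.
apply: box_at_joined => c; rewrite !mxE.
rewrite (_ : _ - _ = milestone j.+1 0 c - milestone j 0 c); first exact: vstep.
by rewrite !mxE; ring.
Qed.

Lemma fpt_excess (J : {fset edge d}) M w u v : joined [set` J] u v ->
  fpt [set` J] (fun e => `|w e|) u v <= fpt [set` J] (cap M w) u v + \sum_(e <- J) excess M (w e).
Proof.
move=> j; rewrite -lerBlDr; apply: fpt_glb => // p pp pJ; rewrite lerBlDr.
apply: le_trans (fpt_le (fun=> normr_ge0 _) pp pJ) _.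
have [I [IE _]] := path_edges_card u p; rewrite !(passage_time_fset _ IE).
have IJ : {subset I <= J} by move=> e eI; apply: pJ; rewrite IE.
apply: le_trans (lerD (lexx _) (ler_sum_fset (fun e => excess_ge0 M (w e)) IJ)).
by rewrite -big_split /=; apply: ler_sum => e _; exact: norm_le_excess.
Qed.

(** The triangle inequality along the pieces of the route, with capped weights;
    on the pieces other than the boxes each edge costs at most [M]. *)
Lemma route_bound M q w : fpt setT (fun e => `|w e|) 0 y <=
  \sum_(0 <= j < k) block M q j w + M%:R * (ends_length q)%:R + \sum_(e <- route q) excess M (w e).
Proof.
pose E : set (edge d) := [set` route q].
have sub1 (J : {fset edge d}) : (J `<=` route_ends q)%fset -> [set` J] `<=` E.
  by move=> /fsubsetP JE e eJ; rewrite /E /=; apply/fsetUP; left; exact: JE.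
have c0 e : 0 <= cap M w e by case/andP: (cap_ge0 M w e).
have cM := cap_ge0 M w.
have M0 : 0 <= M%:R :> R by [].
have piece u v : (hull_edges u v `<=` route_ends q)%fset ->
    joined E u v /\ fpt E (cap M w) u v <= M%:R * (dist u v)%:R.
  move=> /sub1 h; split; first exact: hull_edges_joined h.
  exact: hull_edges_fpt M0 cM h.
have cat u v z (r s : R) : joined E u v /\ fpt E (cap M w) u v <= r ->
    joined E v z /\ fpt E (cap M w) v z <= s ->
    joined E u z /\ fpt E (cap M w) u z <= r + s.
  move=> [j1 h1] [j2 h2]; split; first exact: joined_trans j2.
  by apply: le_trans (fpt_triangle c0 j1 j2) _; exact: lerD.
have boxes : forall l, (l <= k)%N -> joined E (start q) (start q + milestone l) /\
    fpt E (cap M w) (start q) (start q + milestone l) <= \sum_(0 <= j < l) block M q j w.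
  have m0 : milestone 0 = 0.
    by rewrite /milestone mul0r /ray_point scale0r floor_point0.
  elim=> [|l IH] lk.
    rewrite m0 addr0 big_geq//; split; first by exists [::]; split=> //; rewrite path_edges_nil.
    have := @fpt_le R d E (cap M w) (start q) (start q) [::] c0 (conj (erefl _) (erefl _)).
    rewrite path_edges_nil => /(_ (sub0set _)); rewrite (@passage_time_fset _ _ _ _ _ fset0) ?big_nil//.
    by rewrite path_edges_nil; apply/seteqP; split.
  rewrite big_nat_recr//=; apply: cat (IH (ltnW lk)) _.
  have sub : [set` box_at K (start q + milestone l)] `<=` E.
    move=> e /= eb; rewrite /E /= inE; apply/orP; right; apply/bigfcupP; exists l => //.
    by rewrite mem_iota andbT.
  have jb := hull_edges_joined (@block_joined q l).
  split; last exact: fpt_sub.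
  by apply: hull_edges_joined; apply: subset_trans sub; exact: block_joined.
have tot : joined E 0 y /\ fpt E (cap M w) 0 y <=
    \sum_(0 <= j < k) block M q j w + M%:R * (ends_length q)%:R.
  have yE : y = arrival 0 by rewrite /arrival flip0 addr0.
  rewrite [X in joined E 0 X]yE [X in fpt _ _ 0 X]yE.
  have s i : (i \in [:: hull_edges 0 (signed_unit q); hull_edges (signed_unit q) (foot q);
     hull_edges (foot q) (start q); hull_edges (start q + milestone k) (arrival (start q));
     hull_edges (arrival (start q)) (arrival (foot q));
     hull_edges (arrival (foot q)) (arrival (signed_unit q));
     hull_edges (arrival (signed_unit q)) (arrival 0)]) -> (i `<=` route_ends q)%fset.
    move=> ii; apply/fsubsetP => e ei; move: ii; rewrite !inE.
    by move=> /or4P[/eqP E1|/eqP E1|/eqP E1|/or4P[/eqP E1|/eqP E1|/eqP E1|/eqP E1]];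
      rewrite -E1 ei ?orbT.
  have [i1 i2 i3 i4] : [/\ (hull_edges 0 (signed_unit q) `<=` route_ends q)%fset,
      (hull_edges (signed_unit q) (foot q) `<=` route_ends q)%fset,
      (hull_edges (foot q) (start q) `<=` route_ends q)%fset &
      (hull_edges (start q + milestone k) (arrival (start q)) `<=` route_ends q)%fset].
    by split; apply: s; rewrite !inE eqxx ?orbT.
  have [i5 i6 i7] : [/\ (hull_edges (arrival (start q)) (arrival (foot q)) `<=` route_ends q)%fset,
      (hull_edges (arrival (foot q)) (arrival (signed_unit q)) `<=` route_ends q)%fset &
      (hull_edges (arrival (signed_unit q)) (arrival 0) `<=` route_ends q)%fset].
    by split; apply: s; rewrite !inE eqxx ?orbT.
  have t2 := cat _ _ _ _ _ (piece _ _ i1) (piece _ _ i2).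
  have t3 := cat _ _ _ _ _ t2 (piece _ _ i3).
  have t4 := cat _ _ _ _ _ t3 (boxes k (leqnn k)).
  have t5 := cat _ _ _ _ _ t4 (piece _ _ i4).
  have t6 := cat _ _ _ _ _ t5 (piece _ _ i5).
  have t7 := cat _ _ _ _ _ t6 (piece _ _ i6).
  have [t8 t8le] := cat _ _ _ _ _ t7 (piece _ _ i7).
  split; first exact: t8.
  apply: le_trans t8le _.
  rewrite [dist (arrival (start q)) _](_ : _ = dist (foot q) (start q)); last by rewrite dist_flip distC.
  rewrite [dist (arrival (foot q)) _](_ : _ = dist (signed_unit q) (foot q)); last by rewrite dist_flip distC.
  rewrite [dist (arrival (signed_unit q)) _](_ : _ = dist 0 (signed_unit q)); last by rewrite dist_flip distC.
  rewrite /ends_length natrD natrM !natrD le_eqVlt; apply/orP; left; apply/eqP.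
  move: (\sum_(0 <= j < k) _) (dist 0 _)%:R (dist _ (foot q))%:R (dist (foot q) _)%:R (dist _ (arrival _))%:R.
  by move=> r1 r2 r3 r4 r5; ring.
case: tot => j0y h.
apply: (@le_trans _ _ (fpt E (fun e => `|w e|) 0 y)).
  by apply: fpt_sub.
apply: le_trans (fpt_excess M w j0y) _; rewrite lerD2r; exact: h.
Qed.

End routes.

(** * Mean passage times in boxes *)

Section exhaustion.
Variables (R : realType) (d : nat).
Local Notation W := (field R (edge d)).
Variables (Q : probability W R) (nu : probability R R).
Hypothesis Qcyl : forall J B, (forall i, measurable (B i)) ->
  Q (cylinder J B) = (\prod_(i <- J) nu (B i))%E.
Hypothesis mfin : (moment nu < +oo)%E.
Implicit Types (c v delta : 'rV[int]_d) (J : {fset edge d}) (w : edge d -> R).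

Lemma box_edges_exhaust J : exists K0 : nat, forall K, (K0 <= K)%N ->
  {subset J <= box_edges d K}.
Proof.
exists (\sum_(e <- J) \sum_(v <- (val e : {fset lattice d})) \sum_(i < d) absz (v 0%R i))%N.
move=> K hK e eJ; apply/box_edgesP => v i ve.
apply: (@le_trans _ _ ((absz (v 0 i))%:Z)); first by rewrite abszE.
rewrite lez_nat; apply: leq_trans hK.
rewrite (big_rem e)//=; apply: leq_trans (leq_addr _ _).
rewrite (big_rem v)//=; apply: leq_trans (leq_addr _ _).
by rewrite (bigD1 i)//= leq_addr.
Qed.

Definition boxed (K : nat) delta w : R := fpt [set` box_edges d K] (fun e => `|w e|) 0 delta.

(** Restricting paths to a large box costs little: the restricted passage times
    decrease to the unrestricted one and are dominated along a fixed path. *)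
Lemma boxed_mean delta (e : R) : 0 < e -> exists K0 : nat, forall K, (K0 <= K)%N ->
  (\int[Q]_w (boxed K delta w)%:E <= ET Q 0 delta + e%:E)%E.
Proof.
move=> e0; have [K1 hK1] := box_edges_exhaust (hull_edges 0 delta).
pose f n (w : W) : \bar R := (boxed (n + K1) delta w)%:E.
pose g (w : W) : \bar R := (\sum_(i <- hull_edges 0 delta) `|w i|)%:E.
have jn n : joined [set` box_edges d (n + K1)] 0 delta.
  by apply: hull_edges_joined => i ih; apply: hK1 => //; exact: leq_addl.
have mf n : measurable_fun setT (f n) by exact: measurable_T.
have ig : Q.-integrable setT g.
  apply/integrableP; split.
    apply/measurable_EFinP; apply: (measurable_sum_weight (hull_edges 0 delta)).
    exact: normr_measurable.
  under eq_integral do rewrite /g /= ger0_norm ?sumr_ge0//.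
  by rewrite (integral_sum_weight Qcyl) (momentE mfin) -EFinM ltry.
have fg n (w : W) : (`|f n w| <= g w)%E.
  rewrite /f /= ger0_norm ?fpt_ge0// lee_fin.
  have [p [[pp pE] _ _]] : exists p, [/\ is_path 0 delta p /\ path_edges 0 p = [set` hull_edges 0 delta], True & True].
    rewrite /hull_edges; case: cid => J [[p [pp pE]] _ _] /=.
    by exists p.
  rewrite -(passage_time_fset _ pE); apply: fpt_le => //.
  by rewrite pE => i ih; apply: hK1 => //; exact: leq_addl.
have fcvg (w : W) : f n w @[n --> \oo] --> (fpt setT (fun e => `|w e|) 0 delta)%:E.
  apply: cvg_EFin; first by near=> n.
  apply/cvgrPdist_le => eps eps0.
  have /(fpt_lt _ (fun=> normr_ge0 _) (joinedT 0 delta))[p [pp _ pt]] :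
      fpt setT (fun e => `|w e|) 0 delta < fpt setT (fun e => `|w e|) 0 delta + eps.
    by rewrite ltrDl.
  have [J [JE _]] := path_edges_card 0 p; have [K2 hK2] := box_edges_exhaust J.
  near=> n; rewrite /f /=.
  have lo : fpt setT (fun e => `|w e|) 0 delta <= boxed (n + K1) delta w by apply: fpt_sub.
  rewrite distrC ger0_norm ?subr_ge0// lerBlDl; apply: le_trans (ltW pt).
  apply: fpt_le => //; rewrite JE => i ih; apply: hK2 => //.
  rewrite (leq_trans _ (leq_addr _ _))//; near: n; exact: nbhs_infty_ge.
have mT : measurable_fun setT (fun w : W => (fpt setT (fun e => `|w e|) 0 delta)%:E).
  exact: measurable_T.
have [|||_ _ ] := @dominated_convergence _ _ _ Q _ measurableT f
  (fun w : W => (fpt setT (fun e => `|w e|) 0 delta)%:E) g mf mT.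
- by apply: aeW => w _; exact: fcvg.
- exact: ig.
- by apply: aeW => w n _; exact: fg.
rewrite -ETE (ET_fin Qcyl mfin) => /fine_cvgP[fin /cvgrPdist_le /(_ _ e0)] cv.
have [N _ hN] : \forall n \near \oo, (\int[Q]_w f n w <= (fine (ET Q 0 delta))%:E + e%:E)%E.
  near=> n; have h1 : (\int[Q]_w f n w)%E \is a fin_num by near: n.
  have h2 : `|fine (ET Q 0 delta) - fine (\int[Q]_w f n w)%E| <= e by near: n.
  rewrite -(fineK h1) -EFinD lee_fin; move: h2 => /ler_normlP[h2 _].
  by move: (fine _) (fine _) h2 => u v; lra.
exists (N + K1)%N => K hK.
have -> : K = ((K - K1) + K1)%N by rewrite subnK// (leq_trans _ hK)// leq_addl.
by apply: hN => /=; rewrite leq_subRL ?(leq_trans _ hK)// ?leq_addl// addnC.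
Unshelve. all: by end_near. Qed.

(** By translation invariance the box may be centred at the origin, and capping
    only decreases the weights. *)
Lemma boxed_capped_mean (K M : nat) c delta : joined [set` box_edges d K] 0 delta ->
  (\int[Q]_w (fpt [set` box_at K c] (cap M w) c (c + delta))%:E <=
   \int[Q]_w (boxed K delta w)%:E)%E.
Proof.
move=> j.
have mb : measurable_fun setT (fun w : W => (boxed K delta w)%:E) by exact: measurable_T.
rewrite -(integral_shift_field Qcyl c mb); last by move=> w; rewrite lee_fin fpt_ge0.
apply: ge0_le_integral => //.
- by move=> w _; rewrite lee_fin fpt_ge0// => i; case/andP: (cap_ge0 M w i).
- apply/measurable_EFinP; apply: (@measurable_fpt R d (fun t => Num.min `|t| M%:R)).
    by apply: measurable_minr; [exact: normr_measurable|exact: measurable_cst].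
  by move=> t; rewrite le_min normr_ge0 ler0n.
- exact: (measurableT_comp mb (measurable_shift_field c)).
move=> w _; rewrite lee_fin.
have -> : boxed K delta (fun e => w (shift_edge c e)) =
    fpt [set` box_at K c] (fun e => `|w e|) c (c + delta).
  rewrite box_atE [X in fpt _ _ _ X]addrC -[X in fpt _ _ X _]add0r.
  exact: (@fpt_shift R d c [set` box_edges d K] (fun e => `|w e|) 0 delta).
apply: fpt_le_weight.
- by move=> i; case/andP: (cap_ge0 M w i).
- case: j => p [pp pE]; exists [seq z + c | z <- p]; split.
    by have := is_path_shift c pp; rewrite add0r addrC.
  have := path_edges_shift c 0 p; rewrite add0r => ->.
  by rewrite box_atE; exact: image_subset.
- by move=> i; rewrite /cap ge_min lexx.
Qed.

End exhaustion.

(** * Choice of the routes *)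

Section distances.
Variable d : nat.
Implicit Types (u v z : 'rV[int]_d).

Lemma dist_triangle u v z : (dist u z <= dist u v + dist v z)%N.
Proof.
rewrite /dist -big_split; apply: leq_sum => i _ /=.
by move: (u 0 i) (v 0 i) (z 0 i) => r s t; lia.
Qed.

Lemma dist_add z u v : dist (z + u) (z + v) = dist u v.
Proof.
rewrite /dist; apply: eq_bigr => i _; rewrite !mxE.
by move: (u 0 i) (v 0 i) (z 0 i) => r s t; lia.
Qed.

Lemma edge_nonempty (e : edge d) : exists v : 'rV[int]_d, v \in val e.
Proof.
by case: e => e /= /asboolP[u [v [_ ->]]]; exists u; rewrite fset21.
Qed.

End distances.

Section choose_routes.
Variables (R : realType) (d : nat) (x : 'rV[R]_d) (L : R) (K : nat).
Hypotheses (d2 : (2 <= d)%N) (x0 : x != 0) (L0 : 0 < L).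
Local Notation milestone := (milestone x L).
Hypothesis vstep : forall (j : nat) c, `|milestone j.+1 0 c - milestone j 0 c| <= K%:Z.

Lemma main_direction : exists (a b : 'I_d) (sg : int),
  [/\ a != b, sg = 1 \/ sg = -1, sg%:~R * x 0 a = `|x 0 a|, x 0 a != 0 &
      forall c, `|x 0 c| <= `|x 0 a| ].
Proof.
have [i xi] : exists i, x 0 i != 0.
  apply/existsP; apply: contraT; rewrite negb_exists => /forallP H.
  by case/eqP: x0; apply/rowP => i; rewrite mxE; apply/eqP; move: (H i); rewrite negbK.
have [a _ amax] := @arg_maxP _ _ _ i xpredT (fun c => `|x 0 c|) isT.
have xa : x 0 a != 0.
  by rewrite -normr_gt0; apply: lt_le_trans (amax i isT); rewrite normr_gt0.
have [b ab] : exists b : 'I_d, a != b.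
  have h0 : (0 < d)%N by exact: ltnW.
  have [a0|a0] := eqVneq a (Ordinal h0); last by exists (Ordinal h0).
  by exists (Ordinal d2); rewrite a0.
exists a, b, (if 0 < x 0 a then 1 else -1); split => //.
- by case: ifP; [left|right].
- have [h|h|h] := ltgtP 0 (x 0 a); last by rewrite -h eqxx in xa.
    by rewrite mulr1z mul1r gtr0_norm.
  by rewrite intrN mulN1r ltr0_norm.
- by move=> c; exact: amax.
Qed.

(** Summary of the geometry. The constant [C] bounds the length of the parts of
    a route outside of its boxes, and the defect of [k * L] from [n]; the boxes
    of a lane whose indices are congruent modulo [m] are disjoint, because
    consecutive milestones move on by about [L * |x a|] along the axis [a]. *)
Lemma routes : exists C m : nat, (0 < m)%N /\ \forall n \near \oo,
  exists k (J : 'I_d * bool -> {fset edge d}) (c : 'I_d * bool -> nat -> 'rV[int]_d),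
  [/\ k%:R * L <= n%:R /\ n%:R <= (k + C)%:R * L,
      forall q q', q != q' -> [set` J q] `&` [set` J q'] = set0,
      forall q, (#|` J q| <= C + k * #|` box_edges d K|)%N,
      forall q i j, (i = j %[mod m])%N -> i != j ->
        [set` box_at K (c q i)] `&` [set` box_at K (c q j)] = set0 &
      forall (M : nat) q (w : edge d -> R),
        fpt setT (fun e => `|w e|) 0 (ray_point x n%:R) <=
        \sum_(0 <= j < k) fpt [set` box_at K (c q j)] (cap M w) (c q j)
           (c q j + (milestone j.+1 - milestone j))
        + M%:R * C%:R + \sum_(e <- J q) excess M (w e)].
Proof.
have [a [b [sg [ab sg1 sgx xa xmax]]]] := main_direction.
have xa0 : 0 < `|x 0 a| by rewrite normr_gt0.
(* The climb [A] brings a box of radius [K] above the crossbars; [H] is the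
   least gap in height below the target, [D] the largest one, as [k] is the
   integer part of a quotient by [L]; [rho] and [S] follow. *)
pose A : int := K%:Z + 4.
pose H : R := A%:~R + K%:R + 5.
have H0 : 0 < H by rewrite /H /A intrD addr_gt0// ltr_wpDr// -intrD ltr0z.
pose D := H + L * `|x 0 a|.
pose rho := K%:R + A%:~R + D + 3.
pose S : int := (Num.truncn (4 * rho)).+1%:Z.
have Srho : 4 * rho < S%:~R by exact: truncnS_gt.
(* Length of the two fans and of the gap, up to the distance from the last
   milestone to the target, which the second term of [C1] bounds. *)
pose gap q := (2 * (dist 0 (signed_unit q) + dist (signed_unit q) (lane_foot a b sg S q)
  + dist (lane_foot a b sg S q) (lane_start a b sg A S q))
  + dist (lane_start a b sg A S q) (flip a (lane_start a b sg A S q)))%N.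
pose C1 := (\sum_q gap q + Num.truncn (\sum_(c < d) (D + 2))%R)%N.
pose C := (C1 + (Num.truncn (H / `|x 0 a| / L)%R).+2)%N.
pose m := (Num.truncn ((2 * K%:R + 2) / (L * `|x 0 a|))).+1.
exists C, m; split=> //; near=> n.
pose k := Num.truncn ((n%:R - H / `|x 0 a|) / L).
have nH : H / `|x 0 a| <= n%:R by near: n; exact: nbhs_infty_ger.
have nA : (2 * A + 11)%:~R / `|x 0 a| <= n%:R by near: n; exact: nbhs_infty_ger.
have k0 : 0 <= (n%:R - H / `|x 0 a|) / L by rewrite divr_ge0 ?subr_ge0// ltW.
have /andP[kl ku] := truncn_itv k0; rewrite -/k in kl ku.
rewrite ler_pdivlMr// in kl; rewrite ltr_pdivrMr// in ku.
have {}ku : n%:R - H / `|x 0 a| < k%:R * L + L by move: ku; rewrite -(natr1 k) [(_ + 1) * L]mulrDl mul1r.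
have gapl : H / `|x 0 a| <= n%:R - k%:R * L by lra.
have gapu : n%:R - k%:R * L <= H / `|x 0 a| + L by lra.
have kn : H <= (n%:R - k%:R * L) * `|x 0 a| by rewrite -ler_pdivrMr.
have kD : (n%:R - k%:R * L) * `|x 0 a| <= D.
  apply: le_trans (ler_wpM2r (ltW xa0) gapu) _.
  by rewrite mulrDl divfK ?gt_eqF.
have hy : 2 * A + 10 <= axis_height a sg (ray_point x n%:R).
  have /ler_normlP[h1 _] := height_ray sg1 sgx n%:R.
  have h2 : (2 * A + 11)%:~R <= n%:R * `|x 0 a| by rewrite -ler_pdivrMr.
  rewrite -(ler_int R) (_ : 2 * A + 10 = (2 * A + 11) - 1); last by ring.
  rewrite intrB; move: h1 h2; move: (2 * A + 11)%:~R (axis_height _ _ _)%:~R (n%:R * _) => r s t h1 h2.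
  by lra.
exists k, (fun q => route x a b sg A S K k L n%:R q).
exists (fun q j => lane_start a b sg A S q + milestone j).
have AK : K%:Z + 4 <= A by [].
have endsC q : (ends_length x a b sg A S k L n%:R q <= C)%N.
  apply: leq_trans (leq_addr _ _); rewrite /ends_length.
  set st := lane_start _ _ _ _ _ _.
  apply: (@leq_trans (gap q + dist (milestone k) (ray_point x n%:R))%N).
    rewrite /gap -[leqRHS]addnA leq_add2l [leqRHS]addnC.
    apply: leq_trans (dist_triangle _ (st + ray_point x n%:R) _) _; apply: leq_add.
      by rewrite dist_add.
    by rewrite /arrival addrC dist_add.
  apply: leq_add; first by rewrite (bigD1 q)//= leq_addr.
  rewrite truncn_ge_nat; last first.
    by apply: sumr_ge0 => c _; rewrite addr_ge0// addr_ge0 ?mulr_ge0// ltW.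
  rewrite /dist natr_sum; apply: ler_sum => c _.
  rewrite natr_absz intr_norm intrB.
  have /ler_normlP[e1 e2] := ray_pointE x (k%:R * L) c.
  have /ler_normlP[e3 e4] := ray_pointE x n%:R c.
  have : `|(n%:R - k%:R * L) * x 0 c| <= D.
    rewrite normrM ger0_norm; last by apply: le_trans gapl; rewrite divr_ge0// ltW.
    apply: le_trans kD; apply: ler_wpM2l; last exact: xmax.
    by apply: le_trans gapl; rewrite divr_ge0// ltW.
  rewrite mulrBl => /ler_normlP[e5 e6].
  apply/ler_normlP; move: e1 e2 e3 e4 e5 e6; rewrite -/(milestone k).
  move: (milestone k 0 c)%:~R (ray_point x _ 0 c)%:~R (k%:R * L * _) (n%:R * _).
  by move=> r s t u *; split; lra.
split.
- split; first by have := divr_ge0 (ltW H0) (ltW xa0); lra.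
  have Cb : H / `|x 0 a| / L + 1 <= C%:R.
    apply: (@le_trans _ _ ((Num.truncn (H / `|x 0 a| / L)).+1%:R + 1)).
      by rewrite lerD2r ltW// truncnS_gt.
    by rewrite natr1 ler_nat leq_addl.
  have CL : H / `|x 0 a| + L <= C%:R * L.
    rewrite (_ : H / `|x 0 a| + L = (H / `|x 0 a| / L + 1) * L); last first.
      by rewrite [RHS]mulrDl mul1r divfK ?gt_eqF.
    by apply: ler_wpM2r => //; exact: ltW.
  rewrite natrD [leRHS]mulrDl; move: CL gapu.
  by move: (C%:R * L) (H / _) (k%:R * L) => r s t; lra.
- move=> q q' qq'.
  exact: (@route_disjoint R d x a b sg A S K k L n%:R D rho ab sg1 sgx xa xmax (ltW L0) AK kD kn (lexx _) Srho hy).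
- move=> q; apply: leq_trans (card_route _ _ _ _ _ _ _ _ _ _ _) _; rewrite leq_add2r.
  exact: endsC.
- move=> q i j ij nij; rewrite -subset0 => e [/= /box_atP h1 /box_atP h2].
  have [v ve] := edge_nonempty e.
  have g1 : `|v 0 a - (lane_start a b sg A S q 0 a + milestone i 0 a)| <= K%:Z.
    by have := h1 v a ve; rewrite [X in _ - X]mxE.
  have g2 : `|v 0 a - (lane_start a b sg A S q 0 a + milestone j 0 a)| <= K%:Z.
    by have := h2 v a ve; rewrite [X in _ - X]mxE.
  have g : `|milestone i 0 a - milestone j 0 a| <= 2 * K%:Z.
    move: g1 g2; clear; move: (v 0 a) (lane_start _ _ _ _ _ _ 0 a) (milestone i 0 a) (milestone j 0 a).
    by move=> r s t u; lia.
  have gR : `|i%:R * L - j%:R * L| * `|x 0 a| <= 2 * K%:R + 2.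
    rewrite -normrM mulrBl.
    have /ler_normlP[e1 e2] := ray_pointE x (i%:R * L) a.
    have /ler_normlP[e3 e4] := ray_pointE x (j%:R * L) a.
    move: g; rewrite -(ler_int R) intr_norm intrB intrM => /ler_normlP[e5 e6].
    rewrite [K%:Z%:~R](_ : _ = K%:R)// in e5 e6.
    apply/ler_normlP; move: e1 e2 e3 e4 e5 e6; rewrite -/(milestone i) -/(milestone j).
    move: (milestone i 0 a)%:~R (milestone j 0 a)%:~R (i%:R * L * _) (j%:R * L * _) (K%:R : R).
    by move=> r s t u KR *; split; lra.
  have mij : m%:R <= `|i%:R - j%:R| :> R.
    have [ltij|ltji|eqij] := ltngtP i j; last by rewrite eqij eqxx in nij.
      rewrite distrC -natrB 1?ltnW// ger0_norm// ler_nat; apply: dvdn_leq; first by rewrite subn_gt0.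
      by rewrite -eqn_mod_dvd 1?ltnW//; apply/eqP.
    rewrite -natrB 1?ltnW// ger0_norm// ler_nat; apply: dvdn_leq; first by rewrite subn_gt0.
    by rewrite -eqn_mod_dvd 1?ltnW//; apply/eqP.
  have : m%:R * (L * `|x 0 a|) <= 2 * K%:R + 2.
    apply: le_trans gR; rewrite -mulrBl normrM (gtr0_norm L0) mulrA.
    apply: ler_wpM2r; first exact: ltW.
    by apply: ler_wpM2r => //; exact: ltW.
  rewrite -ler_pdivlMr ?mulr_gt0// leNgt => /negP; apply.
  exact: truncnS_gt.
- move=> M q w.
  apply: le_trans (route_bound a b sg A S k n%:R vstep M q w) _; rewrite lerD2r.
  apply: lerD; last by apply: ler_wpM2l; rewrite ?ler_nat.
  rewrite le_eqVlt; apply/orP; left; apply/eqP; apply: eq_bigr => j _; rewrite /block.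
  have E (u v t : 'rV[int]_d) : u + v = u + t + (v - t).
    by rewrite -addrA [t + _]addrC subrK.
  by congr (fpt _ _ _ _); exact: E.
Unshelve. all: by end_near. Qed.

End choose_routes.

(** * Upper bound *)

Section upper_bound.
Variables (R : realType) (d : nat) (x : 'rV[R]_d).
Local Notation W := (field R (edge d)).
Variables (Q : probability W R) (nu : probability R R).
Hypothesis Qcyl : forall J B, (forall i, measurable (B i)) ->
  Q (cylinder J B) = (\prod_(i <- J) nu (B i))%E.
Hypothesis mfin : (moment nu < +oo)%E.
Variable mu : R.
Hypothesis cvmu : t^-1 * fine (ET Q 0 (ray_point x t)) @[t --> +oo] --> mu.
Local Notation m := (fine (moment nu)).

(** All increments of the milestones are among the [2 ^ d] vectors obtained by
    rounding, so that one block length and one box size serve all of them. *)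
Lemma block_choice (e : R) : 0 < e -> exists L K D : nat, [/\ (0 < L)%N,
  forall j c, `|milestone x L%:R j.+1 0 c - milestone x L%:R j 0 c| <= K%:Z,
  forall j, (dist 0 (milestone x L%:R j.+1 - milestone x L%:R j)%R <= D)%N &
  forall j, (\int[Q]_w (boxed K (milestone x L%:R j.+1 - milestone x L%:R j) w)%:E <=
             (L%:R * (mu + e))%:E)%E].
Proof.
move=> e0; have e30 : 0 < e / 3 by rewrite divr_gt0.
have m0 := mean_ge0 nu.
have [T T1 hT] : exists2 T : R, 1 <= T & forall t, T <= t ->
    t^-1 * fine (ET Q 0 (ray_point x t)) <= mu + e / 3.
  apply: near_pinfty_ge; have /cvgrPdist_le/(_ _ e30) := cvmu.
  by apply: filterS => t /ler_normlP[h _]; move: (_ * fine _) h => u; lra.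
pose L := (Num.truncn (Num.max T (d%:R * m / (e / 3)))).+1.
have LT : Num.max T (d%:R * m / (e / 3)) <= L%:R by rewrite ltW// truncnS_gt.
move: LT; rewrite ge_max => /andP[LT Lm].
have L0 : 0 < L%:R :> R by [].
rewrite ler_pdivrMr// in Lm.
have gL := hT _ LT; rewrite mulrC ler_pdivrMr// in gL.
pose delta (f : {ffun 'I_d -> bool}) : 'rV[int]_d :=
  ray_point x L%:R + \row_c (f c)%:Z.
have step j : exists f, milestone x L%:R j.+1 - milestone x L%:R j = delta f.
  have /choice [f hf] : forall c, exists g : bool,
      Num.floor (j%:R * L%:R * x 0 c + L%:R * x 0 c) =
      Num.floor (j%:R * L%:R * x 0 c) + Num.floor (L%:R * x 0 c) + g%:Z.
    by move=> c; exact: floorD_bit.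
  exists [ffun c => f c]; apply/rowP => c; rewrite !mxE ffunE.
  rewrite (_ : j.+1%:R * L%:R * x 0 c = j%:R * L%:R * x 0 c + L%:R * x 0 c); last first.
    by rewrite -natr1; ring.
  by rewrite hf; move: (Num.floor _) (Num.floor _) => u v; ring.
have dd f : (dist (ray_point x L%:R) (delta f) <= d)%N.
  rewrite -[leqRHS]card_ord -sum1_card; apply: leq_sum => c _; rewrite !mxE.
  by move: (Num.floor _); case: (f c) => u; lia.
have ETd f : (ET Q 0 (delta f) <= (L%:R * (mu + e / 3) + L%:R * (e / 3))%:E)%E.
  rewrite (ET_fin Qcyl mfin) lee_fin.
  apply: le_trans (fine_ET_triangle Qcyl mfin 0 (ray_point x L%:R) (delta f)) _.
  apply: lerD; first by rewrite mulrC.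
  apply: le_trans (fine_ET_le Qcyl mfin _ _) _.
  apply: le_trans Lm; apply: ler_wpM2r => //.
  by rewrite ler_nat.
have /choice [K0 hK0] : forall f, exists k0 : nat, forall K, (k0 <= K)%N ->
    (\int[Q]_w (boxed K (delta f) w)%:E <= ET Q 0 (delta f) + (L%:R * (e / 3))%:E)%E.
  by move=> f; apply: (boxed_mean Qcyl mfin); rewrite mulr_gt0.
pose K := (\sum_f K0 f + \sum_f \sum_c absz (delta f 0%R c))%N.
exists L, K, (\sum_f dist 0%R (delta f))%N; split=> //.
- move=> j c; have [f hf] := step j.
  have -> : milestone x L%:R j.+1 0 c - milestone x L%:R j 0 c = delta f 0 c.
    by rewrite -hf !mxE.
  rewrite -abszE lez_nat /K; apply: leq_trans (leq_addl _ _).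
  by rewrite (bigD1 f)//= (bigD1 c)//= -addnA leq_addr.
- move=> j; have [f ->] := step j.
  by rewrite (bigD1 f)//= leq_addr.
- move=> j; have [f ->] := step j.
  apply: le_trans (hK0 f K _) _.
    by apply: leq_trans (leq_addr _ _); rewrite (bigD1 f)//= leq_addr.
  apply: le_trans (leeD (ETd f) (lexx _)) _; rewrite -EFinD lee_fin.
  by move: (L%:R : R) L0 => l l0; nra.
Qed.

Lemma measurable_excess_event (J : {fset edge d}) (M : nat) (t : R) :
  measurable [set w : W | t <= \sum_(e <- J) excess M (w e)].
Proof.
rewrite (_ : [set w | _] = (fun w : W => \sum_(e <- J) excess M (w e)) @^-1` `[t, +oo[).
  rewrite -[X in measurable X]setTI.
  by apply: (measurable_sum_weight J (measurable_excess M)).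
by apply/seteqP; split => w /=; rewrite in_itv/= andbT.
Qed.

Lemma measurable_excess_events (I : finType) (J : I -> {fset edge d}) (M : nat) (t : R) :
  measurable [set w : W | forall q, t <= \sum_(e <- J q) excess M (w e)].
Proof.
rewrite (_ : [set w | _] = \bigcap_(q in [set: I])
    [set w : W | t <= \sum_(e <- J q) excess M (w e)]).
  apply: fin_bigcap_measurable => [|q _]; first exact: finite_finset.
  exact: measurable_excess_event.
by apply/seteqP; split => w h q; [move=> _; exact: h|exact: (h q Logic.I)].
Qed.

(** The sums run over disjoint sets of edges, so that the [2 * d] events are
    independent. *)
Lemma deviation_intersection (J : 'I_d * bool -> {fset edge d}) (M : nat) (t p : R) :
  (forall q q', q != q' -> [set` J q] `&` [set` J q'] = set0) -> 0 <= p ->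
  (forall q, (Q [set w | (t <= \sum_(e <- J q) excess M (w e))%R] <= p%:E)%E) ->
  (Q [set w | forall q, (t <= \sum_(e <- J q) excess M (w e))%R] <= (p ^+ (2 * d))%:E)%E.
Proof.
move=> dJ p0 Jp.
pose V q : set W := [set w | (t <= \sum_(e <- J q) excess M (w e))%R].
have mV q : measurable (V q) by exact: measurable_excess_event.
pose s := enum [set: 'I_d * bool]%SET.
have mall := measurable_excess_events J M t.
rewrite -/(V _) -(setIT [set w | _]) -integral_indic//.
apply: (@le_trans _ _ (\int[Q]_w \prod_(q <- s) (\1_(V q) w)%:E)%E).
  apply: ge0_le_integral => //.
  - by apply/measurable_EFinP; exact: measurable_indic.
  - rewrite (_ : (fun w => _) = (fun w => (\prod_(q <- s) \1_(V q) w)%:E)).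
      by apply/measurable_EFinP; apply: measurable_prod => q _; exact: measurable_indic.
    by apply/funext => w; rewrite prodEFin.
  move=> w _; rewrite prodEFin lee_fin [leLHS]indicE.
  have [/set_mem /= h|_] := boolP (w \in _); last by apply: prodr_ge0 => q _.
  rewrite big1// => q _; rewrite indicE mem_set//; exact: h.
have su : uniq s by exact: enum_uniq.
rewrite (@indep_prod R _ Q nu Qcyl _ s (fun q => [set` J q]) (fun q w => (\1_(V q) w)%:E) su).
- have -> : (2 * d)%N = size s by rewrite -cardE cardsT card_prod card_ord card_bool mulnC.
  apply: prode_le => // [q|q _]; first by apply: integral_ge0 => w _; rewrite lee_fin.
  by rewrite integral_indic// setIT; exact: Jp.
- by move=> q q' _ _; exact: dJ.
- by move=> q; apply/measurable_EFinP; exact: measurable_indic.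
- by move=> q w; rewrite lee_fin.
- move=> q w w' ww'; congr (_%:E); rewrite !indicE; congr ((nat_of_bool _)%:R).
  have E : \sum_(e <- J q) excess M (w e) = \sum_(e <- J q) excess M (w' e).
    by apply: eq_big_seq => e eJ; rewrite ww'.
  by apply/idP/idP => /set_mem h; apply/mem_set; move: h; rewrite /V /= E.
Qed.

End upper_bound.

Section union.
Local Open Scope ereal_scope.

Lemma union_bound (dsp : measure_display) (T : measurableType dsp) (R : realType)
    (Q : probability T R) (I : finType) (U F : set T) (E : I -> set T) (p s : R) :
  measurable U -> measurable F -> (forall q, measurable (E q)) ->
  U `<=` F `|` \bigcup_(q in [set: I]) E q ->
  Q F <= p%:E -> (forall q, Q (E q) <= s%:E) -> Q U <= (p + #|I|%:R * s)%R%:E.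
Proof.
move=> mU mF mE UFE Fp Es.
pose A (o : option I) := if o is Some q then E q else F.
have mA o : measurable (A o) by case: o => [q|]; [exact: mE|exact: mF].
pose s0 := None :: [seq Some q | q <- enum I].
have s0u : uniq s0.
  rewrite /= map_inj_uniq ?enum_uniq ?andbT; last by move=> ? ? [].
  by apply/mapP => -[].
apply: (le_trans (@content_sub_fsum _ _ _ Q _ [set` s0] U A _ _ mU _)) => //.
- move=> w /UFE[Fw|[q _ Eq]]; first by exists None; rewrite //= inE.
  exists (Some q) => //=; rewrite inE /=; apply/mapP; exists q => //; by rewrite mem_enum.
rewrite -fsbig_seq// big_cons big_map /= EFinD; apply: leeD => //.
apply: (@le_trans _ _ (\sum_(q <- enum I) s%:E)); first by apply: lee_sum.
by rewrite sumEFin big_const_seq count_predT iter_addr_0 -cardE mulr_natl.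
Qed.

End union.

Section upper_bound.
Variables (R : realType) (d : nat) (x : 'rV[R]_d).
Local Notation W := (field R (edge d)).
Variables (Q : probability W R) (nu : probability R R).
Hypothesis Qcyl : forall J B, (forall i, measurable (B i)) ->
  Q (cylinder J B) = (\prod_(i <- J) nu (B i))%E.
Hypothesis mfin : (moment nu < +oo)%E.
Variable mu : R.
Hypothesis cvmu : t^-1 * fine (ET Q 0 (ray_point x t)) @[t --> +oo] --> mu.
Variables (b c : R -> R) (r : R).
Hypotheses (r01 : 0 < r < 1) (sb : slowly_varying b) (sc : slowly_varying c).
Hypothesis tail : forall t : R, 0 < t ->
  (nu [set s | (t < `|s|)%R] <= (c t * expR (- (b t * t `^ r)))%:E)%E.
Hypotheses (d2 : (2 <= d)%N) (x0 : x != 0).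

Lemma near_nat_scale (P : R -> Prop) (a : R) : 0 < a ->
  (\forall t \near +oo, P t) -> \forall n \near \oo, P (n%:R * a).
Proof.
move=> a0 /near_pinfty_ge[T T1 hT]; near=> n; apply: hT.
by rewrite -ler_pdivrMr//; near: n; exact: nbhs_infty_ger.
Unshelve. all: by end_near. Qed.

Lemma measurable_passage_gt (y : 'rV[int]_d) (s : R) :
  measurable [set w : W | s < fpt setT (fun i => `|w i|) 0 y].
Proof.
rewrite (_ : [set w | _] = (fun w : W => fpt setT (fun i => `|w i|) 0 y) @^-1` `]s, +oo[).
  rewrite -[X in measurable X]setTI.
  by apply: (@measurable_fpt R d (fun t => `|t|)).
by apply/seteqP; split => w /=; rewrite in_itv/= andbT.
Qed.

Lemma ray_mean_limit_ge0 : 0 <= mu.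
Proof.
rewrite leNgt; apply/negP => m0.
have m0' : 0 < - mu by rewrite oppr_gt0.
have /cvgrPdist_lt/(_ _ m0')/near_pinfty_ge[T T1 /(_ T (lexx _))] := cvmu.
have : 0 <= T^-1 * fine (ET Q 0 (ray_point x T)).
  rewrite mulr_ge0 ?invr_ge0 ?(le_trans _ T1)//; exact: fine_ET_ge0.
by move: (_ * fine _) => u u0 /ltr_normlP[]; lra.
Qed.

(** Since [r < 1] the rate at [n * a] is at most a small multiple of [n], and
    [k] is at least about [n / L]. *)
Lemma linear_beats_rate (a kap L A B : R) (C : nat) : 0 < a -> 0 < kap -> 0 < L -> 0 <= B ->
  \forall n \near \oo, forall k : nat, n%:R <= (k + C)%:R * L ->
    A * expR (- (kap * k%:R)) <= expR (- (B * (b (n%:R * a) * (n%:R * a) `^ r))).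
Proof.
move=> a0 kap0 L0 B0; pose g := kap / (2 * L * a * (B + 1)).
have B1 : 0 < B + 1 by lra.
have g0 : 0 < g by rewrite divr_gt0// !mulr_gt0.
near=> n => k nk.
apply: (@le_trans _ _ (expR (A - kap * k%:R))).
  rewrite expRD ler_wpM2r ?expR_ge0//.
  by apply: le_trans (expR_ge1Dx A); lra.
rewrite ler_expR.
have h : b (n%:R * a) * (n%:R * a) `^ r <= g * (n%:R * a).
  by near: n; apply: (near_nat_scale (P := fun t => b t * t `^ r <= g * t)) => //; exact: rate_sublinear.
have hn : 2 * L * (A + kap * C%:R) / kap <= n%:R by near: n; exact: nbhs_infty_ger.
rewrite ler_pdivrMr// in hn.
rewrite natrD in nk.
have hB : B * (b (n%:R * a) * (n%:R * a) `^ r) <= kap * n%:R / (2 * L).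
  apply: le_trans (ler_wpM2l B0 h) _.
  have -> : B * (g * (n%:R * a)) = (kap * n%:R / (2 * L)) * (B / (B + 1)).
    by rewrite /g; field; rewrite !gt_eqF.
  apply: ler_piMr; first by rewrite !(mulr_ge0, invr_ge0)// ltW.
  by rewrite ler_pdivrMr//; lra.
have h2 : kap * n%:R <= kap * (k%:R + C%:R) * L by rewrite -mulrA ler_pM2l.
have h3 : A + kap * C%:R <= kap * n%:R / (2 * L).
  by rewrite ler_pdivlMr ?mulr_gt0//; move: hn; rewrite mulrC [n%:R * _]mulrC.
have h4 : kap * n%:R / L <= kap * (k%:R + C%:R) by rewrite ler_pdivrMr.
have h5 : kap * n%:R / L = 2 * (kap * n%:R / (2 * L)) by field; rewrite gt_eqF.
rewrite h5 in h4; move: h3 h4 hB; move: (kap * n%:R / _) => z h3 h4 hB.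
rewrite mulrDr in h4; move: hB h3 h4; move: (B * _) (kap * k%:R) (kap * C%:R) => u v s; lra.
Unshelve. all: by end_near. Qed.

(** If [T > n * (mu + xi)], then every route has either a deviation of its
    capped blocks or excesses that sum to at least [n * (xi - eta)]. The first
    is exponentially unlikely in [n] for each of the routes; the second has to
    occur on all routes simultaneously. *)
Lemma upper_bound (xi eta e : R) : 0 < eta < xi -> 0 < e < 1 -> \forall n \near \oo,
  (Q [set w | (n%:R * (mu + xi) < fpt setT (fun i => `|w i|) 0 (ray_point x n%:R))%R] <=
   (2 * expR (- ((2 * d)%:R * (1 - e) ^+ 2 *
      (b (n%:R * (xi - eta)) * (n%:R * (xi - eta)) `^ r))))%:E)%E.
Proof.
move=> /andP[eta0 etaxi] e01; have /andP[e0 e1] := e01.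
pose a := xi - eta; have a0 : 0 < a by rewrite subr_gt0.
(* The loss [eta] is shared: three parts for the mean of a block, one for the
   deviation of the blocks, one for the ends of the route and one to spare. *)
have [h h0 etah] : exists2 h, 0 < h & eta = 6 * h.
  by exists (eta / 6); [rewrite divr_gt0|field].
have mu0 := ray_mean_limit_ge0.
have [L [K [D [L0 vstep hD hmean]]]] := block_choice Qcyl mfin cvmu (mulr_gt0 (ltr0n R 3) h0).
have LR : 0 < L%:R :> R by rewrite ltr0n.
pose delta j : 'rV[int]_d := milestone x L%:R j.+1 - milestone x L%:R j.
have [C [m [m0 hroutes]]] := routes d2 x0 LR vstep.
pose Pr (n : nat) := exists k (J : 'I_d * bool -> {fset edge d})
    (c : 'I_d * bool -> nat -> 'rV[int]_d),
  [/\ k%:R * L%:R <= n%:R :> R /\ n%:R <= (k+C)%:R * L%:R :> R,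
      forall q q', q != q' -> [set` J q] `&` [set` J q'] = set0,
      forall q, (#|` J q| <= C + k * #|` box_edges d K|)%N,
      forall q i j, (i = j %[mod m])%N -> i != j ->
        [set` box_at K (c q i)] `&` [set` box_at K (c q j)] = set0 &
      forall (M : nat) q (w : edge d -> R),
        fpt setT (fun e => `|w e|) 0 (ray_point x n%:R) <=
        \sum_(0 <= j < k) fpt [set` box_at K (c q j)] (cap M w) (c q j)
           (c q j + delta j)
        + M%:R * C%:R + \sum_(e <- J q) excess M (w e)].
have {}hroutes : \forall n \near \oo, Pr n by exact: hroutes.
have [K1 K10 hdev] := excess_sum_deviation Qcyl r01 sb sc tail e01.
(* The cap is so large that a route of at most [n * (1 + #|box|)] edges
   satisfies the size condition of [excess_sum_deviation] at [t = n * a]. *)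
pose M := (K1 + (Num.truncn ((1 + #|` box_edges d K|%:R) / (e * a))).+1)%N.
have MK1 : (K1 <= M)%N by exact: leq_addr.
have Mbig : 1 + #|` box_edges d K|%:R <= e * M%:R * a.
  rewrite mulrAC -ler_pdivrMl ?mulr_gt0// mulrC.
  by apply: le_trans (ltW (truncnS_gt _)) _; rewrite ler_nat leq_addl.
pose B : R := M%:R * D%:R + 1; have B0 : 0 < B by rewrite ltr_pwDr// mulr_ge0.
have Lh : 0 < L%:R * h by rewrite mulr_gt0.
have [kap kap0 hblock] :=
  block_deviation Qcyl (L%:R * (mu + 3 * h)) m0 B0 Lh.
pose E2 := (2 * d)%:R * (1 - e) ^+ 2.
have E20 : 0 <= E2 by rewrite mulr_ge0// sqr_ge0.
near=> n.
have hlin : forall k : nat, n%:R <= (k + C)%:R * L%:R :> R ->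
    (#|{: 'I_d * bool}|%:R * m%:R) * expR (- (kap * k%:R)) <=
    expR (- (E2 * (b (n%:R * a) * (n%:R * a) `^ r))).
  by near: n; exact: linear_beats_rate.
have : Pr n by near: n.
move=> [k [J [c0 [[kn nk] dJ cJ dbox hT]]]].
pose X q j (w : W) := fpt [set` box_at K (c0 q j)] (cap M w) (c0 q j) (c0 q j + delta j).
set t := n%:R * a; set rate := b t * t `^ r.
have K1t : K1%:R <= t.
  by rewrite /t -ler_pdivrMr//; near: n; exact: nbhs_infty_ger.
have kn' : (k <= n)%N.
  rewrite -(ler_nat R); apply: le_trans kn; apply: ler_peMr => //.
  by rewrite ler1n.
have Cn : (C <= n)%N by near: n; exact: nbhs_infty_ge.
have MCn : M%:R * C%:R <= h * n%:R.
  by rewrite mulrC -ler_pdivrMl// mulrC; near: n; exact: nbhs_infty_ger.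
have cJt q : #|` J q|%:R <= e * M%:R * t.
  apply: (@le_trans _ _ (n%:R * (1 + #|` box_edges d K|%:R))).
    rewrite mulrDr mulr1 -natrM -natrD ler_nat; apply: leq_trans (cJ q) _.
    by rewrite leq_add// leq_mul2r kn' orbT.
  by rewrite /t [n%:R * a]mulrC mulrA [leRHS]mulrC ler_wpM2l.
have joinX q j : [set` hull_edges (c0 q j) (c0 q j + delta j)] `<=` [set` box_at K (c0 q j)].
  apply: box_at_joined => i; rewrite !mxE (_ : _ - _ =
    milestone x L%:R j.+1 0 i - milestone x L%:R j 0 i); first exact: vstep.
  by rewrite !mxE; move: (Num.floor _) (Num.floor _) (c0 q j 0 i) => u v z; ring.
have mX q j : measurable_fun setT (X q j).
  apply: (@measurable_fpt R d (fun t => Num.min `|t| M%:R)).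
    by apply: measurable_minr; [exact: normr_measurable|exact: measurable_cst].
  by move=> s; rewrite le_min normr_ge0 ler0n.
have Xdep q j : depends_on [set` box_at K (c0 q j)] (X q j).
  by move=> w w' ww'; apply: fpt_depends => i iE; rewrite /cap ww'.
have Xbd q j w : 0 <= X q j w <= B.
  apply/andP; split.
    by apply: fpt_ge0 => i; case/andP: (cap_ge0 M w i).
  apply: (@le_trans _ _ (M%:R * (dist (c0 q j) (c0 q j + delta j))%:R)).
    by apply: hull_edges_fpt => // i; exact: cap_ge0.
  apply: (@le_trans _ _ (M%:R * D%:R)); last by rewrite lerDl.
  rewrite ler_wpM2l// ler_nat; apply: leq_trans (hD j).
  rewrite leq_eqVlt; apply/orP; left; apply/eqP; apply: eq_bigr => i _.
  by rewrite !mxE; move: (Num.floor _) (Num.floor _) (c0 q j 0 i) => u v z; clear; lia.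
have Xmean q j : (\int[Q]_w (X q j w)%:E <= (L%:R * (mu + 3 * h))%:E)%E.
  apply: le_trans (boxed_capped_mean Qcyl _ _ _) (hmean j).
  apply: hull_edges_joined; move=> i /= hi; apply/box_edgesP => v l vi.
  have := hull_edges_in hi vi l; rewrite mxE.
  have := vstep j l; rewrite !mxE.
  by move: (Num.floor _) (Num.floor _) (v 0 l) => u z v'; clear; lia.
have thr (w : W) q : n%:R * (mu + xi) < fpt setT (fun i => `|w i|) 0 (ray_point x n%:R) ->
    \sum_(0 <= j < k) X q j w < (L%:R * (mu + 3 * h) + L%:R * h) * k%:R ->
    t <= \sum_(i <- J q) excess M (w i).
  move=> hw hX; have := hT M q w; rewrite -/(X q _ w).
  have hk : (L%:R * (mu + 3 * h) + L%:R * h) * k%:R <= (mu + 4 * h) * n%:R.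
    rewrite (_ : _ * k%:R = (mu + 4 * h) * (k%:R * L%:R)); last by ring.
    by rewrite ler_wpM2l// addr_ge0// mulr_ge0// ltW.
  rewrite /t /a; have n0 : 0 <= n%:R :> R by [].
  move: hw hX hk MCn n0; rewrite etah.
  move: (\sum_(0 <= j < k) _) (\sum_(e <- J q) _) (fpt _ _ _ _) (M%:R * C%:R) => u v f s.
  move: (_ * k%:R) (n%:R : R) => z nn p1 p2 p3 p4 p5 p6.
  have : 0 <= h * nn by rewrite mulr_ge0// ltW.
  move: p1 p2 p3 p4 p6; rewrite mulrDr [(mu + _) * nn]mulrDl mulrBr -!mulrA [nn * (6 * h)]mulrCA.
  rewrite [nn * mu]mulrC [nn * h]mulrC; move: (mu * nn) (nn * xi) (h * nn).
  by move=> a1 a2 a3 q1 q2 q3 q4 q5 q6; lra.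
set U := [set w | _].
pose F : set W := [set w | forall q, t <= \sum_(i <- J q) excess M (w i)].
pose E q : set W := [set w | (L%:R * (mu + 3 * h) + L%:R * h) * k%:R <= \sum_(0 <= j < k) X q j w].
apply: (@le_trans _ _ (expR (- (E2 * rate)) + #|{: 'I_d * bool}|%:R * (m%:R * expR (- (kap * k%:R))))%:E).
  have := @union_bound _ W R Q ('I_d * bool)%type U F E (expR (- (E2 * rate))) (m%:R * expR (- (kap * k%:R))). apply.
  - exact: measurable_passage_gt.
  - exact: measurable_excess_events.
  - move=> q; rewrite /E (_ : [set w | _] = (fun w => \sum_(0 <= j < k) X q j w)
        @^-1` `[(L%:R * (mu + 3 * h) + L%:R * h) * k%:R, +oo[); last first.
      by apply/seteqP; split => w /=; rewrite in_itv/= andbT.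
    rewrite -[X in measurable X]setTI.
    by apply: (measurable_sum (index_iota 0 k) (mX q)).
  - move=> w Uw; have [Fw|nF] := pselect (F w); first by left.
    right; move/existsNP: nF => [q /negP]; rewrite -ltNge => hq.
    exists q => //=; rewrite /E /= leNgt; apply/negP => hX.
    by move: hq; apply/negP; rewrite -leNgt; exact: thr.
  - apply: le_trans (deviation_intersection Qcyl dJ (expR_ge0 _) _) _.
      by move=> q; exact: (hdev M t (J q) MK1 K1t (cJt q)).
    by rewrite lee_fin -expRM_natl /E2 mulrN -/rate -mulrA.
  - by move=> q; apply: (hblock k (X q) (fun j => [set` box_at K (c0 q j)])) => //; exact: dbox.
rewrite lee_fin [leRHS]mulr_natl mulr2n; apply: lerD => //.
by rewrite [leLHS]mulrA; exact: hlin.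
Unshelve. all: by end_near. Qed.

End upper_bound.

(** * Lower bound *)

Section lower_bound_rate.
Variables (R : realType) (d : nat) (x : 'rV[R]_d).
Local Notation W := (field R (edge d)).
Variables (Q : probability W R) (nu : probability R R).
Hypothesis Qcyl : forall J B, (forall i, measurable (B i)) ->
  Q (cylinder J B) = (\prod_(i <- J) nu (B i))%E.
Hypothesis mfin : (moment nu < +oo)%E.
Variable mu : R.
Hypothesis cvmu : t^-1 * fine (ET Q 0 (ray_point x t)) @[t --> +oo] --> mu.
Hypothesis small_excess : exists2 K : nat, (0 < K)%N &
  forall M : nat, (K <= M)%N -> (\int[nu]_s (excess M s)%:E <= (1 / M%:R)%:E)%E.
Variables (b c : R -> R) (r : R).
Hypothesis tail : forall t : R, 0 < t ->
  ((c t * expR (- (b t * t `^ r)))%:E <= nu [set s | (t < `|s|)%R])%E.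
Hypothesis c0 : forall t, 0 < t -> 0 < c t.
Hypothesis x0 : x != 0.
Local Notation m := (fine (moment nu)).

Lemma prode_ge (T : eqType) (s : seq T) (f : T -> \bar R) (a : R) : 0 <= a ->
  (forall x, x \in s -> a%:E <= f x)%E -> ((a ^+ size s)%:E <= \prod_(x <- s) f x)%E.
Proof.
move=> a0; elim: s => [|y s IH] fa; first by rewrite big_nil expr0.
rewrite big_cons exprS EFinM; apply: lee_pmul; rewrite ?lee_fin ?exprn_ge0//.
  by apply: fa; rewrite inE eqxx.
by apply: IH => z zs; apply: fa; rewrite inE zs orbT.
Qed.

Lemma ray_point_neq0 : \forall n \near \oo, ray_point x n%:R != 0.
Proof.
have /rV0Pn [a xa] := x0.
near=> n; apply/eqP => /rowP/(_ a); rewrite !mxE => h.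
have /andP[h1 h2] := real_floor_itv (num_real (n%:R * x 0 a)).
rewrite h in h1 h2.
have : `|x 0 a|^-1 <= n%:R by near: n; exact: nbhs_infty_ger.
rewrite -(ler_pM2r (_ : 0 < `|x 0 a|)) ?normr_gt0// mulVf ?normr_eq0//.
by rewrite -[X in X * _]ger0_norm// -normrM ger0_norm//; lra.
Unshelve. all: by end_near. Qed.

(** The mean passage time is at least [n * (mu - eps / 4)] for large [n],
    whereas [ET_le_zeroed] with [v = n * (mu - eps)] bounds it by [v + n * eps /
    2] plus a multiple of [n] times the probability. If [mu <= eps] the event is
    certain, which is why [v] is cut off at [0]. *)
Lemma zeroed_likely (eps : R) : 0 < eps -> exists2 kap : R, 0 < kap & \forall n \near \oo,
  (kap%:E <= Q (zeroed_ge (ray_point x n%:R) (Num.max 0 (n%:R * (mu - eps)))%R))%E.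
Proof.
move=> eps0; have [K1 K10 hK1] := small_excess.
pose l := 2 * linear_size x + 1.
have ls0 : 0 <= linear_size x by apply: sumr_ge0 => i _; rewrite addr_ge0.
have l0 : 0 < l by rewrite ltr_wpDl// mulr_ge0.
pose K := (K1 + (Num.truncn (l / (eps / 4))).+1)%N.
have KK1 : (K1 <= K)%N by exact: leq_addr.
have K0 : 0 < K%:R :> R by rewrite ltr0n; exact: leq_trans KK1.
have lK : l / K%:R <= eps / 4.
  rewrite ler_pdivrMr// -ler_pdivrMl ?divr_gt0// mulrC.
  by apply: le_trans (ltW (truncnS_gt _)) _; rewrite ler_nat leq_addl.
exists (Num.min 1 (eps / 4 / (l * K%:R))); first by rewrite lt_min ltr01 !divr_gt0// mulr_gt0.
have [T T1 hT] : exists2 T : R, 1 <= T & forall t, T <= t ->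
    mu - eps / 4 <= t^-1 * fine (ET Q 0 (ray_point x t)).
  have e40 : 0 < eps / 4 by rewrite divr_gt0.
  apply: near_pinfty_ge; have /cvgrPdist_le/(_ _ e40) := cvmu.
  by apply: filterS => t /ler_normlP[_]; move: (_ * fine _) => u; lra.
near=> n.
have nT : T <= n%:R by near: n; exact: nbhs_infty_ger.
have n1 : 1 <= n%:R :> R by exact: le_trans nT.
have n0 : 0 < n%:R :> R by lra.
have [mueps|mueps] := leP (mu - eps) 0.
  rewrite max_l ?mulr_ge0_le0 ?(ltW n0)//.
  rewrite (_ : zeroed_ge _ _ = setT) ?probability_setT ?lee_fin ?ge_min ?lexx//.
  by apply/seteqP; split => w // _; apply: fpt_ge0; exact: zero_star_ge0.
have v0 : 0 <= n%:R * (mu - eps) by rewrite mulr_ge0// ltW.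
rewrite max_r//.
have mZ := measurable_zeroed_ge (ray_point x n%:R) (n%:R * (mu - eps)).
have := ET_le_zeroed Qcyl (ray_point x n%:R) v0 (hK1 _ KK1).
have h1 := hT _ nT; rewrite [leRHS]mulrC ler_pdivlMr// in h1.
rewrite (ET_fin Qcyl mfin).
rewrite -[in moment nu](fineK (_ : moment nu \is a fin_num)); last first.
  by rewrite ge0_fin_numE// moment_ge0.
rewrite -EFinM -EFinD lee_fin => h2.
rewrite -(fineK (_ : Q (zeroed_ge _ _) \is a fin_num)); last exact: fin_num_measure.
rewrite lee_fin ge_min; apply/orP; right.
have q0 : 0 <= fine (Q (zeroed_ge (ray_point x n%:R) (n%:R * (mu - eps)))) by exact: fine_ge0.
have dl : (dist 0 (ray_point x n%:R))%:R <= l * n%:R.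
  apply: le_trans (dist_floor_le x (ltW n0)) _; rewrite /l.
  by move: (linear_size x) ls0 (n%:R : R) n1 => s s0 z z1; nra.
have nm : (2 * d)%:R * m <= eps / 4 * n%:R.
  by rewrite mulrC -ler_pdivrMl ?divr_gt0// mulrC; near: n; exact: nbhs_infty_ger.
move: h1 h2 q0 dl; move: (fine (ET _ _ _)) (fine (Q _)) (dist _ _)%:R => E q D h1 h2 q0 dl.
rewrite ler_pdivrMr ?mulr_gt0//.
have DK : D * K%:R * q <= l * n%:R * K%:R * q by rewrite !ler_wpM2r.
have DK' : D / K%:R <= eps / 4 * n%:R.
  apply: (@le_trans _ _ (l / K%:R * n%:R)); last by rewrite ler_wpM2r.
  by rewrite mulrAC ler_wpM2r ?invr_ge0// ltW.
rewrite -(ler_pM2r n0).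
have -> : q * (l * K%:R) * n%:R = l * n%:R * K%:R * q by ring.
move: (l * n%:R * _ * q) (D * _ * q) (D / _) (_ * m) DK DK' nm h1 h2 => u1 u2 u3 u4.
by move: (n%:R : R) n0 => z z0; nra.
Unshelve. all: by end_near. Qed.

(** The passage time exceeds the sum of [n * (xi + eps)], from the raised edges,
    and [n * (mu - eps / 2)], from the others. *)
Lemma lower_bound (xi eps : R) : 0 < xi -> 0 < eps -> exists2 kap : R, 0 < kap &
  \forall n \near \oo, ((kap * (c (n%:R * (xi + eps)) *
      expR (- (b (n%:R * (xi + eps)) * (n%:R * (xi + eps)) `^ r))) ^+ (2 * d))%R%:E <=
    Q [set w | (n%:R * (mu + xi) < fpt setT (fun e => `|w e|) 0 (ray_point x n%:R))%R])%E.
Proof.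
move=> xi0 eps0; have e20 : 0 < eps / 2 by rewrite divr_gt0.
have [kap kap0 hk] := zeroed_likely e20; exists kap => //.
near=> n.
have n0 : 0 < n%:R :> R by rewrite ltr0n; near: n; exact: nbhs_infty_gt.
have y0 : ray_point x n%:R != 0 by near: n; exact: ray_point_neq0.
pose u := n%:R * (xi + eps); have u0 : 0 < u by rewrite mulr_gt0// addr_gt0.
have hq : (kap%:E <= Q (zeroed_ge (ray_point x n%:R)
    (Num.max 0 (n%:R * (mu - eps / 2)))%R))%E by near: n; exact: hk.
pose v := Num.max 0 (n%:R * (mu - eps / 2)).
rewrite -/v in hq.
rewrite -/u; set p := c u * _.
have p0 : 0 <= p by rewrite mulr_ge0 ?expR_ge0// ltW// c0.
have hp : (p%:E <= nu [set s | (u < `|s|)%R])%E by exact: tail.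
have p1 : p <= 1.
  rewrite -lee_fin; apply: le_trans hp _; exact: probability_le1 (measurable_tail_set u).
apply: (@le_trans _ _ (\prod_(e <- star d) nu [set s | (u < `|s|)%R] *
    Q (zeroed_ge (ray_point x n%:R) v))%E).
  rewrite mulrC EFinM; apply: lee_pmul; rewrite ?lee_fin ?exprn_ge0// ?(ltW kap0)//.
  apply: (@le_trans _ _ (p ^+ #|` star d|)%:E).
    by rewrite lee_fin ler_wiXn2l ?p0//; exact: card_star.
  by apply: prode_ge => // i _; exact: hp.
apply: le_trans (star_raise Qcyl v y0 (ltW u0)) _.
apply: le_measure; rewrite ?inE/=.
- rewrite (_ : [set w | _] = (fun w : W => fpt setT (fun i => `|w i|) 0 (ray_point x n%:R))
      @^-1` `[u + v, +oo[); last by apply/seteqP; split => w /=; rewrite in_itv/= andbT.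
  rewrite -[X in measurable X]setTI.
  by apply: (@measurable_fpt R d (fun t => `|t|)).
- exact: measurable_passage_gt.
move=> w /=; apply: lt_le_trans.
rewrite /u /v.
have : n%:R * (mu - eps / 2) <= Num.max 0 (n%:R * (mu - eps / 2)) by rewrite le_max lexx orbT.
have := mulr_gt0 n0 e20; set s := Num.max _ _; nra.
Unshelve. all: by end_near. Qed.

End lower_bound_rate.

(** * From probability estimates to the limit *)

Section rate_asymptotics.
Variables (R : realType) (r : R).
Hypothesis r01 : 0 < r < 1.

Lemma rate_pinfty (b : R -> R) : slowly_varying b -> b n%:R * n%:R `^ r @[n --> \oo] --> +oo.
Proof.
move=> sb; have /andP[r0 r1] := r01.
have [B B0 hB] := rate_lower sb r0; apply/cvgryPge => A.
have h : \forall t \near +oo, A <= b t * t `^ r.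
  near=> t; apply: (@le_trans _ _ (B * t `^ (r / 2))); last by near: t.
  rewrite mulrC -ler_pdivrMr//.
  have t0 : 0 < t by near: t; apply: nbhs_pinfty_gt; exact: num_real.
  have tA : (A / B) `^ (2 / r) <= t by near: t; apply: nbhs_pinfty_ge; exact: num_real.
  have [AB|AB] := leP (A / B) 0; first by apply: le_trans AB (powR_ge0 _ _).
  have -> : A / B = ((A / B) `^ (2 / r)) `^ (r / 2).
    by rewrite -powRrM (_ : 2 / r * (r / 2) = 1) ?powRr1 1?ltW//; field; rewrite gt_eqF.
  apply: ge0_ler_powR; rewrite ?nnegrE ?powR_ge0 ?(ltW t0)// => //; by rewrite divr_ge0 ?ltW.
have /near_pinfty_ge[T T1 hT] := h; near=> n; apply: hT; near: n; exact: nbhs_infty_ger.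
Unshelve. all: by end_near. Qed.

(** Slow variation makes the rate homogeneous of degree [r] in the limit, also
    across two asymptotically equivalent slowly varying factors. *)
Lemma rate_ratio (f g : R -> R) (a : R) : slowly_varying f -> slowly_varying g ->
  f t / g t @[t --> +oo] --> (1 : R) -> 0 < a ->
  (f (n%:R * a) * (n%:R * a) `^ r) / (g n%:R * n%:R `^ r) @[n --> \oo] --> a `^ r.
Proof.
move=> sf sg fg a0; have [_ f0 fa] := sf; have [_ g0 _] := sg.
have nat_cvg (h : R -> R) (l : R) : h t @[t --> +oo] --> l -> h n%:R @[n --> \oo] --> l.
  move=> hl; exact: (cvg_comp (fun n : nat => n%:R : R) h cvgr_idn hl).
have h : f (a * n%:R) / f n%:R * (f n%:R / g n%:R) * a `^ r @[n --> \oo] --> a `^ r.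
  rewrite -[X in _ --> X]mul1r; apply: cvgMl.
  rewrite -[X in _ --> X]mul1r; apply: cvgM.
    exact: (nat_cvg (fun t => f (a * t) / f t) _ (fa _ a0)).
  exact: (nat_cvg (fun t => f t / g t)).
apply: cvg_trans h; apply: near_eq_cvg; near=> n.
have n0 : 0 < n%:R :> R by rewrite ltr0n; near: n; exact: nbhs_infty_gt.
rewrite [n%:R * a]mulrC powRM ?ltW//.
have := f0 _ n0; have := g0 _ n0; have := powR_gt0 r n0.
move: (f _) (f _) (g _) (n%:R `^ r) => u v s z z0 s0 v0.
by field; rewrite !gt_eqF.
Unshelve. all: by end_near. Qed.

(** For [0 < r < 1] the powers of [1 - e] and [1 + e] are as close to [1] as the
    bases; this makes the choice of [e] in the final limit explicit. *)
Lemma powR_between (e : R) : 0 < e < 1 -> 1 - e <= (1 - e) `^ r /\ (1 + e) `^ r <= 1 + e.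
Proof.
move=> /andP[e0 e1]; have /andP[r0 r1] := r01; split.
  rewrite -[leLHS]powRr1; last by rewrite subr_ge0 ltW.
  rewrite /powR gt_eqF ?subr_gt0//= ler_expR; apply: ler_wnM2r; last exact: ltW.
  by apply: ln_le0; rewrite gerBl ltW.
rewrite -[leRHS]powRr1; last by rewrite addr_ge0 ?ltW.
by apply: ler_powR; [rewrite lerDl ltW|rewrite ltW].
Qed.

End rate_asymptotics.

Section squeeze.
Variables (R : realType) (r xi : R) (d : nat) (b1 b2 c1 : R -> R) (p : nat -> \bar R).
Hypotheses (r01 : 0 < r < 1) (xi0 : 0 < xi).
Hypotheses (sb1 : slowly_varying b1) (sb2 : slowly_varying b2) (sc1 : slowly_varying c1).
Hypothesis b12 : b1 t / b2 t @[t --> +oo] --> (1 : R).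
Hypothesis upper : forall eta e, 0 < eta < xi -> 0 < e < 1 -> \forall n \near \oo,
  (p n <= (2 * expR (- ((2 * d)%:R * (1 - e) ^+ 2 *
      (b2 (n%:R * (xi - eta)) * (n%:R * (xi - eta)) `^ r))))%:E)%E.
Hypothesis lower : forall eps, 0 < eps -> exists2 kap : R, 0 < kap & \forall n \near \oo,
  ((kap * (c1 (n%:R * (xi + eps)) *
      expR (- (b1 (n%:R * (xi + eps)) * (n%:R * (xi + eps)) `^ r))) ^+ (2 * d))%R%:E <= p n)%E.
Let rho n := b1 n%:R * n%:R `^ r.

Lemma rho_gt0 : \forall n \near \oo, 0 < rho n.
Proof.
near=> n; have n0 : 0 < n%:R :> R by rewrite ltr0n; near: n; exact: nbhs_infty_gt.
by rewrite mulr_gt0 ?powR_gt0//; case: sb1 => _ + _; exact.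
Unshelve. all: by end_near. Qed.

Lemma cvg_const_div_rho (a : R) : a / rho n @[n --> \oo] --> 0.
Proof.
rewrite -[X in _ --> X](mulr0 a); apply: cvgMr; apply/gtr0_cvgV0.
  exact: rho_gt0.
exact: rate_pinfty.
Qed.

Let D := 2 * d%:R * xi `^ r.
Let D0 : 0 <= D. Proof. by rewrite !mulr_ge0 ?powR_ge0. Qed.

(** The upper bound with [eta = e * xi] has the exponent [2 * d * (1 - e) ^+ 2 *
    ((1 - e) * xi) `^ r >= D * (1 - e) ^+ 3] in units of [rho n]. It is stated
    for every real [q] below [p n], as the positivity of [p n] comes from
    [log_lower]. *)
Lemma log_upper (e : R) : 0 < e < 1 -> forall z, - (D * (1 - 3 * e)) < z ->
  \forall n \near \oo, forall q : R, 0 < q -> (q%:E <= p n)%E -> ln q / rho n < z.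
Proof.
move=> e01 z hz; have /andP[e0 e1] := e01.
have hb21 : b2 t / b1 t @[t --> +oo] --> (1 : R).
  rewrite (_ : (fun t => _) = (fun t => (b1 t / b2 t)^-1)).
    by rewrite -[X in _ --> X]invr1; apply: cvgV => //; exact: oner_neq0.
  by apply/funext => t; rewrite invf_div.
have a0 : 0 < xi - e * xi by rewrite subr_gt0 gtr_pMl.
have hr := rate_ratio (r := r) sb2 sb1 hb21 a0.
pose E := (2 * d)%:R * (1 - e) ^+ 2.
have hl : ln 2 / rho n - E * ((b2 (n%:R * (xi - e * xi)) * (n%:R * (xi - e * xi)) `^ r) / rho n)
    @[n --> \oo] --> 0 - E * (xi - e * xi) `^ r.
  by apply: cvgB; [exact: cvg_const_div_rho|apply: cvgMr; exact: hr].
have lim_lt : 0 - E * (xi - e * xi) `^ r < z.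
  rewrite sub0r; apply: le_lt_trans hz; rewrite lerN2.
  have -> : xi - e * xi = (1 - e) * xi by ring.
  have e1' : 0 <= 1 - e by rewrite subr_ge0 ltW.
  rewrite powRM ?(ltW xi0)// /E /D natrM.
  have [hpow _] := powR_between r01 e01.
  have -> : 2 * d%:R * (1 - e) ^+ 2 * ((1 - e) `^ r * xi `^ r) =
            2 * d%:R * xi `^ r * ((1 - e) ^+ 2 * (1 - e) `^ r) by ring.
  apply: ler_wpM2l => //; move: ((1 - e) `^ r) hpow => s hs.
  apply: (@le_trans _ _ ((1 - e) ^+ 2 * (1 - e))); last by rewrite ler_wpM2l ?sqr_ge0.
  by nra.
have hlt : \forall n \near \oo,
    ln 2 / rho n - E * ((b2 (n%:R * (xi - e * xi)) * (n%:R * (xi - e * xi)) `^ r) / rho n) < z.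
  by apply: (cvgr_lt _ hl); exact: lim_lt.
near=> n => q q0 qp.
have rho0 : 0 < rho n by near: n; exact: rho_gt0.
have hn : ln 2 / rho n - E * ((b2 (n%:R * (xi - e * xi)) * (n%:R * (xi - e * xi)) `^ r) / rho n) < z by near: n; exact: hlt.
apply: le_lt_trans hn.
have hq : q <= 2 * expR (- (E *
      (b2 (n%:R * (xi - e * xi)) * (n%:R * (xi - e * xi)) `^ r))).
  rewrite -lee_fin; apply: le_trans qp _; near: n; apply: upper => //.
  by rewrite mulr_gt0//= gtr_pMl.
rewrite [E * _]mulrA -mulrBl ler_pM2r ?invr_gt0//.
rewrite -[leRHS]expRK ler_ln ?posrE ?expR_gt0//.
by rewrite expRD lnK ?posrE.
Unshelve. all: by end_near. Qed.

(** The lower bound with [eps = e * xi], where the prefactor [c1] takes another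
    fraction [e] of the exponent, has the exponent at most [D * (1 + e) ^+ 2] in
    units of [rho n]. *)
Lemma log_lower (e : R) : 0 < e < 1 -> forall z, z < - (D * (1 + 3 * e)) ->
  \forall n \near \oo, exists2 q : R, 0 < q & (q%:E <= p n)%E /\ z < ln q / rho n.
Proof.
move=> e01 z hz; have /andP[e0 e1] := e01.
have exi : 0 < e * xi by rewrite mulr_gt0.
have a0 : 0 < xi + e * xi by rewrite addr_gt0.
have hb11 : b1 t / b1 t @[t --> +oo] --> (1 : R).
  apply: cvg_near_cst; near=> t; rewrite divff// gt_eqF//.
  case: sb1 => _ + _; apply.
  by near: t; apply: nbhs_pinfty_gt; exact: num_real.
have hr := rate_ratio (r := r) sb1 sb1 hb11 a0.
have [kap kap0 hk] := lower exi.
pose E := (2 * d)%:R * (1 + e).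
have hl : ln kap / rho n - E * ((b1 (n%:R * (xi + e * xi)) * (n%:R * (xi + e * xi)) `^ r) / rho n)
    @[n --> \oo] --> 0 - E * (xi + e * xi) `^ r.
  by apply: cvgB; [exact: cvg_const_div_rho|apply: cvgMr; exact: hr].
have lim_lt : z < 0 - E * (xi + e * xi) `^ r.
  rewrite sub0r; apply: lt_le_trans hz _; rewrite lerN2.
  have -> : xi + e * xi = (1 + e) * xi by ring.
  have e1' : 0 <= 1 + e by rewrite addr_ge0// ltW.
  rewrite powRM ?(ltW xi0)// /E /D natrM.
  have [_ hpow] := powR_between r01 e01.
  have -> : 2 * d%:R * (1 + e) * ((1 + e) `^ r * xi `^ r) =
            2 * d%:R * xi `^ r * ((1 + e) * (1 + e) `^ r) by ring.
  apply: ler_wpM2l => //; move: ((1 + e) `^ r) hpow => s hs.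
  apply: (@le_trans _ _ ((1 + e) * (1 + e))); first by rewrite ler_wpM2l// addr_ge0// ltW.
  by nra.
have hlt : \forall n \near \oo,
    z < ln kap / rho n - E * ((b1 (n%:R * (xi + e * xi)) * (n%:R * (xi + e * xi)) `^ r) / rho n).
  by apply: (cvgr_gt _ hl); exact: lim_lt.
near=> n.
have rho0 : 0 < rho n by near: n; exact: rho_gt0.
pose P u := expR (- (e * (b1 u * u `^ r))) <= c1 u.
have hc : P (n%:R * (xi + e * xi)).
  near: n; apply: (near_nat_scale (P := P)) => //.
  have /andP[r0 _] := r01.
  by apply: filterS (slowly_varying_subexp sb1 sc1 r0 e0) => t [].
have hkn : ((kap * (c1 (n%:R * (xi + e * xi)) *
      expR (- (b1 (n%:R * (xi + e * xi)) * (n%:R * (xi + e * xi)) `^ r))) ^+ (2 * d))%R%:E <= p n)%E.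
  by near: n; exact: hk.
pose u := n%:R * (xi + e * xi); rewrite /P -/u in hc.
have cu0 : 0 < c1 u by exact: lt_le_trans (expR_gt0 _) hc.
exists (kap * (c1 u * expR (- (b1 u * u `^ r))) ^+ (2 * d)).
  by rewrite mulr_gt0// exprn_gt0// mulr_gt0// expR_gt0.
split; first exact: hkn.
have hn : z < ln kap / rho n - E * ((b1 (n%:R * (xi + e * xi)) * (n%:R * (xi + e * xi)) `^ r) / rho n) by near: n; exact: hlt.
apply: lt_le_trans hn _.
rewrite [E * _]mulrA -mulrBl ler_pM2r ?invr_gt0//.
rewrite lnM ?posrE ?exprn_gt0// ?mulr_gt0 ?expR_gt0// lerD2l lnXn ?mulr_gt0 ?expR_gt0//.
rewrite lnM ?posrE ?expR_gt0// expRK -[leRHS]mulr_natl /E -[X in - X]mulrA -[leLHS]mulrN; apply: ler_wpM2l => //.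
have : - (e * (b1 u * u `^ r)) <= ln (c1 u).
  by rewrite -[leLHS]expRK ler_ln ?posrE ?expR_gt0.
by move: (b1 u * _) (ln _) => s l; lra.
Unshelve. all: by end_near. Qed.

Lemma log_probability_cvg : (forall n, p n \is a fin_num) ->
  ((rho n)^-1%:E * lne (p n))%E @[n --> \oo] --> (- D)%:E.
Proof.
move=> pfin; apply/fine_cvgP.
have e012 : 0 < (1 / 2 : R) < 1 by apply/andP; split; lra.
have pos : \forall n \near \oo, 0 < fine (p n).
  have hz : - (D * (1 + 3 * (1 / 2))) - 1 < - (D * (1 + 3 * (1 / 2))) by rewrite ltrBlDr ltrDl.
  have h := log_lower e012 hz.
  apply: filterS h => n [q q0 [qp _]]; apply: lt_le_trans q0 _.
  by rewrite -lee_fin fineK.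
split.
  apply: filterS pos => n q0; rewrite -(fineK (pfin n)) lne_EFin//.
apply/cvgrPdist_lt => z z0.
pose e := Num.min (1 / 2) (z / (6 * (D + 1))).
have D1 : 0 < 6 * (D + 1) by rewrite mulr_gt0// ltr_wpDl.
have e0 : 0 < e by rewrite lt_min divr_gt0// divr_gt0.
have e01 : 0 < e < 1 by rewrite e0 /= gt_min; apply/orP; left; lra.
have eD : 3 * e * D < z.
  have : e <= z / (6 * (D + 1)) by rewrite ge_min lexx orbT.
  by rewrite ler_pdivlMr// => h; move: D D0 e e0 h {D1 e01} => D' D'0 e' e'0 h; nra.
have hu : - (D * (1 - 3 * e)) < - D + z by move: eD; lra.
have hl : - D - z < - (D * (1 + 3 * e)) by move: eD; lra.
near=> n.
have q0 : 0 < fine (p n) by near: n.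
have h1 : forall q : R, 0 < q -> (q%:E <= p n)%E -> ln q / rho n < - D + z.
  by near: n; exact: log_upper hu.
have [q qq0 [qp hq]] : exists2 q : R, 0 < q & (q%:E <= p n)%E /\ - D - z < ln q / rho n.
  by near: n; exact: log_lower hl.
have rho0 : 0 < rho n by near: n; exact: rho_gt0.
have h3 := h1 _ q0; rewrite fineK// in h3.
rewrite /= -(fineK (pfin n)) lne_EFin//= [_^-1 * _]mulrC ltr_distl.
rewrite -(fineK (pfin n)) lee_fin in qp.
have h4 : ln q / rho n <= ln (fine (p n)) / rho n.
  by rewrite ler_pM2r ?invr_gt0// ler_ln ?posrE.
have := h3 (lexx _); move: (ln _ / _) (ln _ / _) h4 hq => s t.
by move=> *; apply/andP; split; lra.
Unshelve. all: by end_near. Qed.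

End squeeze.

(** * Transfer to the product space *)

Section law.
Variables (R : realType) (d : nat) (disp : measure_display) (Omega : measurableType disp).
Variables (P : probability Omega R) (tau : edge d -> {RV P >-> R}).
Hypothesis tau_iid : iid tau.
Local Notation W := (field R (edge d)).

Definition environment (omega : Omega) : W := fun e => tau e omega.

Lemma measurable_environment : measurable_fun setT environment.
Proof. by apply: measurable_to_field => e; exact: measurable_funPT. Qed.

HB.instance Definition _ :=
  @isMeasurableFun.Build _ _ _ _ environment measurable_environment.

Definition environment_law : probability W R := distribution P environment.

Lemma environment_law_cylinder (e0 : edge d) J B : (forall i, measurable (B i)) ->
  environment_law (cylinder J B) = (\prod_(i <- J) distribution P (tau e0) (B i))%E.
Proof.
have [indep ident] := tau_iid => mB.
have -> : environment_law (cylinder J B) = P (\bigcap_(i in [set` J]) (tau i @^-1` B i)).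
  by congr (P _).
rewrite indep//; apply: eq_bigr => i _.
exact: (ident i e0 _ (mB i)).
Qed.

Lemma integral_environment (f : W -> R) : measurable_fun setT f -> (forall w, 0 <= f w) ->
  (\int[environment_law]_w (f w)%:E = \int[P]_omega (f (environment omega))%:E)%E.
Proof.
move=> mf f0; rewrite ge0_integral_pushforward//=.
- exact/measurable_EFinP.
- by move=> w _; rewrite lee_fin.
Qed.

Hypothesis tau_ge0 : forall e omega, 0 <= tau e omega.

Lemma first_passage_environment (x : 'rV[R]_d) t omega :
  first_passage_time (fun e => tau e omega) 0 (t *: x) =
  fpt setT (fun e => `|environment omega e|) 0 (ray_point x t).
Proof.
rewrite (_ : (fun e => `|_|) = (fun e => tau e omega)); last first.
  by apply/funext => e; rewrite ger0_norm// tau_ge0.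
by rewrite fpt_setT /first_passage_time floor_point0.
Qed.

(** The expectations that define the time constant are those of the product
    space. *)
Lemma time_constantE (x : 'rV[R]_d) (mu : R) :
  t^-1 * fine (ET environment_law 0 (ray_point x t)) @[t --> +oo] --> mu ->
  time_constant tau x = mu.
Proof.
move=> cvmu; apply/cvg_lim => //; apply: cvg_trans cvmu.
rewrite (_ : (fun t => _) = (fun t => t^-1 * fine (ET environment_law 0 (ray_point x t))))//.
apply/funext => t; congr (_ * fine _); rewrite ETE unlock.
rewrite (integral_environment (f := fun w => fpt setT (fun e => `|w e|) 0 (ray_point x t))).
- by apply: eq_integral => omega _; rewrite first_passage_environment.
- by apply: (@measurable_fpt R d (fun t => `|t|)).
- by move=> w; exact: fpt_ge0.
Qed.

End law.

Theorem mainTheorem3 (R : realType) (d : nat) (hd : (2 <= d)%N)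
  (r : R) (hr : 0 < r < 1)
  (c1 c2 b1 b2 : R -> R)
  (hc1 : slowly_varying c1) (hc2 : slowly_varying c2)
  (hb1 : slowly_varying b1) (hb2 : slowly_varying b2)
  (hb12 : b1 t / b2 t @[t --> +oo] --> (1 : R))
  (disp : measure_display) (Omega : measurableType disp)
  (P : probability Omega R) (tau : edge d -> {RV P >-> R})
  (htau_iid : iid tau)
  (htau_ge0 : forall e omega, 0 <= tau e omega)
  (htau_pc : forall e,
     (P [set omega | tau e omega = 0%R] < (critical_probability R d)%:E)%E)
  (htau_tail : forall e (t : R), 0 < t ->
     ((c1 t * expR (- (b1 t * t `^ r)))%:E <= P [set omega | (t < tau e omega)%R]
       <= (c2 t * expR (- (b2 t * t `^ r)))%:E)%E)
  (xi : R) (hxi : 0 < xi) (x : 'rV[R]_d) (hx : x != 0) :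
  (((b1 n%:R * n%:R `^ r)^-1)%:E *
     lne (P [set omega |
       (n%:R * (time_constant tau x + xi) <
         first_passage_time (fun e => tau e omega) 0 (n%:R *: x))%R]))%E
    @[n --> \oo] --> (- (2 * d%:R * xi `^ r))%:E.
Proof.
have d0 : (0 < d)%N by exact: ltn_trans hd.
pose e0 := star_edge (Ordinal d0, true).
pose Q := environment_law tau; pose nu : probability R R := distribution P (tau e0).
have Qcyl : forall J B, (forall i, measurable (B i)) ->
    Q (cylinder J B) = (\prod_(i <- J) nu (B i))%E.
  exact: (environment_law_cylinder htau_iid e0).
have nuE t : nu [set s | (t < `|s|)%R] = P [set omega | (t < tau e0 omega)%R].
  rewrite /nu /distribution /pushforward; congr (P _).
  by apply/seteqP; split => omega /=; rewrite ger0_norm.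
have tail_le t : 0 < t -> (nu [set s | (t < `|s|)%R] <= (c2 t * expR (- (b2 t * t `^ r)))%:E)%E.
  by move=> t0; rewrite nuE; case/andP: (htau_tail e0 t t0).
have tail_ge t : 0 < t -> ((c1 t * expR (- (b1 t * t `^ r)))%:E <= nu [set s | (t < `|s|)%R])%E.
  by move=> t0; rewrite nuE; case/andP: (htau_tail e0 t t0).
have mfin : (moment nu < +oo)%E := moment_lty hr hb2 hc2 tail_le.
have [mu cvmu] := expectation_cvg Qcyl mfin x.
rewrite (time_constantE htau_ge0 cvmu).
pose p n := Q [set w | (n%:R * (mu + xi) < fpt setT (fun e => `|w e|) 0 (ray_point x n%:R))%R].
rewrite (_ : (fun n : nat => _) = (fun n : nat =>
    (b1 n%:R * n%:R `^ r)^-1%:E * lne (p n))%E); last first.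
  apply/funext => n; congr (_ * lne _)%E; congr (P _).
  by apply/seteqP; split => omega /=; rewrite first_passage_environment.
apply: (log_probability_cvg hr hxi hb1 hb2 hc1 hb12).
- by move=> eta e; exact: (upper_bound Qcyl mfin cvmu hr hb2 hc2 tail_le hd hx).
- move=> eps; have [_ c10 _] := hc1.
  apply: (lower_bound Qcyl mfin cvmu _ tail_ge c10 hx hxi).
  exact: (excess_mean hr hb2 hc2 tail_le).
- by move=> n; apply: fin_num_measure; exact: measurable_passage_gt.
Qed.
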